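(* Let $q\ge 1$ and $T$ be integers with $q+3\le T$. Consider the earnings dynamics model $$y_t=v_t+w_t,\qquad v_t=\eta_1+\cdots+\eta_t,\qquad w_t=\xi_t+a_1\xi_{t-1}+\cdots+a_q\xi_{t-q},\qquad t=1,\ldots,T,$$ where $a_1,\ldots,a_q\in\mathbb{R}$ are unknown coefficients and $\xi_{1-q},\ldots,\xi_T,\eta_1,\ldots,\eta_T$ are real-valued unobserved random variables. Assume that $\xi_{1-q},\ldots,\xi_0,(\xi_1,\eta_1),\ldots,(\xi_T,\eta_T)$ are mutually independent (for each $t$, the pair $(\xi_t,\eta_t)$ may be arbitrarily dependent). Assume that $a_1\notin\{0,1\}$ and $a_q\notin\{0,1\}$. If $\xi_1$ is nongaussian, then $a_1,\ldots,a_q$ are identified from the joint distribution of $(y_1,\ldots,y_T)$. That is, if $(a_1,\ldots,a_q,\xi_{1-q},\ldots,\xi_T,\eta_1,\ldots,\eta_T)$ and $(\widetilde a_1,\ldots,\widetilde a_q,\widetilde\xi_{1-q},\ldots,\widetilde\xi_T,\widetilde\eta_1,\ldots,\widetilde\eta_T)$ are two structures such that $\xi_{1-q},\ldots,\xi_0,(\xi_1,\eta_1),\ldots,(\xi_T,\eta_T)$ are mutually independent, $\widetilde\xi_{1-q},\ldots,\widetilde\xi_0,(\widetilde\xi_1,\widetilde\eta_1),\ldots,(\widetilde\xi_T,\widetilde\eta_T)$ are mutually independent, $a_1,a_q,\widetilde a_1,\widetilde a_q\notin\{0,1\}$, and $\xi_1$ and $\widetilde\xi_1$ are both nongaussian,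 and the two structures are observationally equivalent, then $\widetilde a_j=a_j$ for all $j=1,\ldots,q$.
   Context: A structure is a choice of coefficients $(a_1,\ldots,a_q)$ together with a joint distribution of the shocks $(\xi_{1-q},\ldots,\xi_T,\eta_1,\ldots,\eta_T)$. Through the model equations it determines a joint distribution of the observed vector $(y_1,\ldots,y_T)$. Here $v_t$ is the permanent income component (with permanent shocks $\eta_t$) and $w_t$ is the transitory component, a moving average of order $q$ (with transitory shocks $\xi_t$). The integers $q$ and $T$ are known. Two structures are observationally equivalent if they generate the same joint distribution of $(y_1,\ldots,y_T)$. The coefficients are identified if any two observationally equivalent structures satisfying the stated hypotheses have the same coefficients. ''Nongaussian'' means not normally distributed, where a degenerate (almost surely constant) random variable is counted as normal with variance zero. *)

(* Defs.v *)
From HB Require Import structures.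
From mathcomp Require Import all_boot all_order all_algebra finmap.
From mathcomp Require Import all_classical all_reals all_analysis.
From mathcomp Require Import measurable_realfun.

Set Implicit Arguments.
Unset Strict Implicit.
Unset Printing Implicit Defensive.

Import Order.TTheory GRing.Theory Num.Theory.

Local Open Scope classical_set_scope.
Local Open Scope ring_scope.

Section probability_notions.
Context {d : measure_display} {O : measurableType d} {R : realType}.
Variable P : probability O R.

Definition rv_sigma {d' : measure_display} {E : measurableType d'}
    (X : O -> E) : set (set O) :=
  preimage_set_system [set: O] X measurable.

Definition mutual_indep {I : choiceType} (D : set I) (F : I -> set (set O)) :
    Prop :=
  forall J : {fset I}, [set` J] `<=` D ->
  forall E : I -> set O, (forall i, i \in J -> F i (E i)) ->
  P (\bigcap_(i in [set` J]) E i) = (\prod_(i <- J) P (E i))%E.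

(* The degenerate case is a separate disjunct because the library's
   [normal_prob m 0] is the uniform law on [0, 1], not the Dirac mass at m. *)
Definition gaussian (X : {RV P >-> R}) : Prop :=
  (exists m : R, {ae P, forall w, X w = m}) \/
  (exists m s : R, 0 < s /\
     forall A : set R, measurable A ->
       distribution P X A = normal_prob m s A).

End probability_notions.

(* Time indices are used as in the model: [a j] is a_j for 1 <= j <= q, [xi s]
   is the transitory shock of date s for 1 - q <= s <= n, and [eta t] the
   permanent shock of date t for 1 <= t <= n, where n is the number of observed
   periods.  Values outside these ranges enter neither the observed vector nor
   the independence assumption. *)
Section earnings_model.
Context {d : measure_display} {O : measurableType d} {R : realType}.
Context {P : probability O R}.
Variables (q n : nat) (a : nat -> R).
Variables (xi : int -> {RV P >-> R}) (eta : nat -> {RV P >-> R}).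

Definition permanent (t : nat) (w : O) : R := \sum_(1 <= s < t.+1) eta s w.

Definition transitory (t : nat) (w : O) : R :=
  xi t%:Z w + \sum_(1 <= j < q.+1) a j * xi (t%:Z - j%:Z) w.

Definition income (t : nat) (w : O) : R := permanent t w + transitory t w.

Definition observed (w : O) : n.-tuple R := [tuple income i.+1 w | i < n].

Lemma measurable_income t : measurable_fun [set: O] (income t).
Proof.
apply: measurable_funD; first by apply: measurable_sum => s.
apply: measurable_funD => //; apply: measurable_sum => j.
exact: measurable_funM.
Qed.

Lemma measurable_observed : measurable_fun [set: O] observed.
Proof.
apply/measurable_fun_tnthP => i.
rewrite [X in measurable_fun _ X](_ : _ = income i.+1).
  exact: measurable_income.
by apply/funext => w /=; rewrite tnth_mktuple.
Qed.

HB.instance Definition _ :=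
  isMeasurableFun.Build _ _ _ _ observed measurable_observed.

Definition shock_sigma (s : int) : set (set O) :=
  if (s <= 0)%R then rv_sigma (xi s)
  else rv_sigma (fun w => (xi s w, eta `|s|%N w)).

Definition shocks_indep : Prop :=
  mutual_indep P [set s : int | 1 - q%:Z <= s <= n%:Z] shock_sigma.

End earnings_model.

Definition obs_equivalent {R : realType} (q n : nat)
    {d1 : measure_display} {O1 : measurableType d1} {P1 : probability O1 R}
    (a1 : nat -> R) (xi1 : int -> {RV P1 >-> R}) (eta1 : nat -> {RV P1 >-> R})
    {d2 : measure_display} {O2 : measurableType d2} {P2 : probability O2 R}
    (a2 : nat -> R) (xi2 : int -> {RV P2 >-> R}) (eta2 : nat -> {RV P2 >-> R}) :
    Prop :=
  forall A : set (n.-tuple R), measurable A ->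
    distribution P1 (observed q n a1 xi1 eta1) A =
    distribution P2 (observed q n a2 xi2 eta2) A.

(* Main.v *)
(** Near the origin the characteristic function of (y_1, ..., y_T) at u is the
    exponential of a sum over the shocks s of the log-characteristic functions
    (log-modulus and argument) of (xi_s, eta_s), evaluated at linear forms in u.
    If two structures are observationally equivalent, these two sums agree
    near 0.  Mixed second differences in well chosen periods kill all the terms
    but a few; if moreover a_j <> a'_j for some j, eliminating the unknown
    functions of the other structure and of the later shocks shows that all
    the fifth order differences of the log-characteristic function of xi_1
    vanish near 0.  By Frechet's theorem it is there a polynomial of degree at
    most 4, and a case of Marcinkiewicz's theorem makes xi_1 gaussian.

    For the latter, a polynomial log-characteristic function of degree at most 4
    yields all moments, which obey a four-term recursion; hence X has
    exponential moments and satisfies a Stein identity with four cumulants.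
    Boundedness of the characteristic function makes the fourth cumulant
    nonpositive, positivity of the variances of the exponentially tilted laws
    makes it nonnegative and then kills the third; the moment generating
    function is thus gaussian, and it determines the moments, hence the
    characteristic function, hence the law. *)

From HB Require Import structures.
Require Import Defs.
From mathcomp Require Import all_boot all_order all_algebra finmap.
From mathcomp Require Import all_classical all_reals all_analysis.
From mathcomp Require Import measurable_realfun ring lra zify.

Set Implicit Arguments.
Unset Strict Implicit.
Unset Printing Implicit Defensive.

Import Order.TTheory GRing.Theory Num.Theory.
Import numFieldNormedType.Exports.

Local Open Scope ring_scope.

(** * The functional equation of the log-characteristic functions *)

(** Characteristic functions may vanish away from the origin, their arguments are determined only
    modulo [2 pi], and no smoothness is given: hence finite differences instead of derivatives, and
    statements valid only near 0.

    The dates are chosen by reach. Date [q + 3] is the first one beyond the reach of both [xi_1] and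
    [xi_2], while [eta_1] and [eta_2] still enter; it moves the second coordinate of these pairs
    alone, and explains the bound [q + 3 <= n]. Since the last coefficients are nonzero and
    [a j != b j], second differences in the first coordinate turn out to depend on [x - y] only. A
    step [t] in date 2 then shifts [x - y] by [(a 1 - 1) * t] for the pair of date 1 and by 0 for
    the pair of date 2: the latter disappears, and [a 1 != 1] keeps the former.

    The polynomial form of the log-characteristic function is also only local. The moments carry it
    to the whole line: the Stein identity, summed from their recursion, holds for all cosines, sines
    and exponentials, so that large arguments and arbitrary tilts become available. *)

Ltac split_norms := repeat match goal with
  | H : is_true (`|_| < _) |- _ => move: H; rewrite ltr_norml; case/andP; intros
  end.
Ltac norm_lra := clear; intros; split_norms; rewrite ?ltr_norml; try (apply/andP; split); lra.

(* [ring] compares its atoms up to conversion, which is hopeless for values of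
   a function at distinct sums: they are generalized beforehand. *)
Ltac generalize_values h := repeat match goal with
  | |- context [h ?x ?y] => let v := fresh "v" in generalize (h x y); intro v
  end.

Section difference_operators.
Context {R : comNzRingType}.
Implicit Types (h : R -> R -> R) (f : R -> R).

Fixpoint diffs (s : seq R) f (x : R) : R :=
  if s is t :: s' then diffs s' f (x + t) - diffs s' f x else f x.

Definition mixed_diff h x y p r p' r' : R :=
  h (x + p + p') (y + r + r') - h (x + p) (y + r) - h (x + p') (y + r') + h x y.

Definition diff2x h x y k k' : R := mixed_diff h x y k 0 k' 0.

Lemma mixed_diff0l h x y p' r' : mixed_diff h x y 0 0 p' r' = 0.
Proof. by rewrite /mixed_diff !addr0; generalize_values h; ring. Qed.

Lemma mixed_diff0r h x y p r : mixed_diff h x y p r 0 0 = 0.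
Proof. by rewrite /mixed_diff !addr0; generalize_values h; ring. Qed.

Lemma diffs_cons t s f x : diffs (t :: s) f x = diffs s f (x + t) - diffs s f x.
Proof. by []. Qed.

Lemma diffs0 f s x : diffs (0 :: s) f x = 0.
Proof. by rewrite /= addr0 subrr. Qed.

Lemma diff2x_mixed_diff h x y p t s k k' :
  diff2x (fun x y => mixed_diff h x y p t 0 s) x y k k' =
  diff2x h (x + p) (y + t + s) k k' - diff2x h (x + p) (y + t) k k'
   - diff2x h x (y + s) k k' + diff2x h x y k k'.
Proof.
rewrite /diff2x /mixed_diff !addr0.
have e1 Y : h (x + k + k' + p) Y = h (x + p + k + k') Y by congr h; ring.
have e2 Y : h (x + k + p) Y = h (x + p + k) Y by congr h; ring.
have e3 Y : h (x + k' + p) Y = h (x + p + k') Y by congr h; ring.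
rewrite !e1 !e2 !e3.
by generalize_values h; ring.
Qed.

Lemma diffs4_diff2x h z c d k k' :
  diffs [:: c; d; k; k'] (h^~ 0) z =
  diff2x h (z + c + d) 0 k k' - diff2x h (z + c) 0 k k'
   - diff2x h (z + d) 0 k k' + diff2x h z 0 k k'.
Proof. by rewrite /diff2x /mixed_diff /= !addr0; generalize_values h; ring. Qed.

(** The parameter [d] moves the first coordinates at speeds [c], 1, [c'], 1 and leaves [y] fixed.
    Adding the identities at [k + k'] and 0 and subtracting those at [k] and [k'] yields a second
    difference of each function. *)
Lemma diff2x_matching h g h' g' (x x1 x' x1' y c c' k k' : R) :
  let matching d := h (x + c * d) y + g (x1 + d) y = h' (x' + c' * d) y + g' (x1' + d) y in
  matching 0 -> matching k -> matching k' -> matching (k + k') ->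
  diff2x h x y (c * k) (c * k') + diff2x g x1 y k k' =
  diff2x h' x' y (c' * k) (c' * k') + diff2x g' x1' y k k'.
Proof.
move=> /= E0 E1 E2 E3.
have lin (u v w z u' v' w' z' : R) :
    u - v - w + z + (u' - v' - w' + z') = (u + u') - (v + v') - (w + w') + (z + z').
  by ring.
rewrite !mulr0 !addr0 in E0; rewrite !mulrDr !addrA in E3.
by rewrite /diff2x /mixed_diff !addr0 !lin E0 E1 E2 E3.
Qed.

End difference_operators.
Arguments diffs : simpl never.

Section differences.
Context {R : realFieldType}.
Implicit Types (h g : R -> R -> R) (f : R -> R).

Lemma sum5_lt (c1 c2 c3 c4 c5 rho : R) : c1 < rho / 8 -> c2 < rho / 8 -> c3 < rho / 8 ->
  c4 < rho / 8 -> c5 < rho / 8 -> 0 < rho -> c1 + c2 + (c3 + (c4 + c5)) < rho.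
Proof. lra. Qed.

Lemma sum6_lt (c1 c2 c3 c4 c5 rho : R) : c1 < rho / 32 -> c2 < rho / 32 -> c3 < rho / 16 ->
  c4 < rho / 32 -> c5 < rho / 32 -> 0 < rho -> c1 + c2 + (c3 + (c3 + (c4 + c5))) < rho.
Proof. lra. Qed.

Lemma addr_cancel_sub (c d e e' f f' : R) : c + e = d + f -> c + e' = d + f' -> e - e' = f - f'.
Proof. lra. Qed.

(** Locally, second differences in the first coordinate are functions of [x - y] alone; this is the
    form in which [diagonal_invariant_diffs] exploits it. *)
Definition diagonal_invariant h : Prop :=
  exists2 r : R, 0 < r & forall x y t k k' : R, `|x| < r -> `|y| < r -> `|t| < r ->
    `|k| < r -> `|k'| < r -> diff2x h (x + t) (y + t) k k' = diff2x h x y k k'.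

Lemma small_scale (c r : R) : 0 < r ->
  exists2 e : R, 0 < e & e <= r /\ forall v : R, `|v| < e -> `|c * v| < r.
Proof.
move=> r0; have K0 : 0 < 1 + `|c| by rewrite ltr_pwDl.
(* The added 1 covers [c = 0] and makes the radius at most [r]. *)
exists (r / (1 + `|c|)); first by rewrite divr_gt0.
split=> [|v]; first by rewrite ler_pdivrMr//; apply: ler_peMr; [exact: ltW | rewrite lerDl].
rewrite ltr_pdivlMr// normrM; apply: le_lt_trans.
by rewrite mulrC ler_wpM2l// lerDr.
Qed.

(** Along the line on which [u + be * v] and [u + v + w] stay fixed, the right-hand side is constant
    while the first argument on the left moves by [(al - be) * v]. *)
Lemma invariant_of_matching (F G : R -> R -> R -> R -> R) (al be rho : R) :
  0 < rho -> al != be ->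
  (forall t s u v w : R, `|t| < rho -> `|s| < rho -> `|u| < rho -> `|v| < rho -> `|w| < rho ->
    F t s (u + al * v) (u + v + w) = G t s (u + be * v) (u + v + w)) ->
  exists2 r : R, 0 < r & forall t s x y d : R, `|t| < r -> `|s| < r ->
    `|x| < r -> `|y| < r -> `|d| < r -> F t s (x + d) y = F t s x y.
Proof.
move=> rho0 albe FG.
have rho4 : 0 < rho / 4 by lra.
have [e1 e10 [e1r e1P]] := small_scale be rho4.
have [e2 e20 [e2r e2P]] := small_scale (al - be)^-1 e10.
exists (Num.min e2 (rho / 4)); first by rewrite lt_min e20.
move=> t s x y d; rewrite !lt_min => /andP[_ ht] /andP[_ hs] /andP[_ hx] /andP[_ hy] /andP[hd _].
have := e2P _ hd; set v := _ * d => hv; have hbv := e1P _ hv.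
have dE : d = (al - be) * v by rewrite /v mulrA divff ?mul1r// subr_eq0.
have H1 := FG t s (x - be * v) v (y - x + be * v - v).
have H0 := FG t s x 0 (y - x).
have Ex : x + d = x - be * v + al * v by rewrite dE; ring.
have Ey : y = x - be * v + v + (y - x + be * v - v) by ring.
have hrho (c : R) : `|c| < rho / 4 -> `|c| < rho by move: rho0; norm_lra.
have hv4 := lt_le_trans hv e1r.
have -> : F t s (x + d) y = G t s x y.
  move: H1; rewrite -Ex -Ey subrK; apply; (try by apply: hrho); first by move: hx hbv rho0; norm_lra.
  by move: hx hy hbv hv4; norm_lra.
symmetry; move: H0; rewrite !mulr0 !addr0 (addrC x (y - x)) subrK; apply; (try by apply: hrho); first by rewrite normr0.
by move: hx hy rho0; norm_lra.
Qed.

(** Expanded, each side is the difference along the diagonal step [t] of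
    [h (x + c * s) (y + s) - h x (y + s)]. Its independence of [x] is the diagonal invariance, with
    [k = c * s] arbitrary as [c != 0]. *)
Lemma diagonal_invariantP h g (al be c c' rho : R) : 0 < rho -> al != be -> c != 0 ->
  (forall t s u v w : R, `|t| < rho -> `|s| < rho -> `|u| < rho -> `|v| < rho -> `|w| < rho ->
    mixed_diff h (u + al * v) (u + v + w) t t (c * s) s -
      mixed_diff h (u + al * v) (u + v + w) t t 0 s =
    mixed_diff g (u + be * v) (u + v + w) t t (c' * s) s -
      mixed_diff g (u + be * v) (u + v + w) t t 0 s) ->
  diagonal_invariant h.
Proof.
move=> rho0 albe c0 H.
have [r r0 rP] := invariant_of_matching
  (F := fun t s x y => mixed_diff h x y t t (c * s) s - mixed_diff h x y t t 0 s)
  (G := fun t s x y => mixed_diff g x y t t (c' * s) s - mixed_diff g x y t t 0 s)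
  rho0 albe H.
have r2 : 0 < r / 2 by lra.
have [e e0 [er eP]] := small_scale c^-1 r2.
exists (Num.min e (r / 2)); first by rewrite lt_min e0.
move=> x y t k k'; rewrite !lt_min => /andP[_ hx] /andP[_ hy] /andP[_ ht] /andP[hk _] /andP[_ hk'].
have := eP _ hk; set s := _ * k => hs.
have kE : k = c * s by rewrite /s mulrA divff ?mul1r.
(* The base point is [(x, y - s)] because the increment [s] brings the second coordinate back to
   [y]. *)
have := rP t s x (y - s) k'; rewrite /diff2x /mixed_diff -kE.
have -> : y - s + t + s = y + t by ring.
rewrite !(addr0, subrK) => /(_ _ _ _ _ _)-H2.
have h3 : `|y - s| < r by move: hy hs; norm_lra.
have hr (u : R) : `|u| < r / 2 -> `|u| < r by move: r0; norm_lra.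
have {}H2 := H2 (hr _ ht) (hr _ hs) (hr _ hx) h3 (hr _ hk').
rewrite (_ : x + t + k + k' = x + k' + t + k); last by ring.
rewrite (_ : x + t + k = x + t + k)// (_ : x + t + k' = x + k' + t); last by ring.
rewrite (_ : x + k + k' = x + k' + k); last by ring.
lra.
Qed.


(** * Loads of the shocks and the balance equation *)

Definition ma_coef (q : nat) (a : nat -> R) (j : nat) : R :=
  if j == 0%N then 1 else if (j <= q)%N then a j else 0.

(* Shock [k] of the model is the one of date [k + 1 - q]; period [i] is the one
   of date [i + 1]. *)
Definition xload q a k i : R := if (k <= i + q)%N then ma_coef q a (i + q - k) else 0.
Definition yload q k i : R := ((q <= k) && (k <= i + q))%N%:R.

Implicit Types (l : seq (nat * R)) (H G : nat -> R -> R -> R).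
Definition xlin q a k l : R := \sum_(p <- l) p.2 * xload q a k p.1.
Definition ylin q k l : R := \sum_(p <- l) p.2 * yload q k p.1.

(** [H] and [G] will be the log-moduli, or the arguments, of the shock pairs of the two structures,
    and [l] the point at which the joint characteristic function is taken. A list of weighted
    periods, repetitions allowed, makes a perturbation a mere [cons]. *)
Definition balanced q n (a b : nat -> R) H G rho : Prop :=
  forall l, all (fun p => p.1 < n)%N l -> \sum_(p <- l) `|p.2| < rho ->
  \sum_(k < q + n) H k (xlin q a k l) (ylin q k l) =
  \sum_(k < q + n) G k (xlin q b k l) (ylin q k l).

Lemma balanced_sym q n a b H G rho :
  balanced q n a b H G rho -> balanced q n b a G H rho.
Proof. by move=> B l hl sl; rewrite B. Qed.

Lemma sum_mixed_diff q n (a : nat -> R) H l i1 (t : R) i2 (s : R) :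
  let S m := \sum_(k < q + n) H k (xlin q a k m) (ylin q k m) in
  \sum_(k < q + n) mixed_diff (H k) (xlin q a k l) (ylin q k l)
    (t * xload q a k i1) (t * yload q k i1) (s * xload q a k i2) (s * yload q k i2) =
  S [:: (i1, t), (i2, s) & l] - S ((i1, t) :: l) - S ((i2, s) :: l) + S l.
Proof.
move=> S; rewrite /S -!sumrB -big_split/=; apply: eq_bigr => k _.
rewrite /mixed_diff /xlin /ylin !big_cons/=.
congr (H _ _ _ - H _ _ _ - H _ _ _ + _); ring.
Qed.

(** A shock survives only if it enters both periods. Shocks of index below [q], that is dated 0 or
    earlier, do not reach a period [i2 >= q]; those of index above [q + i1] come after period
    [i1]. *)
Lemma sum_mixed_diff_shared q n (a : nat -> R) H l i1 (t : R) i2 (s : R) : (i1 < n)%N -> (q <= i2)%N ->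
  \sum_(k < q + n) mixed_diff (H k) (xlin q a k l) (ylin q k l)
    (t * xload q a k i1) (t * yload q k i1) (s * xload q a k i2) (s * yload q k i2) =
  \sum_(j < i1.+1) mixed_diff (H (q + j)%N) (xlin q a (q + j) l) (ylin q (q + j) l)
    (t * xload q a (q + j) i1) (t * yload q (q + j) i1)
    (s * xload q a (q + j) i2) (s * yload q (q + j) i2).
Proof.
move=> i1n qi2.
rewrite -(big_mkord xpredT (fun k => mixed_diff (H k) (xlin q a k l) (ylin q k l)
    (t * xload q a k i1) (t * yload q k i1) (s * xload q a k i2) (s * yload q k i2))).
rewrite (@big_cat_nat _ _ _ q)//=; last lia.
rewrite big_nat big1 ?add0r; last first.
  move=> k kq; rewrite (_ : xload q a k i2 = 0); last first.
    by rewrite /xload /ma_coef; case: ifP => // ?; rewrite ifN ?ifN//; lia.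
  by rewrite (_ : yload q k i2 = 0) ?mulr0 ?mixed_diff0r// /yload; case: leqP => //=; lia.
rewrite (@big_cat_nat _ _ _ (i1.+1 + q))//=; try lia.
rewrite [X in _ + X]big_nat [X in _ + X]big1 ?addr0; last first.
  move=> k kq; rewrite (_ : xload q a k i1 = 0); last first.
    by rewrite /xload ifN//; lia.
  by rewrite (_ : yload q k i1 = 0) ?mulr0 ?mixed_diff0l// /yload andbC; case: leqP => //=; lia.
rewrite -{1}[q]add0n big_addn addnK big_mkord; apply: eq_bigr => j _.
by rewrite addnC.
Qed.

Lemma balanced_mixed_diff q n a b H G (rho : R) l i1 (t : R) i2 (s : R) : balanced q n a b H G rho ->
  (i1 < n)%N -> (q <= i2 < n)%N -> all (fun p => p.1 < n)%N l ->
  `|t| + `|s| + \sum_(p <- l) `|p.2| < rho ->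
  \sum_(j < i1.+1) mixed_diff (H (q + j)%N) (xlin q a (q + j) l) (ylin q (q + j) l)
    (t * xload q a (q + j) i1) (t * yload q (q + j) i1)
    (s * xload q a (q + j) i2) (s * yload q (q + j) i2) =
  \sum_(j < i1.+1) mixed_diff (G (q + j)%N) (xlin q b (q + j) l) (ylin q (q + j) l)
    (t * xload q b (q + j) i1) (t * yload q (q + j) i1)
    (s * xload q b (q + j) i2) (s * yload q (q + j) i2).
Proof.
move=> B i1n /andP[qi2 i2n] ln small.
have [t0 s0] := (normr_ge0 t, normr_ge0 s).
rewrite -!(@sum_mixed_diff_shared q n)// !sum_mixed_diff.
by rewrite !B//= ?i1n ?i2n// ?big_cons/= ?ln//; lra.
Qed.

Lemma ma_coef_gt q a i : (q < i)%N -> ma_coef q a i = 0.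
Proof. by move=> qi; rewrite /ma_coef !ifN//; lia. Qed.

Lemma ma_coefE q a i : (0 < i <= q)%N -> ma_coef q a i = a i.
Proof. by case/andP => i0 iq; rewrite /ma_coef iq ifN//; lia. Qed.

Lemma xload_first q a i : xload q a q i = ma_coef q a i.
Proof. by rewrite /xload leq_addl addnK. Qed.

Lemma yload_first q i : yload q q i = 1.
Proof. by rewrite /yload leqnn leq_addl. Qed.

Lemma xload_second q a i : xload q a q.+1 i.+1 = ma_coef q a i.
Proof. by rewrite /xload ifT; [congr ma_coef; lia | lia]. Qed.

Lemma yload_second q i : yload q q.+1 i.+1 = 1.
Proof. by rewrite /yload (_ : (_ && _) = true)//; lia. Qed.

Definition loadE := (xload_first, yload_first, xload_second, yload_second).

(** Each second difference can be slid along the diagonal to second coordinate 0. The four corners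
    of the mixed difference then sit at [x - y] plus [p - t - s], [p - t], [- s] and 0, which is a
    double difference with steps [p - t] and [- s]. *)
Lemma diagonal_invariant_diffs h : diagonal_invariant h ->
  exists2 r : R, 0 < r & forall x y p t s k k' : R, `|x| < r -> `|y| < r -> `|p| < r ->
    `|t| < r -> `|s| < r -> `|k| < r -> `|k'| < r ->
  diff2x (fun x y => mixed_diff h x y p t 0 s) x y k k' =
  diffs [:: p - t; - s; k; k'] (h^~ 0) (x - y).
Proof.
case=> r r0 D; exists (r / 4); first lra.
move=> x y p t s k k' hx hy hp ht hs hk hk'.
have hr (u : R) : `|u| < r / 4 -> `|u| < r by move: r0; norm_lra.
have D0 (X Y : R) : `|X| < r -> `|Y| < r -> diff2x h X Y k k' = diff2x h (X - Y) 0 k k'.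
  by move=> hX hY; rewrite -(D X Y (- Y)) ?subrr ?normrN// hr.
rewrite diff2x_mixed_diff diffs4_diff2x.
rewrite (D0 (x + p) (y + t + s)) ?(D0 (x + p) (y + t)) ?(D0 x (y + s)) ?(D0 x y); (try by apply: hr); try by move: hx hp hy ht hs r0; norm_lra.
by congr (_ - _ - _ + _); congr diff2x; ring.
Qed.

(** * Elimination of the other structure for the shock pairs of dates 1 and 2 *)

Section core.
Variables (q n : nat) (a b : nat -> R) (H G : nat -> R -> R -> R) (rho : R) (j : nat).
Hypotheses (q0 : (0 < q)%N) (qn : (q + 3 <= n)%N) (rho0 : 0 < rho).
Hypotheses (jq : (0 < j <= q)%N) (abj : a j != b j) (aq : a q != 0).
Hypothesis B : balanced q n a b H G rho.

(** A mixed difference in periods [0] and [i2 >= q] isolates the pair of date 1. Its [xi] has load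
    [a q] in period [q] and 0 in period [q.+2], and subtracting these two choices gives the shape of
    [diagonal_invariantP]. The weights [u], [v], [w] on periods [0], [j], [q.+2] place the base
    point at [(u + a j * v, u + v + w)]. *)
Lemma first_diagonal : diagonal_invariant (H q).
Proof.
have r0 : 0 < rho / 8 by rewrite divr_gt0.
apply: (@diagonal_invariantP _ (G q) (a j) (b j) (a q) (b q) (rho / 8)) => //.
move=> t s u v w ht hs hu hv hw.
have E i2 : (q <= i2 < n)%N ->
   mixed_diff (H q) (u + a j * v) (u + v + w) t t (ma_coef q a i2 * s) s =
   mixed_diff (G q) (u + b j * v) (u + v + w) t t (ma_coef q b i2 * s) s.
  move=> i2n; have := @balanced_mixed_diff q n a b H G rho
    [:: (0%N, u); (j, v); (q.+2, w)] 0 t i2 s B.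
  rewrite !big_ord1 /xlin /ylin !big_cons !big_nil /= addn0 !loadE !addr0.
  rewrite !(@ma_coef_gt q _ q.+2)// !(@ma_coefE q _ j)// !/(ma_coef _ _ 0) /= !mulr1 !mulr0 !addr0.
  rewrite (mulrC v (a j)) (mulrC v (b j)) (mulrC s (ma_coef q a i2)) (mulrC s (ma_coef q b i2)) (addrA u v w); apply; [lia | lia | by rewrite andbT; lia |].
  exact: sum5_lt.
have := E q; have := E q.+2.
rewrite !(@ma_coef_gt q _ q.+2)// !(@ma_coefE q _ q) ?q0 ?leqnn// !mul0r.
by move=> E2 E1; rewrite E1 ?E2; try lia.
Qed.

(** With period [1] in place of [0], the pairs of dates 1 and 2 survive. Period [i2.+1] lies beyond
    the reach of [xi] of date 1, whence the increment [(0, s)] in the terms of index [q]. *)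
Lemma balanced_second l (t : R) i2 (s : R) : all (fun p => p.1 < n)%N l ->
    `|t| + `|s| + \sum_(p <- l) `|p.2| < rho -> (q < i2.+1 < n)%N ->
  mixed_diff (H q) (xlin q a q l) (ylin q q l)
    (t * a 1%N) t 0 s +
  mixed_diff (H q.+1) (xlin q a q.+1 l) (ylin q q.+1 l)
    t t (ma_coef q a i2 * s) s =
  mixed_diff (G q) (xlin q b q l) (ylin q q l)
    (t * b 1%N) t 0 s +
  mixed_diff (G q.+1) (xlin q b q.+1 l) (ylin q q.+1 l)
    t t (ma_coef q b i2 * s) s.
Proof.
move=> ln small i2n.
have := @balanced_mixed_diff q n a b H G rho l 1 t i2.+1 s B.
rewrite !big_ord_recl !big_ord0 /= /bump /= !addn0 !addn1.
have z (c : nat -> R) : ma_coef q c i2.+1 = 0 by apply: ma_coef_gt; lia.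
rewrite !loadE !z.
rewrite !(@ma_coefE q _ 1)// !/(ma_coef _ _ 0) /= !mulr1 !mulr0 !addr0.
rewrite (mulrC s (ma_coef q a i2)) (mulrC s (ma_coef q b i2)); apply; [lia | lia | exact: ln | exact: small].
Qed.

(** The scheme of [first_diagonal], one period later. The terms of index [q] in [balanced_second] do
    not involve [i2], so they cancel between [i2 = q] and [i2 = q.+1]. *)
Lemma second_diagonal : diagonal_invariant (H q.+1).
Proof.
have r0 : 0 < rho / 8 by rewrite divr_gt0.
apply: (@diagonal_invariantP _ (G q.+1) (a j) (b j) (a q) (b q) (rho / 8)) => //.
move=> t s u v w ht hs hu hv hw.
have ln : all (fun p => p.1 < n)%N [:: (1%N, u); (j.+1, v); (q.+2, w)].
  by rewrite /= !andbT; lia.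
have small : `|t| + `|s| + \sum_(p <- [:: (1%N, u); (j.+1, v); (q.+2, w)]) `|p.2| < rho.
  by rewrite !big_cons big_nil /= addr0; exact: sum5_lt.
have q2n : (q.+2 < n)%N by move: qn; rewrite addn3.
have E1 := balanced_second (i2 := q) ln small.
have E2 := balanced_second (i2 := q.+1) ln small.
move: E1 E2; rewrite ltnSn (ltnW q2n) ltnW// q2n => /(_ isT) E1 /(_ isT) E2.
move: E1 E2.
rewrite !(@ma_coef_gt q _ q.+1)// !(@ma_coefE q _ q) ?q0 ?leqnn//.
rewrite /xlin /ylin !big_cons !big_nil /= !loadE !addr0.
rewrite !(@ma_coefE q _ j)// !/(ma_coef _ _ 0) !(@ma_coef_gt q _ q.+1)//= !mulr1 !mulr0 !mul0r !addr0.
rewrite (mulrC v (a j)) (mulrC v (b j)) (addrA u v w).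
exact: addr_cancel_sub.
Qed.

End core.

(** The five steps have three sources: [(a j - b j) * v] compares two values of [v] in an identity
    whose other side is free of [v]; [(a 1 - 1) * t] and [- s] come from the mixed difference;
    [a 1 * k] and [a 1 * k'] come from moving the weight on period [1]. *)
Theorem balanced_diffs5 q n a b H G rho j :
    (0 < q)%N -> (q + 3 <= n)%N -> 0 < rho -> (0 < j <= q)%N -> a j != b j ->
    a 1%N != 0 -> a 1%N != 1 -> a q != 0 -> b q != 0 -> balanced q n a b H G rho ->
  exists2 r : R, 0 < r & forall z d1 d2 d3 d4 d5 : R, `|z| < r -> `|d1| < r ->
    `|d2| < r -> `|d3| < r -> `|d4| < r -> `|d5| < r ->
  diffs [:: d1; d2; d3; d4; d5] ((H q)^~ 0) z = 0.
Proof.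
move=> q0 qn rho0 jq abj a10 a11 aq bq B.
have baj : b j != a j by rewrite eq_sym.
have B' := balanced_sym B.
have [r1 r10 D1] := diagonal_invariant_diffs (first_diagonal q0 qn rho0 jq abj aq B).
have [r2 r20 D2] := diagonal_invariant_diffs (first_diagonal q0 qn rho0 jq baj bq B').
have [r3 r30 D3] := diagonal_invariant_diffs (second_diagonal q0 qn rho0 jq abj aq B).
have [r4 r40 D4] := diagonal_invariant_diffs (second_diagonal q0 qn rho0 jq baj bq B').
pose r := Num.min (Num.min r1 r2) (Num.min (Num.min r3 r4) (rho / 32)).
have r0 : 0 < r by rewrite !lt_min r10 r20 r30 r40 /= divr_gt0.
have small (x : R) : `|x| < r -> [/\ `|x| < r1, `|x| < r2, `|x| < r3, `|x| < r4 & `|x| < rho / 32].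
  by rewrite !lt_min => /andP[/andP[-> ->] /andP[/andP[-> ->] ->]].
have s1 (x : R) : `|x| < r -> `|x| < r1 by move=> /small[].
have s2 (x : R) : `|x| < r -> `|x| < r2 by move=> /small[].
have s3 (x : R) : `|x| < r -> `|x| < r3 by move=> /small[].
have s4 (x : R) : `|x| < r -> `|x| < r4 by move=> /small[].
have s5 (x : R) : `|x| < r -> `|x| < rho / 32 by move=> /small[].
have q2n : (q.+2 < n)%N by move: qn; rewrite addn3.
have jn : (j < n)%N by case/andP: jq => _ /leq_ltn_trans; apply; exact: ltn_trans q2n.
have j0 : j = j.-1.+1 by rewrite prednK//; case/andP: jq.
have eq4 (v z t s k k' : R) : `|v| < r -> `|a j * v| < r -> `|b j * v| < r ->
   `|b j * v - z| < r -> `|(b j - 1) * v - z| < r -> `|ma_coef q a j.-1 * v| < r ->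
   `|ma_coef q b j.-1 * v| < r -> `|t| < r -> `|a 1%N * t| < r -> `|b 1%N * t| < r ->
   `|s| < r -> `|k| < r -> `|a 1%N * k| < r -> `|b 1%N * k| < r ->
   `|k'| < r -> `|a 1%N * k'| < r -> `|b 1%N * k'| < r ->
   diffs [:: a 1%N * t - t; - s; a 1%N * k; a 1%N * k'] ((H q)^~ 0) (z + (a j - b j) * v) =
   diffs [:: b 1%N * t - t; - s; b 1%N * k; b 1%N * k'] ((G q)^~ 0) z.
  move=> hv hav hbv hz hz1 hmav hmbv ht hat hbt hs hk hak hbk hk' hak' hbk'.
  pose Qa x y := mixed_diff (H q) x y (a 1%N * t) t 0 s.
  pose Qb x y := mixed_diff (G q) x y (b 1%N * t) t 0 s.
  pose Sa x y := mixed_diff (H q.+1) x y t t 0 s.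
  pose Sb x y := mixed_diff (G q.+1) x y t t 0 s.
  (* The weights [c] on period [1] and [- c] on period [q.+2] move the first coordinates of the two
     pairs by [a 1 * c] (resp. [b 1 * c]) and [c], and no second coordinate. The last weight sets
     the common second coordinate to [b j * v - z], so that [x - y] equals [z] for the pair of date
     1 in the structure [b], whatever [v] is. *)
  have E (c : R) : `|c| < rho / 16 ->
      Qa (a j * v + a 1%N * c) (b j * v - z) + Sa (ma_coef q a j.-1 * v + c) (b j * v - z) =
      Qb (b j * v + b 1%N * c) (b j * v - z) + Sb (ma_coef q b j.-1 * v + c) (b j * v - z).
    move=> hc; have := balanced_second q0 qn rho0 jq abj aq B (i2 := q.+1) (t := t) (s := s)
      (l := [:: (1%N, c); (q.+2, - c); (j, v); (q.+2, (b j - 1) * v - z)]).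
    rewrite !(@ma_coef_gt q _ q.+1)// /xlin /ylin !big_cons !big_nil /=.
    rewrite [in xload q a q.+1 j]j0 [in xload q b q.+1 j]j0 [in yload q q.+1 j]j0 !loadE.
    rewrite !(@ma_coefE q _ 1)// !(@ma_coefE q _ j)// !/(ma_coef _ _ 0) !(@ma_coef_gt q _ q.+1)// !(@ma_coef_gt q _ q.+2)//=.
    rewrite !mulr1 !mulr0 !mul0r !addr0 !add0r normrN.
    rewrite (_ : c + (- c + (v + ((b j - 1) * v - z))) = b j * v - z); last by clear; ring.
    rewrite (addrC (c * a 1%N)) (addrC (c * b 1%N)) (addrC c (v * ma_coef q a j.-1)) (addrC c (v * ma_coef q b j.-1)).
    rewrite (mulrC v (a j)) (mulrC v (b j)) (mulrC v (ma_coef q a j.-1)) (mulrC v (ma_coef q b j.-1)).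
    rewrite (mulrC c (a 1%N)) (mulrC c (b 1%N)) (mulrC t (a 1%N)) (mulrC t (b 1%N)).
    apply; [by rewrite (ltn_trans _ q2n)// q2n jn | by apply: sum6_lt => //; apply: s5|].
    by rewrite ltnW.
  have h1 := s5 _ hk; have h2 := s5 _ hk'.
  have rho16 : 0 < rho / 16 by rewrite divr_gt0.
  have h1' : `|k| < rho / 16 by move: h1 rho0; clear; lra.
  have h2' : `|k'| < rho / 16 by move: h2 rho0; clear; lra.
  have h3 : `|k + k'| < rho / 16 by move: h1 h2; norm_lra.
  have E0 := E 0; rewrite normr0 in E0; have {}E0 := E0 rho16.
  have := diff2x_matching E0 (E k h1') (E k' h2') (E (k + k') h3).
  rewrite /Qa /Qb /Sa /Sb.
  rewrite D1; try exact: s1.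
  rewrite D2; try exact: s2.
  rewrite D3; try exact: s3.
  rewrite D4; try exact: s4.
  (* For the pair of date 2 both coordinates move by [t], so one of its steps is [t - t] and its
     terms vanish on both sides. *)
  rewrite !subrr !diffs0 !addr0.
  rewrite (_ : a j * v - (b j * v - z) = z + (a j - b j) * v); last ring.
  by rewrite (_ : b j * v - (b j * v - z) = z)//; ring.
have {}eq4 := eq4.
have a11' : a 1%N - 1 != 0 by rewrite subr_eq0.
have abj' : a j - b j != 0 by rewrite subr_eq0.
have r8 : 0 < r / 2 by rewrite divr_gt0.
(* All the factors whose products with a parameter must be small in [eq4], and 1 for the parameter
   itself. *)
pose cs := [:: a 1%N; b 1%N; a j; b j; ma_coef q a j.-1; ma_coef q b j.-1; b j - 1; 1].
have [e e0 [er eP]] : exists2 e, 0 < e & e <= r / 2 /\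
    forall x : R, `|x| < e -> all (fun c => `|c * x| < r / 2) cs.
  elim: cs => [|c cs [e e0 [er IH]]]; first by exists (r / 2).
  have [e' e'0 [e'r cP]] := small_scale c r8.
  exists (Num.min e e'); first by rewrite lt_min e0.
  split; first by rewrite ge_min er.
  by move=> x; rewrite lt_min => /andP[/IH xe /cP xe'] /=; rewrite xe xe'.
have [f1 f10 [f1r fP1]] := small_scale (a j - b j)^-1 e0.
have [f2 f20 [f2r fP2]] := small_scale (a 1%N - 1)^-1 e0.
have [f3 f30 [f3r fP3]] := small_scale (a 1%N)^-1 e0.
exists (Num.min (Num.min f1 f2) f3); first by rewrite !lt_min f10 f20.
move=> z d1 d2 d3 d4 d5; rewrite !lt_min.
move=> /andP[/andP[hz _] _] /andP[/andP[/fP1 + _] _] /andP[/andP[_ /fP2 +] _].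
move=> + + /andP[/andP[h3 _] _] /andP[_ /fP3 +] /andP[_ /fP3 +].
(* Arbitrary steps are reached because [a j - b j], [a 1 - 1] and [a 1] are nonzero. *)
have -> : d1 = (a j - b j) * ((a j - b j)^-1 * d1) by rewrite mulrA divff ?mul1r.
have -> : d2 = (a 1%N - 1) * ((a 1%N - 1)^-1 * d2) by rewrite mulrA divff ?mul1r.
have -> : d4 = a 1%N * ((a 1%N)^-1 * d4) by rewrite mulrA divff ?mul1r.
have -> : d5 = a 1%N * ((a 1%N)^-1 * d5) by rewrite mulrA divff ?mul1r.
rewrite !mulKf//.
set v := _^-1 * d1; set t := _^-1 * d2; set k := _^-1 * d4; set k' := _^-1 * d5.
have half (x : R) : `|x| < r / 2 -> `|x| < r by move/lt_trans; apply; rewrite gtr_pMr// invf_lt1 ?ltr1n.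
have scaled (x : R) : `|x| < e -> all (fun c => `|c * x| < r) cs.
  by move/eP => /allP hx; apply/allP => c /hx /half.
move=> hv ht hk hk'.
have := scaled _ hv; rewrite /= andbT mul1r => /and5P[v1 v2 v3 v4 /and4P[v5 v6 v7 v8]].
have := scaled _ ht; rewrite /= andbT mul1r => /and5P[t1 t2 _ _ /and4P[_ _ _ t8]].
have := scaled _ hk; rewrite /= andbT mul1r => /and5P[k1 k2 _ _ /and4P[_ _ _ k8]].
have := scaled _ hk'; rewrite /= andbT mul1r => /and5P[l1 l2 _ _ /and4P[_ _ _ l8]].
have z2 : `|z| < r / 2 by apply: lt_le_trans er; exact: lt_le_trans f1r.
have bz : `|b j * v - z| < r.
  rewrite (splitr r); apply: le_lt_trans (ler_normB _ _) _; apply: ltrD => //.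
  by have /allP/(_ (b j)) := eP _ hv; apply; rewrite !inE eqxx !orbT.
have bz1 : `|(b j - 1) * v - z| < r.
  rewrite (splitr r); apply: le_lt_trans (ler_normB _ _) _; apply: ltrD => //.
  by have /allP/(_ (b j - 1)) := eP _ hv; apply; rewrite !inE eqxx !orbT.
have h3r : `|- d3| < r by rewrite normrN half//; apply: lt_le_trans er; apply: lt_le_trans f1r.
have z0r : `|0 : R| < r by rewrite normr0.
have nzr : `|0 - z| < r by rewrite sub0r normrN half.
(* [eq4] at [v] and at 0 have the same right-hand side; their difference is the fifth difference. *)
have E1 := eq4 v z t (- d3) k k' v8 v3 v4 bz bz1 v5 v6 t8 t1 t2 h3r k8 k1 k2 l8 l1 l2.
have := eq4 0 z t (- d3) k k'; rewrite !mulr0 addr0.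
move/(_ z0r z0r z0r nzr nzr z0r z0r t8 t1 t2 h3r k8 k1 k2 l8 l1 l2) => E0.
have tE : a 1%N * t - t = (a 1%N - 1) * t by rewrite mulrBl mul1r.
rewrite tE opprK in E1; rewrite tE opprK in E0.
by rewrite diffs_cons E1 E0 subrr.
Qed.
End differences.

(** * Frechet's theorem on vanishing differences *)

Section diffs_theory.
Context {R : comNzRingType}.
Implicit Types (f g : R -> R) (s : seq R).

Lemma diffs_shift t s f x : diffs (t :: s) f x = diffs s (fun y => f (y + t) - f y) x.
Proof.
rewrite diffs_cons; elim: s x => [//|u s IH] x.
by rewrite !diffs_cons -IH -IH (addrAC x u t); ring.
Qed.

Lemma diffs_swap s1 t s2 f x : diffs (s1 ++ t :: s2) f x = diffs (t :: s1 ++ s2) f x.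
Proof.
elim: s1 x => [//|u s1 IH] x /=.
by rewrite diffs_cons !IH !diffs_cons (addrAC x u t); ring.
Qed.

Lemma diffs_sum (I : Type) (r : seq I) (F : I -> R -> R) s x :
  diffs s (fun y => \sum_(i <- r) F i y) x = \sum_(i <- r) diffs s (F i) x.
Proof.
elim: s x => [//|t s IH] x; rewrite diffs_cons !IH -sumrB.
by apply: eq_bigr => i _; rewrite diffs_cons.
Qed.

Lemma diffsZ s c f x : diffs s (fun y => c * f y) x = c * diffs s f x.
Proof. by elim: s x => [//|t s IH] x; rewrite !diffs_cons !IH mulrBr. Qed.

Lemma diffsB s f g x : diffs s (fun y => f y - g y) x = diffs s f x - diffs s g x.
Proof. by elim: s x => [//|t s IH] x; rewrite !diffs_cons !IH; ring. Qed.

(** One difference turns [y ^+ n] into a combination of lower powers by the binomial formula; of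
    these only [y ^+ n.-1], with coefficient [n * t], survives [n.-1] further differences. *)
Lemma diffs_exprn n s x :
  (size s = n -> diffs s (fun y => y ^+ n) x = n`!%:R * \prod_(t <- s) t) /\
  ((n < size s)%N -> diffs s (fun y => y ^+ n) x = 0).
Proof.
elim/ltn_ind: n s x => n IH [|t s] x.
  by split => //= <-; rewrite big_nil mulr1.
have E : diffs (t :: s) (fun y => y ^+ n) x =
    \sum_(i < n) ('C(n, i)%:R * t ^+ (n - i)) * diffs s (fun y => y ^+ i) x.
  rewrite diffs_shift -(big_mkord xpredT (fun i => 'C(n, i)%:R * t ^+ (n - i) * diffs s (fun y => y ^+ i) x)).
  under eq_bigr do rewrite -diffsZ.
  rewrite -diffs_sum; congr (diffs s _ x); apply/funext => y.
  rewrite (addrC y t) exprDn big_ord_recr /= subnn expr0 mul1r binn mulr1n addrK big_mkord.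
  by apply: eq_bigr => i _; rewrite -mulr_natl mulrA.
split => /= [|]; rewrite E.
  case: n IH {E} => [//|n] IH [sz]; rewrite big_ord_recr /= big1 ?add0r; last first.
    by move=> i _; rewrite (IH i _ s x).2 ?mulr0//; rewrite ?sz// ltnS ltnW.
  rewrite (IH n _ s x).1// subSnn expr1 big_cons binSn factS natrM; ring.
rewrite ltnS => sz; apply: big1 => i _.
by rewrite (IH i _ s x).2 ?mulr0//; apply: leq_trans sz.
Qed.

End diffs_theory.

Section frechet.
Context {R : realType}.
Implicit Types (f g : R -> R) (s : seq R).

Lemma additive_natmul g (rho : R) : 0 < rho ->
  (forall x y : R, `|x| < rho -> `|y| < rho -> `|x + y| < rho -> g (x + y) = g x + g y) ->
  forall n (x : R), 0 <= x -> n%:R * x < rho -> g (n%:R * x) = n%:R * g x.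
Proof.
move=> rho0 gD; have g0 : g 0 = 0.
  have h := gD 0 0; rewrite addr0 normr0 in h.
  by have /esym/eqP := h rho0 rho0 rho0; rewrite -subr_eq0 addrK => /eqP.
elim=> [|n IH] x x0 hx; first by rewrite !mul0r.
have nx0 : 0 <= n%:R * x by rewrite mulr_ge0.
rewrite -natr1 mulrDl mul1r in hx *.
have hx2 : n%:R * x < rho by apply: le_lt_trans hx; rewrite lerDl.
have hx1 : x < rho by apply: le_lt_trans hx; rewrite lerDr.
by rewrite gD ?IH ?mulrDl ?mul1r// ?ger0_norm ?addr_ge0.
Qed.

(** Cauchy's equation. Subtracting the linear function through [g r] leaves an additive [G] that is
    bounded by [M + M] on [[0, r)] and vanishes at [r / N]. Reducing [x] modulo [r / N] gives [e]
    with [N * e < r] and [G x = G e], so [N * |G x| = |G (N * e)| <= M + M] for every [N]. *)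
Lemma bounded_additive_linear g (rho M r : R) : 0 < r -> r < rho ->
  (forall x : R, `|x| < rho -> `|g x| <= M) ->
  (forall x y : R, `|x| < rho -> `|y| < rho -> `|x + y| < rho -> g (x + y) = g x + g y) ->
  forall x : R, `|x| < r -> g x = x / r * g r.
Proof.
move=> r0 rrho gM gD.
have rho0 : 0 < rho by exact: lt_trans rrho.
pose G x := g x - x / r * g r.
have GD (x y : R) : `|x| < rho -> `|y| < rho -> `|x + y| < rho -> G (x + y) = G x + G y.
  by move=> hx hy hxy; rewrite /G gD// !mulrDl opprD addrACA.
have Gr : G r = 0 by rewrite /G divff ?gt_eqF// mul1r subrr.
have Gn := additive_natmul rho0 GD.
have GM (x : R) : 0 <= x -> x < r -> `|G x| <= M + M.
  move=> x0 xr; apply: le_trans (ler_normB _ _) _.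
  have hx : `|x| < rho by rewrite ger0_norm//; exact: lt_trans rrho.
  have hr : `|r| < rho by rewrite gtr0_norm.
  apply: lerD; first exact: gM.
  rewrite normrM; apply: le_trans (gM _ hr).
  have xr0 : 0 <= x / r by rewrite divr_ge0// ltW.
  by rewrite ler_piMl// ger0_norm// ler_pdivrMr// mul1r ltW.
have G0 (x : R) : 0 <= x -> x < r -> G x = 0.
  move=> x0 xr; have key N : (0 < N)%N -> N%:R * `|G x| <= M + M.
    move=> N0; have N0' : 0 < N%:R :> R by rewrite ltr0n.
    pose h := r / N%:R; have h0 : 0 < h by rewrite divr_gt0.
    have Nh : N%:R * h = r by rewrite mulrC divfK// gt_eqF.
    have Gh : G h = 0.
      have := Gn N h (ltW h0); rewrite Nh Gr => /(_ rrho)/esym/eqP.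
      by rewrite mulf_eq0 gt_eqF//= => /eqP.
    pose k := Num.truncn (x / h).
    have /andP[k1 k2] := truncn_itv (divr_ge0 x0 (ltW h0)).
    rewrite -/k ler_pdivlMr// in k1; rewrite -/k ltr_pdivrMr// in k2.
    pose e := x - k%:R * h.
    have e0 : 0 <= e by rewrite subr_ge0.
    have eh : e < h by rewrite ltrBlDl; move: k2; rewrite -natr1 mulrDl mul1r.
    have xE : x = k%:R * h + e by rewrite /e addrC subrK.
    have kh0 : 0 <= k%:R * h by rewrite mulr_ge0// ltW.
    have xrho : x < rho by exact: lt_trans rrho.
    have Ge : G x = G e.
      have khr : k%:R * h < rho by exact: le_lt_trans k1 _.
      have er : e < rho by apply: le_lt_trans xrho; rewrite /e gerBl.
      rewrite {1}xE GD -?xE ?ger0_norm//.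
      by rewrite Gn ?Gh ?mulr0 ?add0r// ltW.
    have Ne : N%:R * e < r by rewrite -Nh ltr_pM2l.
    rewrite Ge -[N%:R]ger0_norm// -normrM -Gn//; last exact: lt_trans rrho.
    by apply: GM => //; rewrite mulr_ge0.
  apply/eqP; rewrite -normr_le0; rewrite leNgt; apply/negP => Gx.
  have M0 : 0 <= (M + M) / `|G x|.
    by rewrite divr_ge0//; apply: le_trans (key 1%N isT); rewrite mul1r.
  have := key (Num.truncn ((M + M) / `|G x|)).+1 isT.
  have /andP[_] := truncn_itv M0; rewrite ltr_pdivrMr// => h1 h2.
  by have := lt_le_trans h1 h2; rewrite ltxx.
have GG (x : R) : `|x| < r -> G x = 0.
  move=> hx; have [x0|x0] := leP 0 x; first by apply: G0 => //; rewrite -(ger0_norm x0).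
  have nx : G (- x) = 0 by apply: G0; rewrite ?oppr_ge0 ?ltW// -(ltr0_norm x0).
  have hx' : `|x| < rho by exact: lt_trans rrho.
  have := GD x (- x); rewrite subrr normrN normr0 nx addr0 => <- //.
  exact: G0.
by move=> x /GG /eqP; rewrite subr_eq0 => /eqP.
Qed.

Definition diffs_vanish m f := exists2 r : R, 0 < r & forall s (x : R),
  size s = m -> all (fun t => `|t| < r) s -> `|x| < r -> diffs s f x = 0.

Lemma diffs_bound f (r M : R) : (forall x : R, `|x| < r -> `|f x| <= M) ->
  forall s x, `|x| + \sum_(t <- s) `|t| < r -> `|diffs s f x| <= 2 ^+ size s * M.
Proof.
move=> fM; elim=> [|t s IH] x; first by rewrite big_nil addr0 expr0 mul1r => /fM.
rewrite big_cons addrA => hx; rewrite diffs_cons exprS mulr_natl mulrnAl mulr2n.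
apply: le_trans (ler_normB _ _) _; apply: lerD; apply: IH.
  by apply: le_lt_trans hx; rewrite lerD2r ler_normD.
by apply: le_lt_trans hx; rewrite lerD2r lerDl.
Qed.

(** The differences of order [m] no longer depend on the base point; they are symmetric in the
    steps, additive and bounded in each of them, hence a constant times the product of the steps.
    The same is true of [x ^+ m], with constant [m!]. *)
Lemma diffs_vanish_const m f : diffs_vanish m.+1 f ->
  (exists2 r : R, 0 < r & exists M : R, forall x : R, `|x| < r -> `|f x| <= M) ->
  exists c, diffs_vanish m (fun x => f x - c * x ^+ m).
Proof.
move=> [r1 r10 V] [r2 r20 [M fM]].
(* Up to [m] steps below [rho] added together stay within the radius [r2] on which [f] is
   bounded. *)
pose rho := Num.min r1 (r2 / m.+1%:R).
have rho0 : 0 < rho by rewrite lt_min r10 divr_gt0.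
have rho1 (x : R) : `|x| < rho -> `|x| < r1 by rewrite lt_min => /andP[].
have all1 s : all (fun t => `|t| < rho) s -> all (fun t => `|t| < r1) s.
  by apply: sub_all => t; exact: rho1.
pose D s := diffs s f 0.
have r10' : `|0 : R| < r1 by rewrite normr0.
have Dx s (x : R) : size s = m -> all (fun t => `|t| < rho) s -> `|x| < rho ->
    diffs s f x = D s.
  move=> sz hs hx; have hxs : all (fun t => `|t| < r1) (x :: s) by rewrite /= rho1//; exact: all1.
  have := V (x :: s) 0 (congr1 S sz) hxs r10'.
  by rewrite diffs_cons add0r => /eqP; rewrite subr_eq0 => /eqP.
pose r := rho / 2.
have r0 : 0 < r by rewrite divr_gt0.
have rrho : r < rho by rewrite gtr_pMr// invf_lt1 ?ltr1n.
have linear t s : size (t :: s) = m -> `|t| < r -> all (fun t => `|t| < rho) s ->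
    D (t :: s) = t / r * D (r :: s).
  move=> /= sz tr hs.
  apply: (@bounded_additive_linear (fun t => D (t :: s)) rho (2 ^+ m * M) r) => //.
    move=> x hx; rewrite -sz; apply: (diffs_bound fM); rewrite normr0 add0r big_cons.
    have mr : m.+1%:R * rho <= r2 by rewrite mulrC -ler_pdivlMr// ge_min lexx orbT.
    apply: lt_le_trans mr; rewrite -sz -!natr1 !mulrDl !mul1r addrC.
    rewrite -[ltLHS]addr0; apply: ltr_leD => //; last exact: ltW.
    rewrite ler_ltD//; elim: (s) hs => [|u s' IH] /=; first by rewrite big_nil mul0r.
    move=> /andP[hu /IH hs']; rewrite big_cons -natr1 mulrDl mul1r addrC.
    by rewrite lerD// ltW.
  move=> x y hx hy hxy; rewrite /D !diffs_cons !add0r.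
  have hxs : all (fun t => `|t| < rho) (x :: s) by rewrite /= hx.
  (* Additivity: going from 0 to [x + y] through [y], the step [x] taken at [y] counts as if taken
     at 0. *)
  have := Dx (x :: s) y sz hxs hy.
  rewrite /D !diffs_cons !add0r (addrC y x) => <-; ring.
have prodD s k : (size s + k = m)%N -> all (fun t => `|t| < r) s ->
    D (s ++ nseq k r) = (\prod_(t <- s) (t / r)) * D (nseq m r).
  elim: s k => [|t s IH] k; first by rewrite add0n => <- _; rewrite big_nil mul1r.
  rewrite /= addSnnS => szk /andP[tr hs].
  have sz' : size (t :: s ++ nseq k r) = m by rewrite /= size_cat size_nseq -addnS.
  have al : all (fun t => `|t| < rho) (s ++ nseq k r).
    rewrite all_cat all_nseq gtr0_norm// rrho orbT andbT.
    by apply: sub_all hs => u; move/lt_trans; exact.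
  rewrite (linear _ _ sz' tr al) (_ : D (r :: s ++ nseq k r) = D (s ++ nseq k.+1 r)); last first.
    by rewrite /D /= diffs_swap.
  by rewrite IH// big_cons mulrA.
exists (D (nseq m r) / (m`!%:R * r ^+ m)).
exists r => // s x sz hs hx.
have hs' : all (fun t => `|t| < rho) s by apply: sub_all hs => u; move/lt_trans; exact.
rewrite diffsB diffsZ Dx//; last exact: lt_trans rrho.
rewrite (diffs_exprn m s x).1// -[s in D s]cats0 (prodD s 0%N)// ?addn0//.
have -> : \prod_(t <- s) (t / r) = (\prod_(t <- s) t) / r ^+ m.
  rewrite -sz; elim: (s) => [|t s' IH]; first by rewrite !big_nil expr0 divr1.
  by rewrite !big_cons IH /= exprS mulrACA -invfM.
have f0 : m`!%:R != 0 :> R by rewrite pnatr_eq0 -lt0n fact_gt0.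
have rm0 : r ^+ m != 0 by rewrite expf_neq0// gt_eqF.
by field; rewrite f0 rm0.
Qed.

Theorem diffs_vanish_poly m f : diffs_vanish m f ->
  (exists2 r : R, 0 < r & exists M : R, forall x : R, `|x| < r -> `|f x| <= M) ->
  exists2 p : {poly R}, (size p <= m)%N &
    exists2 r : R, 0 < r & forall x : R, `|x| < r -> f x = p.[x].
Proof.
elim: m f => [|m IH] f V B.
  have [r r0 rV] := V; exists 0; first by rewrite size_poly0.
  by exists r => // x hx; rewrite horner0; apply: (rV [::]).
have [c Vc] := diffs_vanish_const V B.
have [] := IH _ Vc.
  have [r r0 [M fM]] := B; exists (Num.min r 1); first by rewrite lt_min r0 ltr01.
  exists (M + `|c|) => x; rewrite lt_min => /andP[xr x1].
  apply: le_trans (ler_normB _ _) _; apply: lerD; first exact: fM.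
  by rewrite normrM ler_piMr// normrX exprn_ile1// ltW.
move=> p sp [r r0 pr]; exists (p + c *: 'X^m).
  apply: leq_trans (size_polyD _ _) _; rewrite geq_max (leq_trans sp)//.
  by apply: leq_trans (size_scale_leq _ _) _; rewrite size_polyXn.
exists r => // x /pr /eqP; rewrite subr_eq => /eqP ->.
by rewrite hornerD hornerZ hornerXn.
Qed.

End frechet.

Local Open Scope classical_set_scope.
Local Open Scope ring_scope.

(** * Integration on a probability space *)

Section integral_tools.
Context {d : measure_display} {T : measurableType d} {R : realType}.
Variable P : probability T R.
Implicit Types f g : T -> R.

Lemma le_integrable_fun f g : measurable_fun [set: T] f ->
  (forall w, `|f w| <= g w) -> P.-integrable [set: T] (EFin \o g) ->
  P.-integrable [set: T] (EFin \o f).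
Proof.
move=> mf fg ig; apply: (le_integrable measurableT _ _ ig).
  exact/measurable_EFinP.
by move=> w _ /=; rewrite lee_fin; apply: le_trans (fg w) (ler_norm _).
Qed.

Lemma cst_integrable (c : R) : P.-integrable [set: T] (EFin \o (fun=> c)).
Proof. exact: finite_measure_integrable_cst. Qed.

Lemma bounded_integrable f (M : R) : measurable_fun [set: T] f ->
  (forall w, `|f w| <= M) -> P.-integrable [set: T] (EFin \o f).
Proof. by move=> mf fM; apply: (le_integrable_fun mf fM); exact: cst_integrable. Qed.

Lemma integrableD_fun f g : P.-integrable [set: T] (EFin \o f) ->
  P.-integrable [set: T] (EFin \o g) -> P.-integrable [set: T] (EFin \o (fun w => f w + g w)).
Proof.
move=> intf intg; have := integrableD measurableT intf intg.
by apply: eq_integrable => // w _ /=.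
Qed.

Lemma integrableZ_fun c f : P.-integrable [set: T] (EFin \o f) ->
  P.-integrable [set: T] (EFin \o (fun w => c * f w)).
Proof.
move=> intf; have := integrableZl measurableT c intf.
by apply: eq_integrable => // w _ /=.
Qed.

Lemma integrableB_fun f g : P.-integrable [set: T] (EFin \o f) ->
  P.-integrable [set: T] (EFin \o g) -> P.-integrable [set: T] (EFin \o (fun w => f w - g w)).
Proof.
move=> intf intg; have := integrableB measurableT intf intg.
by apply: eq_integrable => // w _ /=.
Qed.

Lemma integrable_measurable f : P.-integrable [set: T] (EFin \o f) -> measurable_fun [set: T] f.
Proof. by move=> /integrableP[/measurable_EFinP]. Qed.

Lemma Rintegral1 (c : R) : \int[P]_w c = c.
Proof.
rewrite Rintegral_cst//; transitivity (c * fine (1%E : \bar R)); last by rewrite mulr1.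
congr (c * fine _); exact: probability_setT.
Qed.

Lemma Rintegral_dominated (f_ : nat -> T -> R) f g :
  (forall n, measurable_fun [set: T] (f_ n)) -> P.-integrable [set: T] (EFin \o g) ->
  (forall w, f_ ^~ w @ \oo --> f w) -> (forall n w, `|f_ n w| <= g w) ->
  P.-integrable [set: T] (EFin \o f) /\ (\int[P]_w f_ n w) @[n --> \oo] --> \int[P]_w f w.
Proof.
move=> mf ig cf fg.
have mff : measurable_fun [set: T] f.
  by apply: (measurable_fun_cvg (h := f_)) => // w _; exact: cf.
have [] := @dominated_convergence _ T R P [set: T] measurableT
  (fun n w => (f_ n w)%:E) (EFin \o f) (EFin \o g).
- by move=> n; exact/measurable_EFinP.
- exact/measurable_EFinP.
- by apply: aeW => w _; apply: cvg_EFin; [exact: nearW | exact: cf].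
- exact: ig.
- by apply: aeW => w n _ /=; rewrite lee_fin.
move=> intf _ cv; split => //.
apply: fine_cvg; rewrite /Rintegral fineK//; exact: integrable_fin_num.
Qed.

Lemma Rintegral_ler f g : P.-integrable [set: T] (EFin \o f) ->
  P.-integrable [set: T] (EFin \o g) -> (forall w, f w <= g w) ->
  \int[P]_w f w <= \int[P]_w g w.
Proof. by move=> *; apply: le_Rintegral => //. Qed.

Lemma Rintegral_indic (A : set T) : measurable A -> \int[P]_w \1_A w = fine (P A).
Proof. by move=> mA; rewrite /Rintegral integral_indic// setIT. Qed.

End integral_tools.

(** * Characteristic functions of sums of independent phases *)

Section weighted.
Context {d : measure_display} {T : measurableType d} {R : realType}.
Variable P : probability T R.

Lemma Rintegral_sum (I : Type) (r : seq I) (F : I -> T -> R) :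
  (forall i, P.-integrable [set: T] (EFin \o F i)) ->
  P.-integrable [set: T] (EFin \o (fun w => \sum_(i <- r) F i w)) /\
  \int[P]_w (\sum_(i <- r) F i w) = \sum_(i <- r) \int[P]_w F i w.
Proof.
move=> intF; elim: r => [|i r [IH1 IH2]].
  have -> : (fun w => \sum_(i <- [::]) F i w) = (fun=> 0) by apply/funext => w; rewrite big_nil.
  by split; [exact: cst_integrable | rewrite Rintegral1 big_nil].
have -> : (fun w => \sum_(j <- i :: r) F j w) = (fun w => F i w + \sum_(j <- r) F j w).
  by apply/funext => w; rewrite big_cons.
by split; [exact: integrableD_fun | rewrite RintegralD// IH2 big_cons].
Qed.

Lemma sum_indic_le N (t : nat) : \sum_(k < N) (k < t)%:R = (minn N t)%:R :> R.
Proof.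
elim: N => [|N IH]; first by rewrite big_ord0 min0n.
rewrite big_ord_recr /= IH -natrD; congr (_%:R).
have [h|h] := boolP (N < t)%N.
  by rewrite (minn_idPl h) (minn_idPl (ltnW h)) addn1.
by rewrite -leqNgt in h; rewrite (minn_idPr h) (minn_idPr (leqW h)) addn0.
Qed.

(** The sum counts the levels reached by [y], so it is the integer part of [N * y]. *)
Lemma layer_cake_approx N (y : R) : (0 < N)%N -> 0 <= y <= 1 ->
  `|y - N%:R^-1 * \sum_(k < N) (k.+1%:R / N%:R <= y)%R%:R| <= N%:R^-1.
Proof.
move=> N0 /andP[y0 y1]; have N0' : 0 < N%:R :> R by rewrite ltr0n.
have Ny0 : 0 <= N%:R * y by rewrite mulr_ge0// ltW.
have -> : \sum_(k < N) (k.+1%:R / N%:R <= y)%R%:R = (Num.truncn (N%:R * y))%:R :> R.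
  under eq_bigr => k _ do rewrite ler_pdivrMr// (mulrC y) -truncn_ge_nat//.
  rewrite sum_indic_le; congr (_%:R); apply/minn_idPr.
  rewrite -(ler_nat R); have /andP[h _] := truncn_itv Ny0.
  by apply: le_trans h _; rewrite ler_piMr// ltW.
have /andP[] := truncn_itv Ny0; set t := (Num.truncn _)%:R; rewrite -natr1 -/t => h1 h2.
rewrite -(ler_pM2l N0') divff ?gt_eqF// -{1}(gtr0_norm N0') -normrM mulrBr mulrA divff ?gt_eqF// mul1r.
rewrite ger0_norm ?subr_ge0// lerBlDl addrC.
by rewrite addrC ltW.
Qed.

(** Passes from the events [th \in B] to functions of [th]. A function with values in [[0, 1]] is
    uniformly within [1 / N] of an average of indicators of superlevel sets; a general [g] is
    reduced to [(g + 1) / 2], the case [B = setT] giving the mean of [W]. *)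
Lemma Rintegral_weighted (W th : T -> R) (w M : R) (g : R -> R) :
  measurable_fun [set: T] W -> (forall x, `|W x| <= M) -> measurable_fun [set: T] th ->
  (forall B : set R, measurable B ->
     \int[P]_x (W x * \1_(th @^-1` B) x) = w * fine (P (th @^-1` B))) ->
  measurable_fun [set: R] g -> (forall x, `|g x| <= 1) ->
  \int[P]_x (W x * g (th x)) = w * \int[P]_x g (th x).
Proof.
move=> mW WM mth H mg g1.
have M0 : 0 <= M by apply: le_trans (WM point); exact: normr_ge0.
have iW : P.-integrable [set: T] (EFin \o W) by exact: bounded_integrable WM.
have mWf (f : T -> R) : measurable_fun [set: T] f -> measurable_fun [set: T] (fun x => W x * f x).
  by move=> mf; exact: measurable_funM.
have bWf (f : T -> R) K : (forall x, `|f x| <= K) -> forall x, `|W x * f x| <= M * K.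
  by move=> fK x; rewrite normrM ler_pM.
have unit_case (h : R -> R) : measurable_fun [set: R] h -> (forall x, 0 <= h x <= 1) ->
    \int[P]_x (W x * h (th x)) = w * \int[P]_x h (th x).
  move=> mh h1.
  have mhth : measurable_fun [set: T] (h \o th) by exact: measurableT_comp.
  have hb x : `|h (th x)| <= 1 by have /andP[? ?] := h1 (th x); rewrite ger0_norm.
  have ih : P.-integrable [set: T] (EFin \o (fun x => h (th x))) by apply: (@bounded_integrable _ _ _ P (fun x => h (th x)) 1).
  have iWh : P.-integrable [set: T] (EFin \o (fun x => W x * h (th x))).
    by apply: (@bounded_integrable _ _ _ _ _ (M * 1)); [exact: mWf | exact: bWf].
  have key N : (0 < N)%N ->
      `|\int[P]_x (W x * h (th x)) - w * \int[P]_x h (th x)| <= (M + `|w|) * N%:R^-1.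
    move=> N0.
    pose B k := h @^-1` `[k.+1%:R / N%:R, +oo[%classic.
    have mB k : measurable (B k) by rewrite -[B k]setTI; apply: mh.
    pose hN x := N%:R^-1 * \sum_(k < N) \1_(th @^-1` (B k)) x : R.
    have hNE x : hN x = N%:R^-1 * \sum_(k < N) (k.+1%:R / N%:R <= h (th x))%R%:R.
      congr (_ * _); apply: eq_bigr => k _; rewrite indicE; congr ((nat_of_bool _)%:R).
      by apply/idP/idP; rewrite inE /B /= in_itv /= andbT.
    have close x : `|h (th x) - hN x| <= N%:R^-1.
      by rewrite hNE; apply: layer_cake_approx.
    have mI k : measurable (th @^-1` (B k)) by rewrite -[X in measurable X]setTI; exact: mth.
    have mind k : measurable_fun [set: T] (\1_(th @^-1` (B k)) : T -> R) by exact: measurable_indic.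
    have bind k x : `|\1_(th @^-1` (B k)) x : R| <= 1 by rewrite indicE; case: (_ \in _); rewrite ?normr1 ?normr0.
    have iI k : P.-integrable [set: T] (EFin \o (\1_(th @^-1` (B k)) : T -> R)).
      exact: (@bounded_integrable _ _ _ P _ 1).
    have iWI k : P.-integrable [set: T] (EFin \o (fun x => W x * \1_(th @^-1` (B k)) x)).
      by apply: (@bounded_integrable _ _ _ _ _ (M * 1)); [exact: mWf | exact: bWf].
    have [is1 s1] := Rintegral_sum (index_enum 'I_N) (fun k : 'I_N => iI k).
    have [is2 s2] := Rintegral_sum (index_enum 'I_N) (fun k : 'I_N => iWI k).
    have ihN : P.-integrable [set: T] (EFin \o hN) by exact: integrableZ_fun.
    have WhNE : (fun x => W x * hN x) = (fun x => N%:R^-1 * \sum_(k < N) (W x * \1_(th @^-1` (B k)) x)).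
      by apply/funext => x; rewrite /hN mulrCA mulr_sumr.
    have iWhN : P.-integrable [set: T] (EFin \o (fun x => W x * hN x)).
      by rewrite WhNE; exact: integrableZ_fun.
    have eqN : \int[P]_x (W x * hN x) = w * \int[P]_x hN x.
      rewrite WhNE RintegralZl// s2 /hN RintegralZl// s1 mulrCA; congr (_ * _).
      by rewrite mulr_sumr; apply: eq_bigr => k _; rewrite H// Rintegral_indic.
    have -> : \int[P]_x (W x * h (th x)) - w * \int[P]_x h (th x) =
        \int[P]_x (W x * (h (th x) - hN x)) - w * \int[P]_x (h (th x) - hN x).
      have -> : \int[P]_x (W x * (h (th x) - hN x)) = \int[P]_x (W x * h (th x)) - \int[P]_x (W x * hN x).
        by rewrite -RintegralB//; apply: eq_Rintegral => x _; rewrite mulrBr.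
      by rewrite RintegralB// eqN; ring.
    have bound (f : T -> R) K : P.-integrable [set: T] (EFin \o f) -> (forall x, `|f x| <= K) -> `|\int[P]_x f x| <= K.
      move=> intf fK; apply: le_trans (le_normr_Rintegral _ intf) _ => //.
      rewrite -[leRHS](Rintegral1 P); apply: Rintegral_ler => //; last exact: cst_integrable.
      exact: integrable_norm.
    have idiff : P.-integrable [set: T] (EFin \o (fun x => h (th x) - hN x)) by exact: integrableB_fun.
    have iWdiff : P.-integrable [set: T] (EFin \o (fun x => W x * (h (th x) - hN x))).
      apply: (@bounded_integrable _ _ _ _ _ (M * N%:R^-1)); last exact: bWf.
      by apply: mWf; exact: integrable_measurable idiff.
    apply: le_trans (ler_normB _ _) _; rewrite mulrDl; apply: lerD.
      by apply: bound => //; exact: bWf.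
    by rewrite normrM ler_wpM2l//; exact: bound.
  apply/eqP; rewrite -subr_eq0 -normr_le0 leNgt; apply/negP => pos.
  set e := `|_| in pos key.
  have K0 : 0 <= (M + `|w|) / e by rewrite divr_ge0 ?addr_ge0// ltW.
  have /andP[_] := truncn_itv K0; rewrite ltr_pdivrMr//; set N := (Num.truncn _).+1 => hN.
  have := key N isT; rewrite ler_pdivlMr ?ltr0n// mulrC => h2.
  by have := lt_le_trans hN h2; rewrite ltxx.
have mh : measurable_fun [set: R] (fun x => 2^-1 * g x + 2^-1).
  by apply: measurable_funD => //; exact: measurable_funM.
have h01 x : 0 <= 2^-1 * g x + 2^-1 <= 1.
  by have := g1 x; rewrite ler_norml => /andP[? ?]; apply/andP; split; lra.
have mgth : measurable_fun [set: T] (g \o th) by exact: measurableT_comp.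
have ig : P.-integrable [set: T] (EFin \o (fun x => g (th x))).
  by apply: (@bounded_integrable _ _ _ P (fun x => g (th x)) 1) => // x; exact: g1.
have iWg : P.-integrable [set: T] (EFin \o (fun x => W x * g (th x))).
  apply: (@bounded_integrable _ _ _ _ _ (M * 1)); [exact: mWf | by apply: bWf => x; exact: g1].
have HT := H setT measurableT; rewrite preimage_setT probability_setT mulr1 in HT.
have WT : \int[P]_x W x = w.
  by rewrite -HT; apply: eq_Rintegral => x _; rewrite indicT mulr1.
have := unit_case _ mh h01.
have -> : \int[P]_x (W x * (2^-1 * g (th x) + 2^-1)) = 2^-1 * \int[P]_x (W x * g (th x)) + 2^-1 * w.
  rewrite -WT -!RintegralZl// -RintegralD//; try exact: integrableZ_fun.
  by apply: eq_Rintegral => x _; ring.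
have -> : \int[P]_x (2^-1 * g (th x) + 2^-1) = 2^-1 * \int[P]_x g (th x) + 2^-1.
  rewrite RintegralD ?RintegralZl ?Rintegral1//; [exact: integrableZ_fun | exact: cst_integrable].
lra.
Qed.

End weighted.

Section independent_phases.
Context {d : measure_display} {T : measurableType d} {R : realType}.
Variable P : probability T R.
Context {I : choiceType}.
Variables (D : set I) (F : I -> set (set T)) (th : I -> T -> R) (l t : I -> R).
Hypothesis indep : mutual_indep P D F.
Hypothesis F_measurable : forall i A, D i -> F i A -> measurable A.
Hypothesis th_F : forall i (B : set R), D i -> measurable B -> F i (th i @^-1` B).
Hypothesis th_cos : forall i, D i -> \int[P]_w cos (th i w) = expR (l i) * cos (t i).
Hypothesis th_sin : forall i, D i -> \int[P]_w sin (th i w) = expR (l i) * sin (t i).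

Let joint (s : seq I) (E : I -> set T) := \bigcap_(i in [set` s]) E i.

Lemma joint_prob s E : uniq s -> (forall i, i \in s -> D i) -> (forall i, i \in s -> F i (E i)) ->
  P (joint s E) = (\prod_(i <- s) P (E i))%E.
Proof.
move=> us sD FE; have := @indep [fset i in s]%fset _ E.
have eqs : [set` [fset i in s]%fset] = [set` s] by apply/seteqP; split => i /=; rewrite !inE.
rewrite eqs => -> //; last by move=> i; rewrite inE => /FE.
apply: perm_big; apply: uniq_perm => //.
by move=> i; rewrite inE.
Qed.

Lemma joint_cons i s E : joint (i :: s) E = E i `&` joint s E.
Proof.
apply/seteqP; split=> w.
  move=> h; split; first by apply: h => /=; rewrite inE eqxx.
  by move=> j /= js; apply: h => /=; rewrite inE js orbT.
by move=> [hi hs] j /=; rewrite inE => /predU1P[->//|js]; exact: hs.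
Qed.

Lemma joint_measurable s E : (forall i, i \in s -> D i) -> (forall i, i \in s -> F i (E i)) ->
  measurable (joint s E).
Proof.
elim: s => [|i s IH] sD FE.
  by rewrite (_ : joint _ _ = setT)//; apply/seteqP; split => // w _ j.
rewrite joint_cons; apply: measurableI.
  by apply: F_measurable (FE i _); rewrite ?inE ?eqxx//; apply: sD; rewrite inE eqxx.
by apply: IH => j js; [apply: sD|apply: FE]; rewrite inE js orbT.
Qed.

Lemma th_measurable i : D i -> measurable_fun [set: T] (th i).
Proof. by move=> Di _ B mB; rewrite setTI; apply: F_measurable (th_F Di mB). Qed.

Lemma measurable_sum_th s : (forall i, i \in s -> D i) ->
  measurable_fun [set: T] (fun w => \sum_(i <- s) th i w).
Proof.
elim: s => [|i s IH] sD.
  by rewrite (_ : (fun _ => _) = (fun=> 0))//; apply/funext => w; rewrite big_nil.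
rewrite (_ : (fun _ => _) = (fun w => th i w + \sum_(j <- s) th j w)); last first.
  by apply/funext => w; rewrite big_cons.
apply: measurable_funD; first by apply: th_measurable; apply: sD; rewrite inE eqxx.
by apply: IH => j js; apply: sD; rewrite inE js orbT.
Qed.

Lemma measurable_cosR : measurable_fun [set: R] (@cos R).
Proof. by apply: continuous_measurable_fun => x; exact: continuous_cos. Qed.

Lemma measurable_sinR : measurable_fun [set: R] (@sin R).
Proof. by apply: continuous_measurable_fun => x; exact: continuous_sin. Qed.

(* The indicator of further events is carried along so that each step of the
   induction only uses the product rule for events. *)
Lemma indep_phases_events s s' E : uniq (s ++ s') -> (forall i, i \in s ++ s' -> D i) ->
  (forall i, i \in s' -> F i (E i)) ->
  let p := fine (P (joint s' E)) in
  \int[P]_w (cos (\sum_(i <- s) th i w) * \1_(joint s' E) w) =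
    expR (\sum_(i <- s) l i) * cos (\sum_(i <- s) t i) * p /\
  \int[P]_w (sin (\sum_(i <- s) th i w) * \1_(joint s' E) w) =
    expR (\sum_(i <- s) l i) * sin (\sum_(i <- s) t i) * p.
Proof.
elim: s s' E => [|i s IH] s' E us sD FE p.
  have mJ : measurable (joint s' E) by apply: joint_measurable.
  split; under eq_Rintegral do rewrite big_nil ?cos0 ?sin0 ?mul1r ?mul0r.
    by rewrite !big_nil expR0 cos0 !mul1r Rintegral_indic.
  by rewrite Rintegral1 !big_nil sin0 mulr0 mul0r.
have Di : D i by apply: sD; rewrite inE eqxx.
have sD1 j : j \in s -> D j by move=> js; apply: sD; rewrite inE mem_cat js orbT.
have sD2 j : j \in s' -> D j by move=> js; apply: sD; rewrite inE mem_cat js !orbT.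
have := us; rewrite cat_cons cons_uniq mem_cat negb_or => /andP[/andP[is1 is2] us'].
have us2 : uniq s' by move: us'; rewrite cat_uniq => /and3P[].
have mJ : measurable (joint s' E) by apply: joint_measurable.
have mS := measurable_sum_th sD1.
have mJ1 : measurable_fun [set: T] (\1_(joint s' E) : T -> R) by exact: measurable_indic.
have mC : measurable_fun [set: T] (fun w => cos (\sum_(j <- s) th j w) * \1_(joint s' E) w).
  by apply: measurable_funM => //; apply: measurableT_comp mS; exact: measurable_cosR.
have mSi : measurable_fun [set: T] (fun w => sin (\sum_(j <- s) th j w) * \1_(joint s' E) w).
  by apply: measurable_funM => //; apply: measurableT_comp mS; exact: measurable_sinR.
have b1 w : `|\1_(joint s' E) w : R| <= 1 by rewrite indicE; case: (_ \in _); rewrite ?normr1 ?normr0.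
have bC w : `|cos (\sum_(j <- s) th j w) * \1_(joint s' E) w| <= 1 * 1.
  by rewrite normrM ler_pM// cos_max.
have bS w : `|sin (\sum_(j <- s) th j w) * \1_(joint s' E) w| <= 1 * 1.
  by rewrite normrM ler_pM// sin_max.
(* The event [A] joins the list of events as that of shock [i]; the induction hypothesis then
   provides exactly the product rule that [Rintegral_weighted] asks for. *)
have step B : measurable B -> let A := th i @^-1` B in
   \int[P]_w (cos (\sum_(j <- s) th j w) * \1_(joint s' E) w * \1_A w) =
     expR (\sum_(j <- s) l j) * cos (\sum_(j <- s) t j) * p * fine (P A) /\
   \int[P]_w (sin (\sum_(j <- s) th j w) * \1_(joint s' E) w * \1_A w) =
     expR (\sum_(j <- s) l j) * sin (\sum_(j <- s) t j) * p * fine (P A).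
  move=> mB A; pose E' j := if j == i then A else E j.
  have E's : joint s' E' = joint s' E.
    by apply: eq_bigcapr => j /= js; rewrite /E' ifN//; apply: contraNneq is2 => <-.
  have JE : joint (i :: s') E' = A `&` joint s' E by rewrite joint_cons E's /E' eqxx.
  have FE' j : j \in i :: s' -> F j (E' j).
    rewrite inE /E'; case: eqVneq => [-> _|_ /= /FE//]; exact: th_F.
  have D' j : j \in i :: s' -> D j by rewrite inE => /predU1P[->//|/sD2].
  have PJ : fine (P (joint (i :: s') E')) = p * fine (P A).
    rewrite joint_prob//=; last by rewrite is2.
    rewrite big_cons -joint_prob// ?E's.
      rewrite /E' eqxx fineM ?fin_num_measure// 1?mulrC//.
      exact: F_measurable (th_F Di mB).
    by move=> j js; apply: FE'; rewrite inE js orbT.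
  have [] := IH (i :: s') E'.
  - by rewrite cat_uniq /= is2 us2 negb_or is1 /= andbT; move: us'; rewrite cat_uniq => /and3P[-> -> _].
  - by move=> j; rewrite mem_cat inE => /orP[/sD1//|/predU1P[->//|/sD2]].
  - exact: FE'.
  rewrite PJ JE !mulrA => <- <-.
  split; apply: eq_Rintegral => w _; rewrite -mulrA; congr (_ * _);
    by rewrite indicI /= mulrC.
have wC (g : R -> R) : measurable_fun [set: R] g -> (forall x, `|g x| <= 1) -> _ :=
  Rintegral_weighted mC bC (th_measurable Di) (fun B mB => (step B mB).1).
have wS (g : R -> R) : measurable_fun [set: R] g -> (forall x, `|g x| <= 1) -> _ :=
  Rintegral_weighted mSi bS (th_measurable Di) (fun B mB => (step B mB).2).
have int (f g : T -> R) : measurable_fun [set: T] f -> (forall w, `|f w| <= 1 * 1) ->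
   measurable_fun [set: T] g -> (forall w, `|g w| <= 1) ->
   P.-integrable [set: T] (EFin \o (fun w => f w * g w)).
  move=> mf f1 mg g1; apply: (@bounded_integrable _ _ _ _ _ (1 * 1 * 1)).
    exact: measurable_funM.
  by move=> w; rewrite normrM ler_pM.
have mthi := th_measurable Di.
have mci : measurable_fun [set: T] (fun w => cos (th i w)) by apply: measurableT_comp mthi; exact: measurable_cosR.
have msi : measurable_fun [set: T] (fun w => sin (th i w)) by apply: measurableT_comp mthi; exact: measurable_sinR.
have cm w : `|cos (th i w)| <= 1 by exact: cos_max.
have sm w : `|sin (th i w)| <= 1 by exact: sin_max.
split.
  under eq_Rintegral => w _.
    rewrite big_cons cosD mulrBl.
    rewrite (_ : _ - _ = cos (\sum_(j <- s) th j w) * \1_(joint s' E) w * cos (th i w) -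
       sin (\sum_(j <- s) th j w) * \1_(joint s' E) w * sin (th i w)); last by ring.
    over.
  rewrite RintegralB//; [|exact: int|exact: int].
  rewrite (wC cos measurable_cosR (@cos_max R)) (wS sin measurable_sinR (@sin_max R)).
  by rewrite th_cos// th_sin// !big_cons expRD cosD; ring.
under eq_Rintegral => w _.
  rewrite big_cons sinD mulrDl.
  rewrite (_ : _ + _ = cos (\sum_(j <- s) th j w) * \1_(joint s' E) w * sin (th i w) +
     sin (\sum_(j <- s) th j w) * \1_(joint s' E) w * cos (th i w)); last by ring.
  over.
rewrite RintegralD//; [|exact: int|exact: int].
rewrite (wC sin measurable_sinR (@sin_max R)) (wS cos measurable_cosR (@cos_max R)).
by rewrite th_cos// th_sin// !big_cons expRD sinD; ring.
Qed.

Lemma indep_phases s : uniq s -> (forall i, i \in s -> D i) ->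
  \int[P]_w cos (\sum_(i <- s) th i w) = expR (\sum_(i <- s) l i) * cos (\sum_(i <- s) t i) /\
  \int[P]_w sin (\sum_(i <- s) th i w) = expR (\sum_(i <- s) l i) * sin (\sum_(i <- s) t i).
Proof.
move=> us sD; have [] := @indep_phases_events s [::] (fun=> setT); rewrite ?cats0//.
have -> : joint [::] (fun=> setT) = setT by apply/seteqP; split => // w _ j.
rewrite probability_setT !mulr1 => <- <-.
by split; apply: eq_Rintegral => w _; rewrite indicT mulr1.
Qed.

End independent_phases.

(** * Uniqueness of characteristic functions *)

Section trigonometric_polynomials.
Context {R : realType}.
Implicit Types f g : R -> R.

(** The phase [v] makes room for sines, and [u = 0] for constants, so a single kind of generator is
    enough; products stay in the class by the product-to-sum formula. *)
Inductive trig_poly : (R -> R) -> Prop :=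
| trig_cos c u v : trig_poly (fun x => c * cos (u * x + v))
| trig_add f g : trig_poly f -> trig_poly g -> trig_poly (fun x => f x + g x).

Lemma eq_trig_poly f g : f =1 g -> trig_poly f -> trig_poly g.
Proof. by move=> /funext ->. Qed.

Lemma trig_cst c : trig_poly (fun=> c).
Proof. by apply: eq_trig_poly (trig_cos c 0 0) => x; rewrite mul0r addr0 cos0 mulr1. Qed.

Lemma trig_mul f g : trig_poly f -> trig_poly g -> trig_poly (fun x => f x * g x).
Proof.
elim=> {f} [c u v|f1 f2 _ IH1 _ IH2] tg; last first.
  by apply: eq_trig_poly (trig_add (IH1 tg) (IH2 tg)) => x; rewrite mulrDl.
elim: tg => {g} [c' u' v'|g1 g2 _ IH1 _ IH2]; last first.
  by apply: eq_trig_poly (trig_add IH1 IH2) => x; rewrite mulrDr.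
apply: eq_trig_poly (trig_add (trig_cos (2^-1 * c * c') (u + u') (v + v'))
  (trig_cos (2^-1 * c * c') (u - u') (v - v'))) => x.
have -> : (u + u') * x + (v + v') = (u * x + v) + (u' * x + v') by ring.
have -> : (u - u') * x + (v - v') = (u * x + v) - (u' * x + v') by ring.
by rewrite cosD cosB; field.
Qed.

Lemma trig_exp f n : trig_poly f -> trig_poly (fun x => f x ^+ n).
Proof.
move=> tf; elim: n => [|n IH]; first exact: trig_cst.
by apply: eq_trig_poly (trig_mul tf IH) => x; rewrite exprS.
Qed.

Lemma trig_onem f : trig_poly f -> trig_poly (fun x => 1 - f x).
Proof.
move=> tf; apply: eq_trig_poly (trig_add (trig_cst 1) (trig_mul (trig_cst (-1)) tf)) => x.
by rewrite mulN1r.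
Qed.

Lemma trig_sin u v : trig_poly (fun x => sin (u * x + v)).
Proof.
apply: eq_trig_poly (trig_cos 1 u (v - pi / 2)) => x.
by rewrite mul1r addrA cosBpihalf.
Qed.

Lemma measurable_cos_affine (u v : R) : measurable_fun [set: R] (fun x => cos (u * x + v)).
Proof.
apply: continuous_measurable_fun => x; apply: continuous_comp; last exact: continuous_cos.
by apply: cvgD; [apply: cvgM; [exact: cvg_cst | exact: cvg_id] | exact: cvg_cst].
Qed.

Lemma trig_measurable f : trig_poly f -> measurable_fun [set: R] f.
Proof.
elim=> [c u v|f1 f2 _ m1 _ m2]; last exact: measurable_funD.
by apply: measurable_funM => //; exact: measurable_cos_affine.
Qed.

Lemma trig_bounded f : trig_poly f -> exists M : R, forall x, `|f x| <= M.
Proof.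
elim=> [c u v|f1 f2 _ [M1 h1] _ [M2 h2]].
  by exists `|c| => x; rewrite normrM ler_piMr// cos_max.
by exists (M1 + M2) => x; apply: le_trans (ler_normD _ _) _; exact: lerD.
Qed.

Variables mu nu : probability (measurableTypeR R) R.
Hypothesis eq_cos : forall u, \int[mu]_x cos (u * x) = \int[nu]_x cos (u * x).
Hypothesis eq_sin : forall u, \int[mu]_x sin (u * x) = \int[nu]_x sin (u * x).

Lemma trig_integrable (P : probability (measurableTypeR R) R) f :
  trig_poly f -> P.-integrable [set: R] (EFin \o f).
Proof.
move=> tf; have [M fM] := trig_bounded tf.
exact: (@bounded_integrable _ (measurableTypeR R) R P f M (trig_measurable tf) fM).
Qed.

Lemma eq_trig_integral f : trig_poly f -> \int[mu]_x f x = \int[nu]_x f x.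
Proof.
elim=> [c u v|f1 f2 t1 IH1 t2 IH2]; last first.
  by rewrite !RintegralD ?IH1 ?IH2//; exact: trig_integrable.
have E (P : probability (measurableTypeR R) R) : \int[P]_x (c * cos (u * x + v)) =
    c * cos v * \int[P]_x cos (u * x) - c * sin v * \int[P]_x sin (u * x).
  have ic : P.-integrable [set: R] (EFin \o (fun x => cos (u * x))).
    apply: trig_integrable; apply: eq_trig_poly (trig_cos 1 u 0) => x.
    by rewrite mul1r addr0.
  have is_ : P.-integrable [set: R] (EFin \o (fun x => sin (u * x))).
    by apply: trig_integrable; apply: eq_trig_poly (trig_sin u 0) => x; rewrite addr0.
  rewrite -!RintegralZl// -RintegralB//; try exact: integrableZ_fun.
  by apply: eq_Rintegral => x _; rewrite cosD; ring.
by rewrite !E eq_cos eq_sin.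
Qed.

End trigonometric_polynomials.

(** * A trigonometric approximation of the indicator of an interval *)

Section kernel.
Context {R : realType}.

(* (1 - y)^N is close to exp (- N y); with N y = (m sin (z / m)) ^ (2 m), which
   tends to 0 or to +oo according as |z| < 1 or |z| > 1. *)
Definition ball_kernel (x0 r : R) (m : nat) (x : R) : R :=
  (1 - sin ((r * m.+1%:R)^-1 * (x - x0)) ^+ (2 * m.+1)) ^+ (m.+1 ^ (2 * m.+1)).

Lemma ball_kernel_trig x0 r m : trig_poly (ball_kernel x0 r m).
Proof.
apply: trig_exp; apply: trig_onem; apply: trig_exp.
apply: eq_trig_poly (trig_sin (r * m.+1%:R)^-1 (- ((r * m.+1%:R)^-1 * x0))) => x.
by rewrite mulrBr.
Qed.

Lemma bernoulli_onem (y : R) N : 0 <= y <= 1 -> 1 - N%:R * y <= (1 - y) ^+ N.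
Proof.
move=> /andP[y0 y1]; elim: N => [|N IH]; first by rewrite mul0r subr0 expr0.
rewrite exprS; apply: (@le_trans _ _ ((1 - y) * (1 - N%:R * y))); last first.
  by rewrite ler_wpM2l// subr_ge0.
rewrite -natr1; have : 0 <= N%:R * (y * y) :> R by rewrite !mulr_ge0.
by move=> h; rewrite -subr_ge0 (_ : _ - _ = N%:R * (y * y))//; ring.
Qed.

Lemma bernoulli_onep (y : R) N : 0 <= y -> 1 + N%:R * y <= (1 + y) ^+ N.
Proof.
move=> y0; elim: N => [|N IH]; first by rewrite mul0r addr0 expr0.
rewrite exprS; apply: (@le_trans _ _ ((1 + y) * (1 + N%:R * y))); last first.
  by rewrite ler_wpM2l// addr_ge0.
rewrite -natr1; have : 0 <= N%:R * (y * y) :> R by rewrite !mulr_ge0.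
by move=> h; rewrite -subr_ge0 (_ : _ - _ = N%:R * (y * y))//; ring.
Qed.

(** Bernoulli's inequality for [1 + y], and [(1 - y) * (1 + y) <= 1]. It stands in for the bound of
    [(1 - y) ^+ N] by an exponential. *)
Lemma onem_exp_le (y : R) N : 0 <= y <= 1 -> (1 - y) ^+ N * (1 + N%:R * y) <= 1.
Proof.
move=> /andP[y0 y1]; apply: (@le_trans _ _ ((1 - y) ^+ N * (1 + y) ^+ N)).
  by rewrite ler_wpM2l ?bernoulli_onep// exprn_ge0// subr_ge0.
rewrite -exprMn exprn_ile1//; first by rewrite mulr_ge0 ?subr_ge0// addr_ge0.
by rewrite -subr_sqr expr1n gerBl sqr_ge0.
Qed.

Lemma sin_even_01 (t : R) m : 0 <= sin t ^+ (2 * m) <= 1.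
Proof.
by rewrite exprM exprn_ge0 ?sqr_ge0//= exprn_ile1 ?sqr_ge0// sin2cos2 gerBl sqr_ge0.
Qed.

Lemma ball_kernel_01 x0 r m x : 0 <= ball_kernel x0 r m x <= 1.
Proof.
have /andP[h0 h1] := sin_even_01 ((r * m.+1%:R)^-1 * (x - x0)) m.+1.
rewrite /ball_kernel exprn_ge0 ?subr_ge0//=.
by rewrite exprn_ile1 ?subr_ge0// gerBl.
Qed.

Lemma norm_sin_le (t : R) : `|sin t| <= `|t|.
Proof.
wlog t0 : t / 0 <= t => [H|].
  have [|/ltW] := leP 0 t; first exact: H.
  by rewrite -oppr_ge0 => /H; rewrite sinN !normrN.
have : {within `[0, t], continuous (@sin R)}.
  by apply: continuous_subspaceT => x; exact: continuous_sin.
move=> /(MVT_segment t0 (fun x _ => is_derive_sin x))[c _].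
rewrite sin0 !subr0 => ->; rewrite normrM ler_piMl//; exact: cos_max.
Qed.

Lemma cvg_msin (z : R) : (m.+1%:R * sin (z / m.+1%:R)) @[m --> \oo] --> z.
Proof.
have [->|z0] := eqVneq z 0.
  by under eq_fun do rewrite mul0r sin0 mulr0; exact: cvg_cst.
have D := is_derive_sin (0 : R).
have DE : 'D_1 (@sin R) 0 = 1 by rewrite (@derive_val _ _ _ _ _ _ _ D) cos0.
have C : (fun h : R => h^-1 *: ((@sin R \o shift 0) (h *: 1) - sin 0)) @ 0^' --> 'D_1 (@sin R) 0.
  exact: (@ex_derive _ _ _ _ _ _ _ D).
rewrite DE in C.
move/cvgr_dnbhsP: C => /(_ (fun m => z / m.+1%:R)) /=.
have h1 : (forall n : nat, z / n.+1%:R != 0) /\ z / n.+1%:R @[n --> \oo] --> 0.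
  split=> [n|]; first by rewrite mulf_neq0// invr_eq0.
  rewrite -[X in _ --> X](mulr0 z); apply: cvgM; [exact: cvg_cst | exact: cvg_harmonic].
move=> /(_ h1) H.
rewrite -[X in _ --> X](mulr1 z).
apply: cvg_trans (cvgM (cvg_cst z) H); apply: near_eq_cvg; near=> m.
rewrite /= sin0 subr0 scaler1 addr0.
by rewrite /GRing.scale /= mulrA invf_div mulrCA divff// mulr1.
Unshelve. all: by end_near. Qed.

Lemma ball_kernel_in x0 r x : 0 < r -> `|x - x0| < r ->
  ball_kernel x0 r m x @[m --> \oo] --> (1 : R).
Proof.
move=> r0 xr; pose z := (x - x0) / r.
have z1 : `|z ^+ 2| < 1.
  rewrite normrX expr_lt1// normrM normfV (gtr0_norm r0) ltr_pdivrMr// mul1r//.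
have cv : (1 - (z ^+ 2) ^+ m.+1) @[m --> \oo] --> (1 : R).
  rewrite -[X in _ --> X]subr0; apply: cvgB; first exact: cvg_cst.
  by rewrite (cvg_shiftS (fun m => (z ^+ 2) ^+ m)); exact: cvg_expr.
suff sq : \forall m \near \oo, 1 - (z ^+ 2) ^+ m.+1 <= ball_kernel x0 r m x <= 1.
  exact: (squeeze_cvgr sq cv (cvg_cst _)).
apply: nearW => m /=.
have /andP[_ ->] := ball_kernel_01 x0 r m x; rewrite andbT.
(* In Bernoulli's bound the product [N * y] is a power of [m.+1 * sin (z / m.+1)], which is at most
   [|z|] in absolute value. *)
apply: le_trans (bernoulli_onem _ (sin_even_01 _ _)).
rewrite lerD2l lerN2 natrX -exprMn !exprM lerXn2r ?nnegrE ?sqr_ge0//.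
rewrite -[leLHS]real_normK ?num_real// -[leRHS]real_normK ?num_real//.
rewrite lerXn2r ?nnegrE// normrM.
apply: (@le_trans _ _ (`|m.+1%:R| * `|(r * m.+1%:R)^-1 * (x - x0)|)).
  by rewrite ler_wpM2l// norm_sin_le.
rewrite -normrM invfM /z le_eqVlt; apply/orP; left; apply/eqP; congr (`|_|).
by field; rewrite gt_eqF//= nat1r pnatr_eq0.
Qed.

Lemma ball_kernel_out x0 r x : 0 < r -> r < `|x - x0| ->
  ball_kernel x0 r m x @[m --> \oo] --> (0 : R).
Proof.
move=> r0 xr; pose z := (x - x0) / r.
have z1 : 1 < `|z| by rewrite normrM normfV (gtr0_norm r0) ltr_pdivlMr// mul1r.
(* Strictly between 1 and [|z|]: eventually [|m.+1 * sin (z / m.+1)|] exceeds [th], whose powers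
   still tend to infinity. *)
pose th := (1 + `|z|) / 2.
have th1 : 1 < th by rewrite /th; lra.
have thz : th < `|z| by rewrite /th; lra.
have ev : \forall m \near \oo, th < `|m.+1%:R * sin (z / m.+1%:R)|.
  by apply: (cvgr_gt `|z|) => //; apply: cvg_norm; exact: cvg_msin.
have th2 : `|(th ^+ 2)^-1| < 1.
  by rewrite normfV ger0_norm ?sqr_ge0// invf_lt1 ?exprn_gt0 ?exprn_egt1//; lra.
have cv : ((th ^+ 2)^-1) ^+ m.+1 @[m --> \oo] --> (0 : R).
  by rewrite (cvg_shiftS (fun m => ((th ^+ 2)^-1) ^+ m)); exact: cvg_expr.
suff sq : \forall m \near \oo, 0 <= ball_kernel x0 r m x <= ((th ^+ 2)^-1) ^+ m.+1.
  exact: (squeeze_cvgr sq (cvg_cst _) cv).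
near=> m.
have /andP[-> _] := ball_kernel_01 x0 r m x; rewrite /=.
have := onem_exp_le (m.+1 ^ (2 * m.+1)) (sin_even_01 ((r * m.+1%:R)^-1 * (x - x0)) m.+1).
rewrite -/(ball_kernel x0 r m x) natrX -exprMn => H.
have zE : (r * m.+1%:R)^-1 * (x - x0) = z / m.+1%:R by rewrite /z invfM; ring.
have tm : th < `|m.+1%:R * sin (z / m.+1%:R)| by near: m.
rewrite zE in H.
have w0 : (th ^+ 2) ^+ m.+1 <= (m.+1%:R * sin (z / m.+1%:R)) ^+ (2 * m.+1).
  rewrite exprM lerXn2r ?nnegrE ?sqr_ge0// -[leRHS]real_normK ?num_real//.
  by rewrite lerXn2r ?nnegrE// ?ltW//; lra.
have thm : 0 < (th ^+ 2) ^+ m.+1 by rewrite !exprn_gt0//; lra.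
rewrite exprVn -[leRHS]mul1r ler_pdivlMr//; apply: le_trans H.
have /andP[k0 _] := ball_kernel_01 x0 r m x.
by rewrite ler_wpM2l//; apply: le_trans w0 _; rewrite lerDr.
Unshelve. all: by end_near. Qed.

End kernel.

(** * Comparison of laws on intervals, then on rays *)

Section uniqueness.
Context {R : realType}.

(** The limit of the kernel is not controlled at the two endpoints, hence an open interval on one
    side and a closed one on the other. *)
Lemma eq_cf_le_ball (mu nu : probability (measurableTypeR R) R) (x0 r : R) :
  (forall u, \int[mu]_x cos (u * x) = \int[nu]_x cos (u * x)) ->
  (forall u, \int[mu]_x sin (u * x) = \int[nu]_x sin (u * x)) -> 0 < r ->
  (mu `](x0 - r)%R, (x0 + r)%R[%classic <= nu `[(x0 - r)%R, (x0 + r)%R]%classic)%E.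
Proof.
move=> eqc eqs r0; set A := `]x0 - r, x0 + r[%classic; set B := `[x0 - r, x0 + r]%classic.
have mA : measurable (A : set (measurableTypeR R)) by exact: measurable_itv.
have mB : measurable (B : set (measurableTypeR R)) by exact: measurable_itv.
have mCB : measurable (~` B : set (measurableTypeR R)) by exact: measurableC.
have AE x : A x <-> `|x - x0| < r by rewrite /A /= in_itv /= ltr_distl.
have BE x : B x <-> `|x - x0| <= r by rewrite /B /= in_itv /= ler_distl.
have k01 m x := ball_kernel_01 x0 r m x.
have kt m := ball_kernel_trig x0 r m.
have km m := trig_measurable (kt m).
have ind01 (S : set (measurableTypeR R)) x : (\1_S x : R) = 0 \/ (\1_S x : R) = 1.
  by rewrite indicE; case: (_ \in _); [right | left].
have mind (S : set (measurableTypeR R)) m : measurable S ->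
    measurable_fun [set: measurableTypeR R] (fun x => ball_kernel x0 r m x * \1_S x).
  move=> mS; apply: measurable_funM; first exact: km.
  by have : measurable_fun [set: measurableTypeR R] (\1_S : measurableTypeR R -> R) by exact: measurable_indic.
have bind (S : set (measurableTypeR R)) m x : `|ball_kernel x0 r m x * \1_S x| <= 1.
  have /andP[k0 k1] := k01 m x.
  by have [->|->] := ind01 S x; rewrite ?mulr0 ?normr0// mulr1 ger0_norm.
have iind (P : probability (measurableTypeR R) R) (S : set (measurableTypeR R)) m : measurable S ->
    P.-integrable [set: measurableTypeR R] (EFin \o (fun x => ball_kernel x0 r m x * \1_S x)).
  by move=> mS; apply: (@bounded_integrable _ (measurableTypeR R) R P _ 1 (mind S m mS)) => x; exact: bind.
have cA x : ball_kernel x0 r m x * \1_A x @[m --> \oo] --> (\1_A x : R).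
  have [xA|xA] := boolP (x \in A).
    have -> : (\1_A x : R) = 1 by rewrite indicE xA.
    by under eq_fun do rewrite mulr1; apply: ball_kernel_in => //; apply/AE; exact/set_mem.
  have -> : (\1_A x : R) = 0 by rewrite indicE (negbTE xA).
  by under eq_fun do rewrite mulr0; exact: cvg_cst.
have cB x : ball_kernel x0 r m x * \1_(~` B) x @[m --> \oo] --> (0 : R).
  have [xB|xB] := boolP (x \in ~` B).
    have -> : (\1_(~` B) x : R) = 1 by rewrite indicE xB.
    under eq_fun do rewrite mulr1; apply: ball_kernel_out => //; rewrite ltNge.
    by apply/negP => /BE; move/set_mem: xB.
  have -> : (\1_(~` B) x : R) = 0 by rewrite indicE (negbTE xB).
  by under eq_fun do rewrite mulr0; exact: cvg_cst.
have [_ c1] := @Rintegral_dominated _ (measurableTypeR R) R mu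
  (fun m x => ball_kernel x0 r m x * \1_A x) \1_A (fun=> 1) (fun m => mind A m mA) (cst_integrable mu 1)
  cA (fun m => bind A m).
have [_ c2] := @Rintegral_dominated _ (measurableTypeR R) R nu
  (fun m x => ball_kernel x0 r m x * \1_(~` B) x) (fun=> 0) (fun=> 1) (fun m => mind (~` B) m mCB) (cst_integrable nu 1)
  cB (fun m => bind (~` B) m).
rewrite Rintegral_indic// in c1; rewrite Rintegral1 in c2.
have fA : mu A \is a fin_num by exact: fin_num_measure.
have fB : nu B \is a fin_num by exact: fin_num_measure.
rewrite -(fineK fA) -(fineK fB) lee_fin.
have c3 : (fine (nu B) + \int[nu]_x (ball_kernel x0 r m x * \1_(~` B) x)) @[m --> \oo] --> fine (nu B).
  by rewrite -[X in _ --> X]addr0; apply: cvgD => //; exact: cvg_cst.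
apply: (ler_cvg_to c1 c3); apply: nearW => m.
have ik (P : probability (measurableTypeR R) R) := trig_integrable P (kt m).
apply: (@le_trans _ _ (\int[mu]_x ball_kernel x0 r m x)).
  apply: (Rintegral_ler (iind mu A m mA) (ik mu)) => x.
  have /andP[k0 k1] := k01 m x.
  by have [->|->] := ind01 A x; rewrite ?mulr0 ?mulr1.
rewrite (eq_trig_integral eqc eqs (kt m)).
have iB : nu.-integrable [set: measurableTypeR R] (EFin \o (\1_B : measurableTypeR R -> R)).
  apply: (@bounded_integrable _ (measurableTypeR R) R nu _ 1); first exact: measurable_indic.
  by move=> x; have [->|->] := ind01 B x; rewrite ?normr0 ?normr1.
rewrite -(Rintegral_indic nu mB) -RintegralD//; last exact: iind.
apply: (Rintegral_ler (ik nu) (integrableD_fun iB (iind nu (~` B) m mCB))) => x.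
have /andP[k0 k1] := k01 m x.
rewrite !indicE in_setC; case: (x \in B) => /=; first by rewrite mulr0 addr0.
by rewrite mulr1 add0r.
Qed.

(** The ray is an increasing union of open intervals whose closures it contains, so the endpoints
    lost in [eq_cf_le_ball] cost nothing in the limit. Exchanging [mu] and [nu] then gives
    equality. *)
Lemma eq_cf_le_ray (mu nu : probability (measurableTypeR R) R) (a : R) :
  (forall u, \int[mu]_x cos (u * x) = \int[nu]_x cos (u * x)) ->
  (forall u, \int[mu]_x sin (u * x) = \int[nu]_x sin (u * x)) ->
  (mu `]a, +oo[%classic <= nu `]a, +oo[%classic)%E.
Proof.
move=> eqc eqs.
pose A (n : nat) : set (measurableTypeR R) := `]a + n.+1%:R^-1, a + n.+1%:R^-1 + 2 * n.+1%:R[%classic.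
have mA n : measurable (A n) by exact: measurable_itv.
have AU : \bigcup_n A n = `]a, +oo[%classic.
  apply/seteqP; split=> x.
    move=> [n _]; rewrite /A /= !in_itv /= andbT => /andP[h _].
    by apply: lt_trans h; rewrite ltrDl invr_gt0.
  rewrite /= in_itv /= andbT => ax.
  have xa : 0 < x - a by rewrite subr_gt0.
  (* The integer [n.+1] has to exceed both [x - a] and its inverse, hence their sum. *)
  have K0 : 0 <= (x - a) + (x - a)^-1 by rewrite addr_ge0// ?invr_ge0 ltW.
  have /andP[_] := truncn_itv K0; set n := Num.truncn _ => hn.
  have n0 : 0 < n.+1%:R :> R by rewrite ltr0n.
  have h1 : n.+1%:R^-1 < x - a.
    rewrite -[ltRHS]invrK ltf_pV2 ?posrE ?invr_gt0//; apply: le_lt_trans hn.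
    by rewrite lerDr ltW.
  have h2 : x - a < n.+1%:R by apply: le_lt_trans hn; rewrite lerDl invr_ge0 ltW.
  exists n => //; rewrite /A /= in_itv /=; apply/andP; split; first by rewrite -ltrBrDl.
  have : 0 < n.+1%:R^-1 :> R by rewrite invr_gt0.
  by move: h2 n0; set c := n.+1%:R; set e := c^-1; lra.
have mU : measurable (\bigcup_n A n) by exact: bigcup_measurable.
have nd : nondecreasing_seq A.
  apply/nondecreasing_seqP => n; apply/subsetPset => x; rewrite /A /= !in_itv /= => /andP[h1 h2].
  have i0 : n.+2%:R^-1 <= n.+1%:R^-1 :> R by rewrite lef_pV2 ?posrE ?ltr0n// ler_nat.
  have i1 : n.+1%:R^-1 <= 1 :> R by rewrite invf_le1 ?ltr0n// ler1n.
  have i2 : 0 < n.+2%:R^-1 :> R by rewrite invr_gt0 ltr0n.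
  have n2 : n.+2%:R = n.+1%:R + 1 :> R by rewrite -natr1.
  move: h1 h2 i0 i1 i2; rewrite n2; set e := (n.+1%:R + 1)^-1; set e1 := n.+1%:R^-1; set c := n.+1%:R.
  by move=> *; apply/andP; split; lra.
have cv := @nondecreasing_cvg_mu _ (measurableTypeR R) R mu A mA mU nd; rewrite AU in cv.
rewrite -(cvg_lim (@ereal_hausdorff R) cv); apply: lime_le; first by apply/cvg_ex; exists (mu `]a, +oo[%classic).
apply: nearW => n /=.
have n0 : 0 < n.+1%:R :> R by rewrite ltr0n.
have e0 : 0 < n.+1%:R^-1 :> R by rewrite invr_gt0.
have := @eq_cf_le_ball mu nu (a + n.+1%:R^-1 + n.+1%:R) n.+1%:R eqc eqs n0.
rewrite addrK -addrA (_ : n.+1%:R + n.+1%:R = 2 * n.+1%:R); last by ring.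
move=> h; apply: le_trans h _; apply: le_measure; rewrite ?inE; [exact: measurable_itv | exact: measurable_itv |].
move=> x; rewrite /= !in_itv /= andbT => /andP[h _]; apply: lt_le_trans h.
by rewrite ltrDl.
Qed.

Theorem eq_cf_eq_measure (mu nu : probability (measurableTypeR R) R) :
  (forall u, \int[mu]_x cos (u * x) = \int[nu]_x cos (u * x)) ->
  (forall u, \int[mu]_x sin (u * x) = \int[nu]_x sin (u * x)) ->
  forall A : set (measurableTypeR R), measurable A -> mu A = nu A.
Proof.
move=> eqc eqs A mA; apply: (@measure_unique _ R (measurableTypeR R) (@RGenOInfty.G R)
  (fun n => `](- n%:R)%R, +oo[%classic) _ _ _ _ mu nu _ _ A mA).
- exact: RGenOInfty.measurableE.
- move=> B C [x ->] [y ->]; exists (Num.max x y).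
  apply/seteqP; split => z; rewrite /= !in_itv /= !andbT gt_max; last by case/andP.
  by case=> -> ->.
- by move=> n; exists (- n%:R).
- apply/seteqP; split => // x _; exists (Num.truncn `|x|).+1 => //=.
  rewrite in_itv /= andbT; have /andP[_ h] := truncn_itv (normr_ge0 x).
  by rewrite ltrNl; apply: le_lt_trans h; rewrite -normrN ler_norm.
- move=> B [x ->]; apply/eqP; rewrite eq_le !eq_cf_le_ray//.
- by move=> n; rewrite -ge0_fin_numE//; apply: fin_num_measure; exact: measurable_itv.
Qed.

End uniqueness.

(** * Moments and derivatives of the characteristic function *)

Section derive_tools.
Context {R : realType}.
Implicit Types f g : R -> R.

Lemma is_derive_ext f g (u df : R) : f =1 g -> is_derive u 1 f df -> is_derive u 1 g df.
Proof. by move=> /funext ->. Qed.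

Lemma is_derive_val f (u df df' : R) : df = df' -> is_derive u 1 f df -> is_derive u 1 f df'.
Proof. by move=> ->. Qed.

Lemma is_derive_mul f g (u df dg : R) : is_derive u 1 f df -> is_derive u 1 g dg ->
  is_derive u 1 (fun x => f x * g x) (df * g u + f u * dg).
Proof.
move=> hf hg; have := is_deriveM hf hg; apply: is_derive_val.
by rewrite /GRing.scale /= addrC mulrC.
Qed.

Lemma is_derive_add f g (u df dg : R) : is_derive u 1 f df -> is_derive u 1 g dg ->
  is_derive u 1 (fun x => f x + g x) (df + dg).
Proof. by move=> hf hg; exact: is_deriveD. Qed.

Lemma is_derive_sub f g (u df dg : R) : is_derive u 1 f df -> is_derive u 1 g dg ->
  is_derive u 1 (fun x => f x - g x) (df - dg).
Proof. by move=> hf hg; exact: is_deriveB. Qed.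

Lemma is_derive_scale f (k u df : R) : is_derive u 1 f df ->
  is_derive u 1 (fun x => k * f x) (k * df).
Proof. by move=> hf; exact: is_deriveZ. Qed.

Lemma is_derive_unique f g (u df dg : R) : (\forall x \near u, f x = g x) ->
  is_derive u 1 f df -> is_derive u 1 g dg -> df = dg.
Proof.
move=> fg hf hg.
have hg' := near_eq_is_derive fg hf.
by rewrite -(@derive_val _ _ _ _ _ _ _ hg) (@derive_val _ _ _ _ _ _ _ hg').
Qed.

Lemma near_ball (u rho : R) : `|u| < rho -> \forall x \near u, `|x| < rho.
Proof.
move=> hu; apply/nbhs_ballP; exists (rho - `|u|); first by rewrite /= subr_gt0.
move=> x; rewrite /ball /= distrC => xu.
have := ler_normD u (x - u); rewrite addrC subrK => h.
by apply: le_lt_trans h _; rewrite addrC -ltrBrDr.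
Qed.

End derive_tools.

Section derive_under_integral.
Context {d : measure_display} {T : measurableType d} {R : realType}.
Variable P : probability T R.

Lemma is_derive_Rintegral (f f' : R -> T -> R) (G : T -> R) (a u v : R) :
  u < a -> a < v -> (forall x, P.-integrable [set: T] (EFin \o f x)) ->
  (forall (x : R) (w : T), is_derive x (1 : R) (f^~ w) (f' x w)) ->
  (forall x w, u < x -> x < v -> `|f' x w| <= G w) -> P.-integrable [set: T] (EFin \o G) ->
  is_derive a 1 (fun x => \int[P]_w f x w) (\int[P]_w f' a w).
Proof.
move=> ua av intf df fG intG.
have Ia : `]u, v[%classic a by rewrite /= in_itv /= ua av.
have dE (x : R) (w : T) : partial1of2 f x w = f' x w.
  by rewrite partial1of2E; apply: (@derive_val _ _ _ _ _ _ _ (df x w)).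
have G0 (w : T) : 0 <= G w by apply: le_trans (fG a w ua av); exact: normr_ge0.
have h1 (x : R) (y : T) : `]u, v[%classic x -> [set: T] y -> derivable (f^~ y) x 1.
  by move=> _ _; apply: (@ex_derive _ _ _ _ _ _ _ (df x y)).
have h2 (x : R) (y : T) : `]u, v[%classic x -> [set: T] y -> `|partial1of2 f x y| <= G y.
  by rewrite /= in_itv /= dE => /andP[? ?] _; exact: fG.
apply: DeriveDef.
  exact: (@derivable_under_integral _ _ _ P f setT measurableT a u v Ia (fun x _ => intf x) h1 G G0 intG h2).
rewrite -derive1E (@differentiation_under_integral _ _ _ P f setT measurableT a u v Ia (fun x _ => intf x) h1 G G0 intG h2).
by apply: eq_Rintegral => w _; rewrite dE.
Qed.

End derive_under_integral.

Section moments.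
Context {d : measure_display} {T : measurableType d} {R : realType}.
Variables (P : probability T R) (X : T -> R).
Hypothesis mX : measurable_fun [set: T] X.

Definition has_moment n := P.-integrable [set: T] (EFin \o (fun w => X w ^+ n)).
(** [cmom n u] and [smom n u] are the real and imaginary parts of [E (X^n e^(i u X))], which is
    [(- i d/du)^n] of the characteristic function. *)
Definition cmom n u := \int[P]_w (X w ^+ n * cos (u * X w)).
Definition smom n u := \int[P]_w (X w ^+ n * sin (u * X w)).

Lemma measurable_powX n : measurable_fun [set: T] (fun w => X w ^+ n).
Proof. exact: measurable_funX. Qed.

Lemma measurable_cosX (u : R) : measurable_fun [set: T] (fun w => cos (u * X w)).
Proof.
apply: (@measurableT_comp _ _ _ _ _ _ (@cos R)); last exact: measurable_funM.
by apply: continuous_measurable_fun => x; exact: continuous_cos.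
Qed.

Lemma measurable_sinX (u : R) : measurable_fun [set: T] (fun w => sin (u * X w)).
Proof.
apply: (@measurableT_comp _ _ _ _ _ _ (@sin R)); last exact: measurable_funM.
by apply: continuous_measurable_fun => x; exact: continuous_sin.
Qed.

Lemma has_moment_norm n : has_moment n -> P.-integrable [set: T] (EFin \o (fun w => `|X w ^+ n|)).
Proof. by move=> h; apply: integrable_norm. Qed.

Lemma has_moment_le n m : (m <= n)%N -> has_moment n -> has_moment m.
Proof.
move=> mn hn; apply: (le_integrable_fun (g := fun w => 1 + `|X w ^+ n|)).
- exact: measurable_powX.
- move=> w; rewrite !normrX; have [x1|x1] := leP `|X w| 1.
    by apply: (@le_trans _ _ 1); [rewrite exprn_ile1 | rewrite lerDl exprn_ge0].
  by apply: (@le_trans _ _ (`|X w| ^+ n)); [rewrite ler_weXn2l// ltW | rewrite lerDr].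
- by apply: integrableD_fun; [exact: cst_integrable | exact: has_moment_norm].
Qed.

Lemma integrable_momM n (g : T -> R) : has_moment n -> measurable_fun [set: T] g ->
  (forall w, `|g w| <= 1) -> P.-integrable [set: T] (EFin \o (fun w => X w ^+ n * g w)).
Proof.
move=> hn mg g1; apply: (le_integrable_fun _ _ (has_moment_norm hn)).
  by apply: measurable_funM => //; exact: measurable_powX.
by move=> w; rewrite normrM ler_piMr.
Qed.

Lemma integrable_cmom n u : has_moment n ->
  P.-integrable [set: T] (EFin \o (fun w => X w ^+ n * cos (u * X w))).
Proof.
by move=> hn; apply: integrable_momM => //; [exact: measurable_cosX | move=> w; exact: cos_max].
Qed.

Lemma integrable_smom n u : has_moment n ->
  P.-integrable [set: T] (EFin \o (fun w => X w ^+ n * sin (u * X w))).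
Proof.
by move=> hn; apply: integrable_momM => //; [exact: measurable_sinX | move=> w; exact: sin_max].
Qed.

Lemma is_derive_mulr (x u : R) : is_derive u 1 (fun v => v * x) x.
Proof.
apply: (@is_derive_ext _ (fun v => x * v)); first by move=> v; rewrite mulrC.
by apply: is_derive_val (is_derive_scale x (is_derive_id u 1)); rewrite mulr1.
Qed.

Lemma is_derive_cmom n (u : R) : has_moment n.+1 -> is_derive u 1 (cmom n) (- smom n.+1 u).
Proof.
move=> hn; have hn' := has_moment_le (leqnSn n) hn.
have -> : - smom n.+1 u = \int[P]_w (- (X w ^+ n.+1 * sin (u * X w))).
  rewrite /smom -mulN1r -RintegralZl//; last exact: integrable_smom.
  by apply: eq_Rintegral => w _; rewrite mulN1r.
apply: (@is_derive_Rintegral _ _ _ P _ (fun v w => - (X w ^+ n.+1 * sin (v * X w)))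
  (fun w => `|X w ^+ n.+1|) u (u - 1) (u + 1)); [lra | lra | | | | exact: has_moment_norm].
- by move=> v; exact: integrable_cmom.
- move=> v w; apply: is_derive_val (is_derive_scale (X w ^+ n) (is_derive1_comp (is_derive_cos _) (is_derive_mulr (X w) v))).
  by rewrite /GRing.scale /= exprSr; ring.
- by move=> v w _ _; rewrite normrN normrM ler_piMr// sin_max.
Qed.

Lemma is_derive_smom n (u : R) : has_moment n.+1 -> is_derive u 1 (smom n) (cmom n.+1 u).
Proof.
move=> hn; have hn' := has_moment_le (leqnSn n) hn.
apply: (@is_derive_Rintegral _ _ _ P _ (fun v w => X w ^+ n.+1 * cos (v * X w))
  (fun w => `|X w ^+ n.+1|) u (u - 1) (u + 1)); [lra | lra | | | | exact: has_moment_norm].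
- by move=> v; exact: integrable_smom.
- move=> v w; apply: is_derive_val (is_derive_scale (X w ^+ n) (is_derive1_comp (is_derive_sin _) (is_derive_mulr (X w) v))).
  by rewrite /GRing.scale /= exprSr; ring.
- by move=> v w _ _; rewrite normrM ler_piMr// cos_max.
Qed.

Lemma smom_0 n : smom n 0 = 0.
Proof.
rewrite /smom; under eq_Rintegral do rewrite mul0r sin0 mulr0.
by rewrite Rintegral1.
Qed.

Lemma cmom_0 n : cmom n 0 = \int[P]_w X w ^+ n.
Proof. by rewrite /cmom; apply: eq_Rintegral => w _; rewrite mul0r cos0 mulr1. Qed.

Lemma cmom_even n u : cmom n (- u) = cmom n u.
Proof. by rewrite /cmom; apply: eq_Rintegral => w _; rewrite mulNr cosN. Qed.

Section exp_poly_cf.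
Variables (p q : {poly R}) (rho : R).
Hypothesis rho0 : 0 < rho.

(** [exp_cos] and [exp_sin] are the real and imaginary parts of [(A + i B) e^(p + i q)]; applying
    [- i d/du] replaces [A + i B] by [nextA A B + i nextB A B]. *)
Definition exp_cos (A B : {poly R}) u := expR p.[u] * (A.[u] * cos q.[u] - B.[u] * sin q.[u]).
Definition exp_sin (A B : {poly R}) u := expR p.[u] * (A.[u] * sin q.[u] + B.[u] * cos q.[u]).
Definition nextA (A B : {poly R}) := B^`() + B * p^`() + A * q^`().
Definition nextB (A B : {poly R}) := - (A^`() + A * p^`() - B * q^`()).

Lemma is_derive_exp_cos A B (u : R) : is_derive u 1 (exp_cos A B) (- exp_sin (nextA A B) (nextB A B) u).
Proof.
have dq := is_derive_poly q u.
apply: is_derive_val (is_derive_mul (is_derive1_comp (is_derive_expR _) (is_derive_poly p u))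
  (is_derive_sub (is_derive_mul (is_derive_poly A u) (is_derive1_comp (is_derive_cos _) dq))
     (is_derive_mul (is_derive_poly B u) (is_derive1_comp (is_derive_sin _) dq)))).
rewrite /exp_sin /nextA /nextB /= !hornerE /GRing.scale /=; ring.
Qed.

Lemma is_derive_exp_sin A B (u : R) : is_derive u 1 (exp_sin A B) (exp_cos (nextA A B) (nextB A B) u).
Proof.
have dq := is_derive_poly q u.
apply: is_derive_val (is_derive_mul (is_derive1_comp (is_derive_expR _) (is_derive_poly p u))
  (is_derive_add (is_derive_mul (is_derive_poly A u) (is_derive1_comp (is_derive_sin _) dq))
     (is_derive_mul (is_derive_poly B u) (is_derive1_comp (is_derive_cos _) dq)))).
rewrite /exp_cos /nextA /nextB /= !hornerE /GRing.scale /=; ring.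
Qed.

Hypothesis cf_cos : forall u, `|u| < rho -> cmom 0 u = exp_cos 1 0 u.
Hypothesis cf_sin : forall u, `|u| < rho -> smom 0 u = exp_sin 1 0 u.

Lemma local_moments n : has_moment n -> exists A B : {poly R}, forall u, `|u| < rho ->
  cmom n u = exp_cos A B u /\ smom n u = exp_sin A B u.
Proof.
elim: n => [|n IH] hn; first by exists 1, 0 => u hu; rewrite cf_cos// cf_sin.
have [A [B AB]] := IH (has_moment_le (leqnSn n) hn).
exists (nextA A B), (nextB A B) => u hu; split.
  apply: is_derive_unique (is_derive_smom u hn) (is_derive_exp_sin A B u).
  by apply: filterS (near_ball hu) => x /AB[].
apply: oppr_inj; apply: is_derive_unique (is_derive_cmom u hn) (is_derive_exp_cos A B u).
by apply: filterS (near_ball hu) => x /AB[].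
Qed.

(** [cmom (2 * k)] is even and locally an [exp_cos], hence smooth with derivative 0 at the origin.
    Two mean value theorems leave a second derivative, bounded near 0 by [K]. *)
Lemma cmom_quadratic k : has_moment (2 * k) -> exists K : R, exists2 e : R, 0 < e &
  forall u, 0 < u -> u < e -> cmom (2 * k) 0 - cmom (2 * k) u <= K * u ^+ 2.
Proof.
move=> hk; have [A [B AB]] := local_moments hk.
have h0 : `|0 : R| < rho by rewrite normr0.
pose f := exp_cos A B; pose A1 := nextA A B; pose B1 := nextB A B.
pose A2 := nextA A1 B1; pose B2 := nextB A1 B1.
have fe u : `|u| < rho -> f (- u) = f u.
  by move=> hu; rewrite /f -(AB _ hu).1 -(AB (- u) _).1 ?normrN// cmom_even.
have f10 : exp_sin A1 B1 0 = 0.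
  have D := is_derive_exp_cos A B 0.
  have DN : is_derive (0 : R) 1 (fun u => f (- u)) (exp_sin A1 B1 0).
    have D0 := is_derive1_comp (is_derive_exp_cos A B (-1 * 0)) (is_derive_scale (-1) (is_derive_id (0 : R) 1)).
    apply: is_derive_ext (is_derive_val _ D0) => [x|]; first by rewrite /= mulN1r.
    by rewrite mulr0 /GRing.scale /= mulr1 ?mulrN1 ?mulN1r opprK.
  have := is_derive_unique _ DN D.
  move=> H; have {}H : exp_sin A1 B1 0 = - exp_sin A1 B1 0.
    by apply: H; apply: filterS (near_ball h0) => x; exact: fe.
  lra.
have C2 : {for 0, continuous (exp_cos A2 B2)}.
  have := @ex_derive _ _ _ _ _ _ _ (is_derive_exp_cos A2 B2 0).
  by move=> /derivable1_diffP/differentiable_continuous.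
pose K := `|exp_cos A2 B2 0| + 1.
have nearK : \forall v \near (0 : R), `|exp_cos A2 B2 v| < K.
  move/cvgrPdist_lt: (C2) => /(_ _ ltr01); apply: filterS => v hv.
  rewrite -(subKr (exp_cos A2 B2 0) (exp_cos A2 B2 v)); apply: le_lt_trans (ler_normB _ _) _.
  by rewrite /K ltrD2l.
have /nbhs_ballP[e1 /= e10 he1] := nearK.
exists K; exists (Num.min e1 rho); first by rewrite lt_min e10.
move=> u u0; rewrite lt_min => /andP[ue1 urho].
have hu : `|u| < rho by rewrite gtr0_norm.
rewrite (AB _ hu).1 (AB _ h0).1 -/f.
have cont (g dg : R -> R) (a b : R) : (forall x : R, is_derive x (1 : R) g (dg x)) -> {within `[a, b], continuous g}.
  move=> dgx; apply: continuous_subspaceT => x.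
  by have := @ex_derive _ _ _ _ _ _ _ (dgx x) => /derivable1_diffP/differentiable_continuous.
have [c /andP[c0 cu] fE] : exists2 c, 0 <= c <= u & f u - f 0 = - exp_sin A1 B1 c * (u - 0).
  have [c ci fE] := MVT_segment (ltW u0) (fun x _ => is_derive_exp_cos A B x) (cont _ _ 0 u (is_derive_exp_cos A B)).
  by exists c => //; move: ci; rewrite in_itv.
have [c' /andP[c'0 c'c] gE] : exists2 c', 0 <= c' <= c & exp_sin A1 B1 c - exp_sin A1 B1 0 = exp_cos A2 B2 c' * (c - 0).
  have [c' ci gE] := MVT_segment c0 (fun x _ => is_derive_exp_sin A1 B1 x) (cont _ _ 0 c (is_derive_exp_sin A1 B1)).
  by exists c' => //; move: ci; rewrite in_itv.
rewrite f10 !subr0 in gE; rewrite subr0 in fE.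
have -> : f 0 - f u = exp_cos A2 B2 c' * c * u by rewrite -opprB fE gE; ring.
have hK : `|exp_cos A2 B2 c'| <= K.
  apply: ltW; apply: he1; rewrite /ball /= sub0r normrN ger0_norm//.
  by apply: le_lt_trans ue1; exact: le_trans cu.
have K0 : 0 <= K by rewrite addr_ge0.
apply: (@le_trans _ _ (K * c * u)).
  by apply: ler_wpM2r; [exact: ltW | apply: ler_wpM2r => //; apply: le_trans hK; exact: ler_norm].
rewrite expr2 mulrA; apply: ler_wpM2r; first exact: ltW.
by rewrite ler_wpM2l.
Qed.

End exp_poly_cf.
End moments.

Section fatou_tools.
Context {d : measure_display} {T : measurableType d} {R : realType}.
Variable P : probability T R.

Lemma integrable_of_bounded_integrals (f_ : nat -> T -> R) (f : T -> R) (K : R) :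
  (forall n, P.-integrable [set: T] (EFin \o f_ n)) -> (forall n w, 0 <= f_ n w) ->
  (forall w, f_ ^~ w @ \oo --> f w) -> (forall n, \int[P]_w f_ n w <= K) ->
  P.-integrable [set: T] (EFin \o f).
Proof.
move=> intf f0 cf fK.
have mf n : measurable_fun [set: T] (f_ n) by exact: integrable_measurable (intf n).
have mff : measurable_fun [set: T] f.
  by apply: (measurable_fun_cvg (h := f_)) => // w _; exact: cf.
have ff0 w : 0 <= f w.
  by apply: (ler_cvg_to (cvg_cst 0) (cf w)); apply: nearW => n; exact: f0.
apply/integrableP; split; first exact/measurable_EFinP.
apply: (@le_lt_trans _ _ K%:E); last exact: ltry.
have -> : (\int[P]_w `|(EFin \o f) w| = \int[P]_w limn_einf (fun n => (f_ n w)%:E))%E.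
  apply: eq_integral => w _; rewrite /= ger0_norm//.
  have c : (fun n => (f_ n w)%:E) @ \oo --> (f w)%:E by apply: cvg_EFin; [exact: nearW | exact: cf].
  by rewrite is_cvg_limn_einfE; [symmetry; exact: (cvg_lim _ c) | apply/cvg_ex; exists (f w)%:E].
apply: le_trans.
  apply: (@fatou _ T R P [set: T] measurableT (fun n w => (f_ n w)%:E)) => //.
    by move=> n; exact/measurable_EFinP.
  by move=> n w _; rewrite lee_fin.
have E n : (\int[P]_w (f_ n w)%:E = (\int[P]_w f_ n w)%:E)%E.
  by rewrite /Rintegral fineK//; exact: (integrable_fin_num measurableT (intf n)).
rewrite (_ : (fun n => _) = (fun n => (\int[P]_w f_ n w)%:E)%E); last by apply/funext => n; exact: E.
rewrite limn_einf_lim; apply: lime_le; first exact: is_cvg_einfs.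
apply: nearW => m; apply: (@le_trans _ _ (\int[P]_w f_ m w)%:E); last by rewrite lee_fin.
by apply: ereal_inf_lbound; exists m => /=.
Qed.

End fatou_tools.

(** * Existence of all moments and their recursion *)

Section all_moments.
Context {d : measure_display} {T : measurableType d} {R : realType}.
Variables (P : probability T R) (X : T -> R).
Hypothesis mX : measurable_fun [set: T] X.
Variables (p q : {poly R}) (rho : R).
Hypothesis rho0 : 0 < rho.
Hypothesis cf_cos : forall u : R, `|u| < rho -> cmom P X 0 u = exp_cos p q 1 0 u.
Hypothesis cf_sin : forall u : R, `|u| < rho -> smom P X 0 u = exp_sin p q 1 0 u.

(** As [u] tends to 0, [2 x^(2k) (1 - cos (u x)) / u^2] tends to [x^(2k+2)]. Its expectation is
    bounded by [cmom_quadratic], so Fatou's lemma provides the next even moment. *)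
Lemma has_moment_even k : has_moment P X (2 * k).
Proof.
elim: k => [|k IH].
  by rewrite muln0; apply: (@bounded_integrable _ _ _ _ _ 1) => [|w]; [exact: measurable_powX | rewrite expr0 normr1].
have [K [e e0 cK]] := cmom_quadratic mX rho0 cf_cos cf_sin IH.
pose u m := e / 2 / m.+1%:R : R.
have u0 m : 0 < u m by rewrite /u !divr_gt0.
have ue m : u m < e.
  rewrite /u ltr_pdivrMr ?ltr0n//; have : 1 <= m.+1%:R :> R by rewrite ler1n.
  by move=> h; apply: (@lt_le_trans _ _ e); [lra | rewrite ler_peMr// ltW].
pose f m w := 2 * (X w ^+ (2 * k) * (1 - cos (u m * X w)) / u m ^+ 2).
have intf m : P.-integrable [set: T] (EFin \o (fun w => X w ^+ (2 * k) - X w ^+ (2 * k) * cos (u m * X w))).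
  by apply: integrableB_fun => //; exact: integrable_cmom.
have fE m w : f m w = 2 / u m ^+ 2 * (X w ^+ (2 * k) - X w ^+ (2 * k) * cos (u m * X w)).
  by rewrite /f; field; rewrite gt_eqF.
have fc w : f ^~ w @ \oo --> X w ^+ (2 * k.+1).
  (* The half-angle formula turns [1 - cos] into twice a squared sine, to which this limit
     applies. *)
  have c := @cvg_msin R (e / 2 * X w / 2).
  have -> : X w ^+ (2 * k.+1) = X w ^+ (2 * k) * (4 * ((e / 2)^-1 * (e / 2 * X w / 2)) ^+ 2).
    by rewrite mulnS exprD; field; rewrite gt_eqF.
  rewrite (_ : f ^~ w = (fun m => X w ^+ (2 * k) * (4 * ((e / 2)^-1 * (m.+1%:R * sin (e / 2 * X w / 2 / m.+1%:R))) ^+ 2))); last first.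
    apply/funext => m; rewrite /f.
    have -> : u m * X w = (e / 2 * X w / 2 / m.+1%:R) *+ 2.
      by rewrite /u -mulr_natr; field; rewrite nat1r pnatr_eq0.
    rewrite cos_mulr2n cos2sin2 /u; set s := sin _.
    by rewrite -mulr_natr; field; rewrite gt_eqF//= nat1r pnatr_eq0.
  apply: cvgM; first exact: cvg_cst.
  apply: cvgM; first exact: cvg_cst.
  have c2 : (fun m => (e / 2)^-1 * (m.+1%:R * sin (e / 2 * X w / 2 / m.+1%:R))) @ \oo --> (e / 2)^-1 * (e / 2 * X w / 2).
    by apply: cvgM => //; exact: cvg_cst.
  by apply: cvgM; exact: c2.
apply: (@integrable_of_bounded_integrals _ _ _ P f _ (2 * K)) => //.
- move=> m; rewrite (_ : f m = fun w => 2 / u m ^+ 2 * (X w ^+ (2 * k) - X w ^+ (2 * k) * cos (u m * X w))).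
    exact: integrableZ_fun.
  by apply/funext => w; exact: fE.
- move=> m w; rewrite /f mulr_ge0// divr_ge0 ?sqr_ge0// mulr_ge0 ?subr_ge0 ?cos_le1//.
  by rewrite exprM exprn_ge0 ?sqr_ge0.
move=> m; under eq_Rintegral do rewrite fE.
rewrite RintegralZl// RintegralB//; last exact: integrable_cmom.
rewrite -/(cmom P X _ _) -cmom_0; have := cK _ (u0 m) (ue m); rewrite -ler_pdivrMr ?exprn_gt0//.
by move=> h; rewrite -!mulrA ler_wpM2l// mulrC.
Qed.

Lemma has_moment_all n : has_moment P X n.
Proof. by apply: has_moment_le (has_moment_even n) => //; exact: leq_pmull. Qed.

(** Real and imaginary parts of [(- i d/du)^(j+1) (p + i q)]. The value at 0 is the cumulant of
    order [j + 1]: throughout, the index is one below the order, so that [cumulant 0] is the mean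
    and [cumulant 1] the variance. *)
Fixpoint cumpoly j : {poly R} * {poly R} :=
  if j is j'.+1 then ((cumpoly j').2^`(), - (cumpoly j').1^`()) else (q^`(), - p^`()).

(** With [sjoint], the real and imaginary parts of the product of the complex [cumpoly j] and
    [E (X^m e^(i u X))]. *)
Definition cjoint j m (u : R) := (cumpoly j).1.[u] * cmom P X m u - (cumpoly j).2.[u] * smom P X m u.
Definition sjoint j m (u : R) := (cumpoly j).1.[u] * smom P X m u + (cumpoly j).2.[u] * cmom P X m u.

Lemma is_derive_cjoint j m (u : R) :
  is_derive u 1 (cjoint j m) (- (sjoint j m.+1 u + sjoint j.+1 m u)).
Proof.
apply: is_derive_val (is_derive_sub
  (is_derive_mul (is_derive_poly _ u) (is_derive_cmom mX u (has_moment_all _)))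
  (is_derive_mul (is_derive_poly _ u) (is_derive_smom mX u (has_moment_all _)))).
by rewrite /sjoint /= hornerN; ring.
Qed.

Lemma is_derive_sjoint j m (u : R) :
  is_derive u 1 (sjoint j m) (cjoint j m.+1 u + cjoint j.+1 m u).
Proof.
apply: is_derive_val (is_derive_add
  (is_derive_mul (is_derive_poly _ u) (is_derive_smom mX u (has_moment_all _)))
  (is_derive_mul (is_derive_poly _ u) (is_derive_cmom mX u (has_moment_all _)))).
by rewrite /cjoint /= hornerN; ring.
Qed.

Hypotheses (sp : (size p <= 5)%N) (sq : (size q <= 5)%N).

Lemma cumpoly4 : cumpoly 4 = (0, 0).
Proof.
have deriv0 (r : {poly R}) : (size r <= 5)%N -> r^`()^`()^`()^`()^`() = 0.
  move=> sr; apply/eqP; rewrite -size_poly_eq0 -leqn0.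
  have sd (t : {poly R}) k : (size t <= k.+1)%N -> (size t^`() <= k)%N.
    by move=> st; apply: leq_trans (size_poly _ _) _; case: (size t) st.
  by do 5 apply: (sd _ _).
by rewrite /= !derivN !opprK !deriv0// ?oppr0.
Qed.

Lemma cjoint4 m u : cjoint 4 m u = 0.
Proof. by rewrite /cjoint cumpoly4 !horner0 !mul0r subr0. Qed.

Lemma sjoint4 m u : sjoint 4 m u = 0.
Proof. by rewrite /sjoint cumpoly4 !horner0 !mul0r addr0. Qed.

(** Pascal's rule. Where [j > n] the truncated subtraction [n - j] is harmless, the binomial
    coefficient being 0. *)
Lemma leibniz_shift (F : nat -> nat -> R) n : (forall m, F 4%N m = 0) ->
  'C(n, 0)%:R * (F 0%N (n - 0).+1 + F 1%N (n - 0)%N) + 'C(n, 1)%:R * (F 1%N (n - 1).+1 + F 2%N (n - 1)%N) +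
  'C(n, 2)%:R * (F 2%N (n - 2).+1 + F 3%N (n - 2)%N) + 'C(n, 3)%:R * (F 3%N (n - 3).+1 + F 4%N (n - 3)%N) =
  'C(n.+1, 0)%:R * F 0%N (n.+1 - 0)%N + 'C(n.+1, 1)%:R * F 1%N (n.+1 - 1)%N +
  'C(n.+1, 2)%:R * F 2%N (n.+1 - 2)%N + 'C(n.+1, 3)%:R * F 3%N (n.+1 - 3)%N.
Proof.
move=> F4; have sh j : 'C(n, j)%:R * F j (n - j).+1 = 'C(n, j)%:R * F j (n.+1 - j)%N.
  have [jn|nj] := leqP j n; first by rewrite subSn.
  by rewrite bin_small// !mul0r.
rewrite !mulrDr !sh F4 mulr0 addr0 !binS !natrD !bin0 !subSS !subn0; ring.
Qed.

(** Leibniz's rule: [- i d/du] is applied [n] times to the identity between the derivative of the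
    characteristic function and its product with its logarithmic derivative. Four terms remain
    because the fifth derivatives of [p] and [q] vanish. *)
Lemma local_stein n (u : R) : `|u| < rho ->
  cmom P X n.+1 u = 'C(n, 0)%:R * cjoint 0 (n - 0) u + 'C(n, 1)%:R * cjoint 1 (n - 1) u +
    'C(n, 2)%:R * cjoint 2 (n - 2) u + 'C(n, 3)%:R * cjoint 3 (n - 3) u /\
  smom P X n.+1 u = 'C(n, 0)%:R * sjoint 0 (n - 0) u + 'C(n, 1)%:R * sjoint 1 (n - 1) u +
    'C(n, 2)%:R * sjoint 2 (n - 2) u + 'C(n, 3)%:R * sjoint 3 (n - 3) u.
Proof.
elim: n u => [|n IH] u hu.
  rewrite bin0 !bin0n /= !mul0r !addr0 !mul1r /cjoint /sjoint /= hornerN.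
  have near0 := near_ball hu.
  split.
    rewrite cf_cos// cf_sin//; apply: etrans.
      apply: (@is_derive_unique _ (smom P X 0) (exp_sin p q 1 0) u _ _ _ (is_derive_smom mX u (has_moment_all 1)) (is_derive_exp_sin _ _ _ _ _)).
      by apply: filterS near0 => x; exact: cf_sin.
    by rewrite /exp_cos /exp_sin /nextA /nextB deriv0 -polyC1 derivC !hornerE /=; ring.
  rewrite cf_cos// cf_sin//; apply: oppr_inj; apply: etrans.
    apply: (@is_derive_unique _ (cmom P X 0) (exp_cos p q 1 0) u _ _ _ (is_derive_cmom mX u (has_moment_all 1)) (is_derive_exp_cos _ _ _ _ _)).
    by apply: filterS near0 => x; exact: cf_cos.
  by rewrite /exp_cos /exp_sin /nextA /nextB deriv0 -polyC1 derivC !hornerE /=; ring.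
have ds j := is_derive_scale 'C(n, j)%:R (is_derive_sjoint j (n - j) u).
have dc j := is_derive_scale 'C(n, j)%:R (is_derive_cjoint j (n - j) u).
split.
  rewrite -(leibniz_shift (F := fun j m => cjoint j m u)); last by move=> m; exact: cjoint4.
  apply: is_derive_unique (is_derive_smom mX u (has_moment_all n.+2))
    (is_derive_add (is_derive_add (is_derive_add (ds 0%N) (ds 1%N)) (ds 2%N)) (ds 3%N)).
  by apply: filterS (near_ball hu) => x /IH[].
rewrite -(leibniz_shift (F := fun j m => sjoint j m u)); last by move=> m; exact: sjoint4.
apply: oppr_inj; apply: etrans.
  apply: is_derive_unique (is_derive_cmom mX u (has_moment_all n.+2))
    (is_derive_add (is_derive_add (is_derive_add (dc 0%N) (dc 1%N)) (dc 2%N)) (dc 3%N)).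
  by apply: filterS (near_ball hu) => x /IH[].
ring.
Qed.

Definition cumulant j := (cumpoly j).1.[0].

Lemma moment_recursion n : cmom P X n.+1 0 =
  'C(n, 0)%:R * (cumulant 0 * cmom P X (n - 0) 0) + 'C(n, 1)%:R * (cumulant 1 * cmom P X (n - 1) 0) +
  'C(n, 2)%:R * (cumulant 2 * cmom P X (n - 2) 0) + 'C(n, 3)%:R * (cumulant 3 * cmom P X (n - 3) 0).
Proof.
have [|-> _] := @local_stein n 0; first by rewrite normr0.
by rewrite /cjoint !smom_0 !mulr0 !subr0.
Qed.

End all_moments.

(** * Growth of the moments *)

Section finitely_many_cumulants.
Context {d : measure_display} {T : measurableType d} {R : realType}.
Variables (P : probability T R) (X : T -> R).
Hypothesis mX : measurable_fun [set: T] X.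
Hypothesis hm : forall n, has_moment P X n.
Variable kap : nat -> R.
Let M n := \int[P]_w X w ^+ n.
Hypothesis momentS : forall n, M n.+1 = \sum_(j < 4) 'C(n, j)%:R * (kap j * M (n - j)).

Definition nmom n := `|M n| / n`!%:R.

Lemma nmom_ge0 n : 0 <= nmom n.
Proof. by rewrite divr_ge0. Qed.

Lemma bin_fact_div n j : (j <= n)%N -> 'C(n, j)%:R / n`!%:R = (j`!%:R * (n - j)`!%:R)^-1 :> R.
Proof.
move=> jn; have f0 m : m`!%:R != 0 :> R by rewrite pnatr_eq0 -lt0n fact_gt0.
rewrite -(bin_fact jn) !natrM; have C0 : 'C(n, j)%:R != 0 :> R by rewrite pnatr_eq0 -lt0n bin_gt0.
by field; rewrite !f0 C0.
Qed.

Definition kapmax := \sum_(j < 4) `|kap j|.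

Lemma kapmax_ge (j : 'I_4) : `|kap j| <= kapmax.
Proof. by rewrite /kapmax (bigD1 j)//= lerDl sumr_ge0. Qed.

(** ['C(n, j) / n!] is at most [1 / (n - j)!], and passing from [n!] to [n.+1!] leaves the gain
    [1 / n.+1]. *)
Lemma nmomS n : nmom n.+1 <= kapmax / n.+1%:R * \sum_(j < 4 | (j <= n)%N) nmom (n - j).
Proof.
have f0 m : 0 < m`!%:R :> R by rewrite ltr0n fact_gt0.
rewrite /nmom momentS factS natrM invfM mulrA mulrAC.
have n1 : 0 < n.+1%:R :> R by rewrite ltr0n.
rewrite [leRHS]mulrAC ler_pM2r ?invr_gt0//.
rewrite (bigID (fun j : 'I_4 => (j <= n)%N))/= [X in `|_ + X|]big1 ?addr0; last first.
  by move=> j; rewrite -ltnNge => nj; rewrite bin_small// mul0r.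
apply: (@le_trans _ _ ((\sum_(j < 4 | (j <= n)%N) 'C(n, j)%:R * (kapmax * `|M (n - j)|)) / n`!%:R)).
  rewrite ler_pM2r ?invr_gt0//; apply: le_trans (ler_norm_sum _ _ _) _.
  apply: ler_sum => j _; rewrite !normrM ger0_norm// ler_wpM2l// ler_wpM2r//.
  exact: kapmax_ge.
rewrite mulr_suml mulr_sumr; apply: ler_sum => j jn.
rewrite mulrAC bin_fact_div// invfM mulrCA; apply: ler_wpM2l.
  by rewrite sumr_ge0.
rewrite mulrC ler_wpM2l// ler_piMl ?invr_ge0//.
by rewrite invf_le1// ler1n fact_gt0.
Qed.

(** From rank [N] on, the factor [1 / n.+1] outweighs [4 * kapmax / r ^+ 4], the cost of bounding
    four terms by the worst power [r ^+ (n - 3)]; the earlier ranks are absorbed into [C]. *)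
Lemma nmom_growth (r : R) : 0 < r -> r <= 1 -> exists2 C : R, 0 <= C & forall n, nmom n <= C * r ^+ n.
Proof.
move=> r0 r1; have K0 : 0 <= kapmax by rewrite sumr_ge0.
have r40 : 0 < r ^+ 4 by rewrite exprn_gt0.
pose N := Num.truncn (4 * kapmax / r ^+ 4).
have hN n : (N <= n)%N -> 4 * kapmax <= r ^+ 4 * n.+1%:R.
  move=> Nn; have k0 : 0 <= 4 * kapmax / r ^+ 4 by rewrite divr_ge0 ?mulr_ge0// ltW.
  have /andP[_] := truncn_itv k0; rewrite ltr_pdivrMr// -/N => h.
  apply: le_trans (ltW h) _; rewrite [leRHS]mulrC; apply: ler_wpM2r; first exact: ltW.
  by rewrite ler_nat ltnS.
pose C := \sum_(i < N.+1) nmom i / r ^+ i.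
have C0 : 0 <= C by apply: sumr_ge0 => i _; rewrite divr_ge0 ?nmom_ge0 ?exprn_ge0// ltW.
exists C => //; elim/ltn_ind => n IH.
have [nN|Nn] := leqP n N.
  have nN' : (n < N.+1)%N by [].
  rewrite -ler_pdivrMr ?exprn_gt0// /C (bigD1 (Ordinal nN'))//= lerDl.
  by apply: sumr_ge0 => i _; rewrite divr_ge0 ?nmom_ge0 ?exprn_ge0// ltW.
case: n Nn IH => // n Nn IH; apply: le_trans (nmomS n) _.
have n1 : 0 < n.+1%:R :> R by rewrite ltr0n.
have step : \sum_(j < 4 | (j <= n)%N) nmom (n - j) <= 4 * (C * r ^+ n / r ^+ 3).
  apply: (@le_trans _ _ (\sum_(j < 4 | (j <= n)%N) C * r ^+ n / r ^+ 3)).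
    apply: ler_sum => j jn; apply: le_trans (IH (n - j)%N _) _; first by rewrite ltnS leq_subr.
    rewrite -mulrA ler_wpM2l// ler_pdivlMr ?exprn_gt0//.
    rewrite -{2}(subnK jn) exprD; apply: ler_wpM2l; first by rewrite exprn_ge0// ltW.
    by apply: ler_wiXn2l => //; [exact: ltW | rewrite -ltnS].
  apply: (@le_trans _ _ (\sum_(j < 4) C * r ^+ n / r ^+ 3)).
    rewrite [leRHS](bigID (fun j : 'I_4 => (j <= n)%N))/= lerDl sumr_ge0// => j _.
    by rewrite !mulr_ge0 ?invr_ge0 ?exprn_ge0// ltW.
  by rewrite sumr_const card_ord -[leLHS]mulr_natl.
apply: (@le_trans _ _ (kapmax / n.+1%:R * (4 * (C * r ^+ n / r ^+ 3)))).
  by rewrite ler_wpM2l// divr_ge0// ltW.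
have -> : kapmax / n.+1%:R * (4 * (C * r ^+ n / r ^+ 3)) = (4 * kapmax) * (C * r ^+ n / r ^+ 3 / n.+1%:R).
  by move: n.+1%:R (lt0r_neq0 n1) => z z0; field; rewrite ?z0 ?(lt0r_neq0 r0).
have -> : C * r ^+ n.+1 = (r ^+ 4 * n.+1%:R) * (C * r ^+ n / r ^+ 3 / n.+1%:R).
  by rewrite exprSr; move: n.+1%:R (lt0r_neq0 n1) => z z0; field; rewrite ?z0 ?(lt0r_neq0 r0).
apply: ler_wpM2r; last exact: hN.
by rewrite !mulr_ge0 ?invr_ge0 ?exprn_ge0// ltW.
Qed.

Lemma abs_expR_series (x : R) N : \sum_(n < N) `|x| ^+ n / n`!%:R <= expR `|x|.
Proof.
rewrite -(big_mkord xpredT (fun n => `|x| ^+ n / n`!%:R)).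
have nd : nondecreasing_seq (series (@exp_coeff R `|x|)).
  apply/nondecreasing_seqP => n; rewrite seriesSr lerDl; apply: divr_ge0 => //; exact: exprn_ge0.
have c : cvgn (series (@exp_coeff R `|x|)) by exact: is_cvg_series_exp_coeff.
exact: (nondecreasing_cvgn_le nd c N).
Qed.

Lemma integrable_sum (N : nat) (a : nat -> R) (m : nat -> nat) :
  P.-integrable [set: T] (EFin \o (fun w => \sum_(n < N) a n * X w ^+ m n)) /\
  \int[P]_w (\sum_(n < N) a n * X w ^+ m n) = \sum_(n < N) a n * M (m n).
Proof.
elim: N => [|N [IH1 IH2]].
  rewrite (_ : (fun w => _) = fun=> 0); last by apply/funext => w; rewrite big_ord0.
  by split; [exact: cst_integrable | rewrite Rintegral1 big_ord0].
rewrite (_ : (fun w => \sum_(n < N.+1) _) =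
   fun w => \sum_(n < N) a n * X w ^+ m n + a N * X w ^+ m N); last first.
  by apply/funext => w; rewrite big_ord_recr.
have i2 : P.-integrable [set: T] (EFin \o (fun w => a N * X w ^+ m N)).
  exact: (integrableZ_fun (a N) (hm (m N))).
split; first exact: integrableD_fun.
rewrite RintegralD// IH2 RintegralZl//; last exact: hm.
by rewrite big_ord_recr.
Qed.

(* [expR r|x| <= 2 cosh (r x)], and cosh has only even powers, whose
   expectations are moments without absolute values. *)
Lemma integrable_exp_abs (r : R) : 0 <= r ->
  P.-integrable [set: T] (EFin \o (fun w => expR (r * `|X w|))).
Proof.
(* This makes [r * s <= 1 / 2], so the expected partial sums of [cosh (r X)] are below [C] times a
   geometric series of sum 2. *)
move=> r0; pose s := (2 * (1 + r))^-1.
have s0 : 0 < s by rewrite invr_gt0 mulr_gt0// ltr_pwDl.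
have s1 : s <= 1 by rewrite invf_le1 ?mulr_gt0 ?ltr_pwDl//; lra.
have [C C0 hC] := nmom_growth s0 s1.
pose f N w := \sum_(n < N) (~~ odd n)%:R * r ^+ n / n`!%:R * X w ^+ n.
have fint N := integrable_sum N (fun n => (~~ odd n)%:R * r ^+ n / n`!%:R) id.
have coef n : 0 <= (~~ odd n)%:R * r ^+ n / n`!%:R :> R by rewrite !mulr_ge0 ?exprn_ge0 ?invr_ge0.
pose g w := (expR (r * X w) + expR (- (r * X w))) / 2.
have fg w : f ^~ w @ \oo --> g w.
  have e x : series (@exp_coeff R x) @ \oo --> expR x.
    by have := is_cvg_series_exp_coeff x.
  rewrite (_ : f ^~ w = fun N => (series (@exp_coeff R (r * X w)) N + series (@exp_coeff R (- (r * X w))) N) / 2); last first.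
    apply/funext => N; rewrite /series /= !big_mkord -big_split/= mulr_suml.
    apply: eq_bigr => n _; rewrite /exp_coeff /= exprNn exprMn -signr_odd.
    by case: (odd n); rewrite /= ?expr0 ?expr1; field; rewrite pnatr_eq0 -lt0n fact_gt0.
  by apply: cvgM; [apply: cvgD; exact: e | exact: cvg_cst].
have gint : P.-integrable [set: T] (EFin \o g).
  apply: (@integrable_of_bounded_integrals _ _ _ P f g (C * 2)).
  - by move=> N; exact: (fint N).1.
  - move=> N w; apply: sumr_ge0 => n _; have := coef n.
    case on : (odd n); rewrite /= ?mul0r// => h; rewrite mulr_ge0//.
    by rewrite exprn_even_ge0// on.
  - exact: fg.
  move=> N; rewrite (fint N).2; apply: (@le_trans _ _ (\sum_(n < N) C * (2^-1) ^+ n)).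
    apply: ler_sum => n _; apply: (@le_trans _ _ (r ^+ n * nmom n)).
      have -> : (~~ odd n)%:R * r ^+ n / n`!%:R * M n = r ^+ n * ((~~ odd n)%:R * M n / n`!%:R) by ring.
      rewrite ler_wpM2l ?exprn_ge0// /nmom; apply: ler_wpM2r; first by rewrite invr_ge0.
      by case: (odd n); rewrite /= ?mul0r ?mul1r ?ler_norm.
    apply: (@le_trans _ _ (r ^+ n * (C * s ^+ n))); first by rewrite ler_wpM2l ?exprn_ge0.
    rewrite mulrCA -exprMn ler_wpM2l//; apply: lerXn2r; rewrite ?nnegrE ?invr_ge0//.
      by rewrite mulr_ge0// ltW.
    have r2 : 0 < 2 * (1 + r) by rewrite mulr_gt0// ltr_pwDl.
    by rewrite /s ler_pdivrMr// mulrA mulVf// mul1r lerDr.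
  rewrite -mulr_sumr ler_wpM2l//.
  suff -> : \sum_(n < N) (2^-1) ^+ n = 2 - 2 * (2^-1) ^+ N :> R.
    by rewrite gerBl mulr_ge0// exprn_ge0// invr_ge0.
  elim: N => [|N IH]; first by rewrite big_ord0 expr0; ring.
  by rewrite big_ord_recr /= IH exprS; field.
apply: (le_integrable_fun (g := fun w => 2 * g w)).
- apply: (@measurableT_comp _ _ _ _ _ _ (@expR R)); first by exact: measurable_expR.
  by apply: measurable_funM => //; exact: measurableT_comp.
- move=> w; rewrite ger0_norm ?expR_ge0//.
  have -> : 2 * g w = expR (r * X w) + expR (- (r * X w)) by rewrite /g; field.
  have [x0|/ltW x0] := leP 0 (X w); first by rewrite (ger0_norm x0) lerDl expR_ge0.
  by rewrite (ler0_norm x0) mulrN lerDr expR_ge0.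
- exact: integrableZ_fun.
Qed.

End finitely_many_cumulants.

(** * Stein's identity and the moment generating function *)

Lemma is_derive_unique_ext {R : realType} (f g : R -> R) (u df dg : R) : f =1 g ->
  is_derive u 1 f df -> is_derive u 1 g dg -> df = dg.
Proof.
move=> fg hf hg; have hg' := is_derive_ext fg hf.
by rewrite -(@derive_val _ _ _ _ _ _ _ hg) (@derive_val _ _ _ _ _ _ _ hg').
Qed.

Section exponential_generating.
Context {R : realType}.
Implicit Types (a : nat -> R) (x u t : R).

(** Partial sums of an exponential generating function. Shifting the coefficients differentiates the
    limit, so derivatives are handled through coefficients. *)
Definition egf a x N := \sum_(n < N) a n / n`!%:R * x ^+ n.

Lemma egf_le a (K r : R) x N : 0 <= r -> (forall n, `|a n| <= K * r ^+ n) ->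
  `|egf a x N| <= K * expR (r * `|x|).
Proof.
move=> r0 ar; apply: le_trans (ler_norm_sum _ _ _) _.
have K0 : 0 <= K by have := ar 0%N; rewrite expr0 mulr1; exact: le_trans.
apply: (@le_trans _ _ (K * \sum_(n < N) `|r * x| ^+ n / n`!%:R)).
  rewrite mulr_sumr; apply: ler_sum => n _.
  rewrite !normrM normfV normr_nat normrX (ger0_norm r0).
  have -> : K * ((r * `|x|) ^+ n / n`!%:R) = K * r ^+ n / n`!%:R * `|x| ^+ n by rewrite exprMn; ring.
  by rewrite ler_wpM2r ?exprn_ge0// ler_wpM2r ?invr_ge0.
rewrite ler_wpM2l//; have -> : r * `|x| = `|r * x| by rewrite normrM ger0_norm.
exact: abs_expR_series.
Qed.

Lemma egf_scale a (c : R) x N : egf (fun n => c * a n) x N = c * egf a x N.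
Proof. by rewrite /egf mulr_sumr; apply: eq_bigr => n _; rewrite !mulrA. Qed.

Lemma egf_cvg_scale a (c : R) x (l : R) : egf a x @ \oo --> l -> egf (fun n => c * a n) x @ \oo --> c * l.
Proof.
move=> h; rewrite (_ : egf _ x = fun N => c * egf a x N).
  by apply: cvgM => //; exact: cvg_cst.
by apply/funext => N; exact: egf_scale.
Qed.

Lemma egf_expR t x : egf (fun n => t ^+ n) x @ \oo --> expR (t * x).
Proof.
have c : series (@exp_coeff R (t * x)) @ \oo --> expR (t * x) by have := @is_cvg_series_exp_coeff R (t * x).
rewrite (_ : egf _ x = series (@exp_coeff R (t * x)))//.
apply/funext => N; rewrite /egf /series /= big_mkord; apply: eq_bigr => n _.
by rewrite /exp_coeff /= exprMn mulrAC.
Qed.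

Definition cos_egf u n : R := (~~ odd n)%:R * (-1) ^+ n./2 * u ^+ n.
Definition sin_egf u n : R := (odd n)%:R * (-1) ^+ n.-1./2 * u ^+ n.

Lemma egf_cos u x : egf (cos_egf u) x @ \oo --> cos (u * x).
Proof.
have c : series (@cos_coeff R (u * x)) @ \oo --> cos (u * x).
  by rewrite unlock; exact: (@is_cvg_series_cos_coeff R (u * x)).
rewrite (_ : egf _ x = series (@cos_coeff R (u * x)))//.
apply/funext => N; rewrite /egf /series /= big_mkord; apply: eq_bigr => n _.
by rewrite /cos_coeff /cos_egf /= exprMn -?exprnP; ring.
Qed.

Lemma egf_sin u x : egf (sin_egf u) x @ \oo --> sin (u * x).
Proof.
have c : series (@sin_coeff R (u * x)) @ \oo --> sin (u * x).
  by rewrite unlock; exact: (@is_cvg_series_sin_coeff R (u * x)).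
rewrite (_ : egf _ x = series (@sin_coeff R (u * x)))//.
apply/funext => N; rewrite /egf /series /= big_mkord; apply: eq_bigr => n _.
by rewrite /sin_coeff /sin_egf /= exprMn; ring.
Qed.

Lemma cos_egfS u n : cos_egf u n.+1 = - u * sin_egf u n.
Proof.
rewrite /cos_egf /sin_egf /= negbK; case on : (odd n); last by rewrite !mul0r mulr0.
have -> : uphalf n = (n.-1./2).+1 by case: n on.
by rewrite !exprS; ring.
Qed.

Lemma sin_egfS u n : sin_egf u n.+1 = u * cos_egf u n.
Proof. by rewrite /cos_egf /sin_egf /= exprS; ring. Qed.

Lemma cos_egf_le u n : `|cos_egf u n| <= `|u| ^+ n.
Proof.
rewrite /cos_egf !normrM !normrX normrN1 expr1n mulr1 normr_nat.
by rewrite ler_piMl ?exprn_ge0//; case: (odd n).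
Qed.

Lemma sin_egf_le u n : `|sin_egf u n| <= `|u| ^+ n.
Proof.
rewrite /sin_egf !normrM !normrX normrN1 expr1n mulr1 normr_nat.
by rewrite ler_piMl ?exprn_ge0//; case: (odd n).
Qed.

End exponential_generating.

Section exponential_moments.
Context {d : measure_display} {T : measurableType d} {R : realType}.
Variables (P : probability T R) (X : T -> R).
Hypothesis mX : measurable_fun [set: T] X.
Hypothesis hexp : forall r : R, 0 <= r -> P.-integrable [set: T] (EFin \o (fun w => expR (r * `|X w|))).

Lemma measurable_expX (t : R) : measurable_fun [set: T] (fun w => expR (t * X w)).
Proof.
by apply: (@measurableT_comp _ _ _ _ _ _ (@expR R)); [exact: measurable_expR | exact: measurable_funM].
Qed.

Lemma integrable_pow_exp n (r : R) : 0 <= r ->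
  P.-integrable [set: T] (EFin \o (fun w => `|X w| ^+ n * expR (r * `|X w|))).
Proof.
move=> r0; apply: (le_integrable_fun (g := fun w => n`!%:R * expR ((1 + r) * `|X w|))).
- apply: measurable_funM; first by apply: measurable_funX; exact: measurableT_comp.
  apply: (@measurableT_comp _ _ _ _ _ _ (@expR R)); first by exact: measurable_expR.
  by apply: measurable_funM => //; exact: measurableT_comp.
- move=> w; rewrite ger0_norm ?mulr_ge0 ?exprn_ge0 ?expR_ge0//.
  rewrite mulrDl mul1r expRD mulrA ler_wpM2r ?expR_ge0//.
  have := abs_expR_series (X w) n.+1; rewrite big_ord_recr /= => h.
  rewrite mulrC -ler_pdivrMr ?ltr0n ?fact_gt0//; apply: le_trans h.
  by rewrite lerDr sumr_ge0// => i _; rewrite divr_ge0// exprn_ge0.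
- by apply: integrableZ_fun; apply: hexp; rewrite addr_ge0.
Qed.

Lemma all_moments_of_exp n : has_moment P X n.
Proof.
apply: (le_integrable_fun _ _ (integrable_pow_exp n (lexx 0))); first exact: measurable_powX.
by move=> w; rewrite mul0r expR0 mulr1 normrX.
Qed.

Definition mexp n (t : R) := \int[P]_w (X w ^+ n * expR (t * X w)).

Lemma exp_le_abs (t r : R) w : `|t| <= r -> expR (t * X w) <= expR (r * `|X w|).
Proof.
move=> tr; rewrite ler_expR; apply: le_trans (ler_norm _) _.
by rewrite normrM ler_wpM2r.
Qed.

Lemma integrable_mexp n (t : R) :
  P.-integrable [set: T] (EFin \o (fun w => X w ^+ n * expR (t * X w))).
Proof.
apply: (le_integrable_fun _ _ (integrable_pow_exp n (normr_ge0 t))).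
  by apply: measurable_funM; [exact: measurable_powX | exact: measurable_expX].
move=> w; rewrite normrM normrX (ger0_norm (expR_ge0 _)) ler_wpM2l ?exprn_ge0//.
exact: exp_le_abs.
Qed.

Lemma is_derive_mexp n (t : R) : is_derive t 1 (mexp n) (mexp n.+1 t).
Proof.
apply: (@is_derive_Rintegral _ _ _ P _ (fun v w => X w ^+ n.+1 * expR (v * X w))
  (fun w => `|X w| ^+ n.+1 * expR ((`|t| + 1) * `|X w|)) t (t - 1) (t + 1)); [lra | lra | | | | ].
- by move=> v; exact: integrable_mexp.
- move=> v w; apply: is_derive_val (is_derive_scale (X w ^+ n) (is_derive1_comp (is_derive_expR _) (is_derive_mulr (X w) v))).
  by rewrite /GRing.scale /= exprSr; ring.
- move=> v w v1 v2; rewrite normrM normrX (ger0_norm (expR_ge0 _)) ler_wpM2l ?exprn_ge0//.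
  apply: exp_le_abs; rewrite -(subrK t v) addrC; apply: le_trans (ler_normD _ _) _.
  by rewrite lerD2l ler_norml; apply/andP; split; lra.
- by apply: integrable_pow_exp; rewrite addr_ge0.
Qed.

(** Jensen's inequality: the exponential lies above its tangent at [t * m], whose expectation is
    [expR (t * m)]. *)
Lemma mexp0_gt0 (t : R) : 0 < mexp 0 t.
Proof.
pose m := \int[P]_w X w; have hX : P.-integrable [set: T] (EFin \o X).
  by have := all_moments_of_exp 1; apply: eq_integrable.
have i2 : P.-integrable [set: T] (EFin \o (fun w => (1 - t * m) + t * X w)).
  by apply: integrableD_fun; [exact: cst_integrable | exact: integrableZ_fun].
apply: (@lt_le_trans _ _ (expR (t * m))); first exact: expR_gt0.
have <- : \int[P]_w (expR (t * m) * ((1 - t * m) + t * X w)) = expR (t * m).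
  rewrite RintegralZl// RintegralD ?Rintegral1//; [| exact: cst_integrable | exact: integrableZ_fun].
  by rewrite RintegralZl// -/m subrK mulr1.
apply: Rintegral_ler; [exact: integrableZ_fun | exact: integrable_mexp | move=> w].
have -> : X w ^+ 0 * expR (t * X w) = expR (t * m) * expR (t * X w - t * m).
  by rewrite expr0 mul1r -expRD; congr expR; ring.
rewrite ler_wpM2l ?expR_ge0//; apply: le_trans (expR_ge1Dx _).
by rewrite addrAC -addrA.
Qed.

Lemma egf_limit (a : nat -> R) (g : R -> R) (K r : R) k : 0 <= r -> (forall n, `|a n| <= K * r ^+ n) ->
  (forall x : R, egf a x @ \oo --> g x) ->
  (fun N => \sum_(n < N) a n / n`!%:R * \int[P]_w X w ^+ (n + k)) @ \oo --> \int[P]_w (X w ^+ k * g (X w)).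
Proof.
move=> r0 ar ag.
have E N : \int[P]_w (X w ^+ k * egf a (X w) N) = \sum_(n < N) a n / n`!%:R * \int[P]_w X w ^+ (n + k).
  rewrite -(integrable_sum all_moments_of_exp N (fun n => a n / n`!%:R) (fun n => n + k)%N).2.
  apply: eq_Rintegral => w _; rewrite /egf mulr_sumr; apply: eq_bigr => n _.
  by rewrite exprD; ring.
under eq_fun do rewrite -E.
have [] // := @Rintegral_dominated _ _ _ P (fun N w => X w ^+ k * egf a (X w) N) (fun w => X w ^+ k * g (X w))
  (fun w => K * (`|X w| ^+ k * expR (r * `|X w|))).
- move=> N; apply: measurable_funM; first exact: measurable_powX.
  apply: measurable_sum => n; apply: measurable_funM => //; exact: measurable_powX.
- by apply: integrableZ_fun; exact: integrable_pow_exp.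
- by move=> w; apply: cvgM; [exact: cvg_cst | exact: ag].
- move=> N w; rewrite normrM normrX mulrCA ler_wpM2l ?exprn_ge0//.
  exact: egf_le.
Qed.

Lemma cvg_ord_sum k (f : 'I_k -> nat -> R) (l : 'I_k -> R) : (forall j, f j @ \oo --> l j) ->
  (fun n => \sum_j f j n) @ \oo --> \sum_j l j.
Proof.
move=> fl; elim: (index_enum _) => [|j s IH].
  by under eq_fun do rewrite big_nil; rewrite big_nil; exact: cvg_cst.
by under eq_fun do rewrite big_cons; rewrite big_cons; apply: cvgD.
Qed.

(** * Stein's identity and its consequences for the cumulants *)

Section stein.
Variable kap : nat -> R.
Let M n := \int[P]_w X w ^+ n.
Hypothesis momentS : forall n, M n.+1 = \sum_(j < 4) 'C(n, j)%:R * (kap j * M (n - j)).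

(** Reindexing by [n + j]; the first [j] terms have a zero binomial coefficient. *)
Lemma egf_shift (a : nat -> R) j N :
  \sum_(n < N + j) a n / n`!%:R * ('C(n, j)%:R * M (n - j)) =
  (j`!%:R)^-1 * \sum_(n < N) a (n + j)%N / n`!%:R * M (n + 0).
Proof.
elim: N => [|N IH].
  rewrite big_ord0 mulr0 big1// => n _.
  by rewrite bin_small ?mul0r ?mulr0//; case: n.
rewrite addSn big_ord_recr IH big_ord_recr /= mulrDr addn0; congr (_ + _).
have jn : (j <= N + j)%N by rewrite leq_addl.
transitivity (a (N + j)%N * ('C(N + j, j)%:R / (N + j)`!%:R) * M (N + j - j)); first by ring.
by rewrite bin_fact_div// addnK invfM; ring.
Qed.

(** The moment recursion summed against [a n / n!]. Since shifted coefficients generate derivatives,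
    [g j] is the [j]-th derivative of [g 0]. *)
Lemma stein_identity (a : nat -> R) (g : nat -> R -> R) (r : R) : 0 <= r -> (forall n, `|a n| <= r ^+ n) ->
  (forall (j : 'I_4) (x : R), egf (fun n => a (n + j)%N) x @ \oo --> g j x) ->
  \int[P]_w (X w ^+ 1 * g 0%N (X w)) = \sum_(j < 4) kap j / j`!%:R * \int[P]_w (X w ^+ 0 * g j (X w)).
Proof.
move=> r0 ar ag.
have c0 : (fun N => \sum_(n < N) a n / n`!%:R * M (n + 1)) @ \oo --> \int[P]_w (X w ^+ 1 * g 0%N (X w)).
  apply: (egf_limit (K := 1) (r := r)) => // [n|x]; first by rewrite mul1r.
  have := ag ord0 x; rewrite (_ : (fun n => a (n + ord0)%N) = a)//.
  by apply/funext => n; rewrite addn0.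
have cj (j : 'I_4) : (fun N => \sum_(n < N) a (n + j)%N / n`!%:R * M (n + 0)) @ \oo --> \int[P]_w (X w ^+ 0 * g j (X w)).
  apply: (@egf_limit (fun n => a (n + j)%N) (g j) (r ^+ j) r 0) => // n.
  by rewrite -exprD addnC.
(* A sum truncated at [N + 4] becomes one truncated at [N + (4 - j)] after the shift by [j]; with
   these bounds the two sides agree exactly for each [N]. *)
have c4 : (fun N => \sum_(j < 4) kap j / j`!%:R * (\sum_(n < N + (4 - j)) a (n + j)%N / n`!%:R * M (n + 0))) @ \oo -->
    \sum_(j < 4) kap j / j`!%:R * \int[P]_w (X w ^+ 0 * g j (X w)).
  apply: cvg_ord_sum => j; apply: cvgM; first exact: cvg_cst.
  by have := cj j; rewrite -(cvg_shiftn (4 - j)).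
rewrite -(cvg_shiftn 4) in c0.
have E N : \sum_(n < N + 4) a n / n`!%:R * M (n + 1) =
    \sum_(j < 4) kap j / j`!%:R * (\sum_(n < N + (4 - j)) a (n + j)%N / n`!%:R * M (n + 0)).
  transitivity (\sum_(j < 4) kap j * \sum_(n < N + 4) a n / n`!%:R * ('C(n, j)%:R * M (n - j))).
    under [RHS]eq_bigr do rewrite mulr_sumr.
    rewrite exchange_big /=; apply: eq_bigr => n _; rewrite addn1 momentS mulr_sumr.
    by apply: eq_bigr => j _; ring.
  apply: eq_bigr => j _; have j4 : (j <= 4)%N by apply: ltnW.
  have NE : (N + 4 = N + (4 - j) + j)%N by rewrite -addnA subnK.
  by rewrite NE egf_shift mulrA.
rewrite (_ : (fun N => _) = (fun N => \sum_(n < N + 4) a n / n`!%:R * M (n + 1))) in c4; last first.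
  by apply/funext => N; rewrite E.
exact: (cvg_unique _ c0 c4).
Qed.

(** The derivative of the cumulant generating function [ln (mexp 0 t)]. *)
Definition mgf_rate (t : R) := kap 0 + kap 1 * t + kap 2 / 2 * t ^+ 2 + kap 3 / 6 * t ^+ 3.

Lemma stein_exp t : mexp 1 t = mgf_rate t * mexp 0 t.
Proof.
have ig j : \int[P]_w (X w ^+ 0 * (t ^+ j * expR (t * X w))) = t ^+ j * mexp 0 t.
  rewrite -RintegralZl//; last exact: integrable_mexp.
  by apply: eq_Rintegral => w _; ring.
rewrite /mexp; transitivity (\int[P]_w (X w ^+ 1 * (t ^+ 0 * expR (t * X w)))).
  by apply: eq_Rintegral => w _; rewrite expr0 mul1r.
rewrite (@stein_identity (fun n => t ^+ n) (fun j x => t ^+ j * expR (t * x)) `|t|)//.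
- rewrite !big_ord_recl big_ord0 /= !ig /mgf_rate /bump /=.
  by rewrite -/(mexp 0 t) !factS fact0 ?addn0; field.
- by move=> n; rewrite normrX.
move=> j x; rewrite (_ : (fun n => _) = (fun n => t ^+ j * t ^+ n)).
  by apply: egf_cvg_scale; exact: egf_expR.
by apply/funext => n; rewrite exprD mulrC.
Qed.

Lemma stein_cos u : cmom P X 1 u =
  (kap 0 - kap 2 / 2 * u ^+ 2) * cmom P X 0 u - (kap 1 * u - kap 3 / 6 * u ^+ 3) * smom P X 0 u.
Proof.
have ic (c : R) : \int[P]_w (X w ^+ 0 * (c * cos (u * X w))) = c * cmom P X 0 u.
  rewrite -RintegralZl//; last by apply: integrable_cmom => //; exact: all_moments_of_exp.
  by apply: eq_Rintegral => w _; ring.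
have is_ (c : R) : \int[P]_w (X w ^+ 0 * (c * sin (u * X w))) = c * smom P X 0 u.
  rewrite -RintegralZl//; last by apply: integrable_smom => //; exact: all_moments_of_exp.
  by apply: eq_Rintegral => w _; ring.
pose g j := nth (fun=> 0) [:: fun x => 1 * cos (u * x); fun x => - u * sin (u * x);
  fun x => - u ^+ 2 * cos (u * x); fun x => u ^+ 3 * sin (u * x)] j.
transitivity (\int[P]_w (X w ^+ 1 * g 0%N (X w))).
  by apply: eq_Rintegral => w _; rewrite /g /= mul1r.
rewrite (@stein_identity (cos_egf u) g `|u|)//.
- rewrite !big_ord_recl big_ord0 /= !ic !is_ /bump /=.
  by rewrite !factS fact0; field.
- exact: cos_egf_le.
move=> [[|[|[|[|//]]]] /= _] x.
- rewrite /g /= mul1r (_ : (fun n => _) = cos_egf u); first exact: egf_cos.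
  by apply/funext => n; rewrite addn0.
- rewrite (_ : (fun n => _) = (fun n => - u * sin_egf u n)); first by apply: egf_cvg_scale; exact: egf_sin.
  by apply/funext => n; rewrite addn1 cos_egfS.
- rewrite (_ : (fun n => _) = (fun n => - u ^+ 2 * cos_egf u n)); first by apply: egf_cvg_scale; exact: egf_cos.
  by apply/funext => n; rewrite addn2 cos_egfS sin_egfS; ring.
- rewrite (_ : (fun n => _) = (fun n => u ^+ 3 * sin_egf u n)); first by apply: egf_cvg_scale; exact: egf_sin.
  by apply/funext => n; rewrite addn3 cos_egfS sin_egfS cos_egfS; ring.
Qed.

Lemma stein_sin u : smom P X 1 u =
  (kap 0 - kap 2 / 2 * u ^+ 2) * smom P X 0 u + (kap 1 * u - kap 3 / 6 * u ^+ 3) * cmom P X 0 u.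
Proof.
have ic (c : R) : \int[P]_w (X w ^+ 0 * (c * cos (u * X w))) = c * cmom P X 0 u.
  rewrite -RintegralZl//; last by apply: integrable_cmom => //; exact: all_moments_of_exp.
  by apply: eq_Rintegral => w _; ring.
have is_ (c : R) : \int[P]_w (X w ^+ 0 * (c * sin (u * X w))) = c * smom P X 0 u.
  rewrite -RintegralZl//; last by apply: integrable_smom => //; exact: all_moments_of_exp.
  by apply: eq_Rintegral => w _; ring.
pose g j := nth (fun=> 0) [:: fun x => 1 * sin (u * x); fun x => u * cos (u * x);
  fun x => - u ^+ 2 * sin (u * x); fun x => - u ^+ 3 * cos (u * x)] j.
transitivity (\int[P]_w (X w ^+ 1 * g 0%N (X w))).
  by apply: eq_Rintegral => w _; rewrite /g /= mul1r.
rewrite (@stein_identity (sin_egf u) g `|u|)//.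
- rewrite !big_ord_recl big_ord0 /= !ic !is_ /bump /=.
  by rewrite !factS fact0; field.
- exact: sin_egf_le.
move=> [[|[|[|[|//]]]] /= _] x.
- rewrite /g /= mul1r (_ : (fun n => _) = sin_egf u); first exact: egf_sin.
  by apply/funext => n; rewrite addn0.
- rewrite (_ : (fun n => _) = (fun n => u * cos_egf u n)); first by apply: egf_cvg_scale; exact: egf_cos.
  by apply/funext => n; rewrite addn1 sin_egfS.
- rewrite (_ : (fun n => _) = (fun n => - u ^+ 2 * sin_egf u n)); first by apply: egf_cvg_scale; exact: egf_sin.
  by apply/funext => n; rewrite addn2 sin_egfS cos_egfS; ring.
- rewrite (_ : (fun n => _) = (fun n => - u ^+ 3 * cos_egf u n)); first by apply: egf_cvg_scale; exact: egf_cos.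
  by apply/funext => n; rewrite addn3 sin_egfS cos_egfS sin_egfS; ring.
Qed.

Lemma mexp2E t : mexp 2 t = (kap 1 + kap 2 * t + kap 3 / 2 * t ^+ 2 + mgf_rate t ^+ 2) * mexp 0 t.
Proof.
have dr : is_derive t (1 : R) mgf_rate (kap 1 + kap 2 * t + kap 3 / 2 * t ^+ 2).
  pose p : {poly R} := (kap 0)%:P + (kap 1)%:P * 'X + (kap 2 / 2)%:P * 'X^2 + (kap 3 / 6)%:P * 'X^3.
  apply: (@is_derive_ext _ (fun x => p.[x])) => [x|]; first by rewrite /mgf_rate /p !hornerE /=; ring.
  apply: is_derive_val (is_derive_poly p t).
  by rewrite /p !(derivXn, derivX, derivC, derivD, derivB, derivN, derivM) !hornerE /=; field.
apply: etrans (is_derive_unique_ext (f := mexp 1) (g := fun x => mgf_rate x * mexp 0 x) _ (is_derive_mexp 1 t) (is_derive_mul dr (is_derive_mexp 0 t))) _.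
  exact: stein_exp.
by rewrite stein_exp; ring.
Qed.

(** Under the law tilted by [expR (t * X)], whose total mass is [mexp 0 t], the mean is [mgf_rate t]
    and the variance is its derivative. *)
Lemma tilted_variance t : \int[P]_w ((X w - mgf_rate t) ^+ 2 * expR (t * X w)) =
  (kap 1 + kap 2 * t + kap 3 / 2 * t ^+ 2) * mexp 0 t.
Proof.
set m := mgf_rate t.
transitivity (\int[P]_w ((X w ^+ 2 * expR (t * X w) + (- (2 * m)) * (X w ^+ 1 * expR (t * X w))) + m ^+ 2 * (X w ^+ 0 * expR (t * X w)))).
  by apply: eq_Rintegral => w _; ring.
have i n := integrable_mexp n t; have iz n c := integrableZ_fun c (i n).
have zE n (c : R) : \int[P]_w (c * (X w ^+ n * expR (t * X w))) = c * mexp n t by rewrite RintegralZl//; exact: i.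
rewrite RintegralD//; try (by apply: integrableD_fun; [exact: i | exact: iz]); try exact: iz.
rewrite RintegralD//; try exact: i; try exact: iz.
by rewrite !zE -/(mexp 2 t) mexp2E stein_exp -/m; ring.
Qed.

Lemma tilted_variance_ge0 t : 0 <= kap 1 + kap 2 * t + kap 3 / 2 * t ^+ 2.
Proof.
rewrite -(pmulr_lge0 _ (mexp0_gt0 t)) -tilted_variance.
by apply: Rintegral_ge0 => w _; rewrite mulr_ge0 ?sqr_ge0 ?expR_ge0.
Qed.

(** By [stein_cos] and [stein_sin] the quotient of the two sides has derivative 0 everywhere, not
    only near the origin; the formula can thus be tested at large [u]. *)
Lemma cf_modulus u : cmom P X 0 u ^+ 2 + smom P X 0 u ^+ 2 = expR (- kap 1 * u ^+ 2 + kap 3 / 12 * u ^+ 4).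
Proof.
pose p : {poly R} := (kap 1)%:P * 'X^2 - (kap 3 / 12)%:P * 'X^4.
have pE x : expR p.[x] = (expR (- kap 1 * x ^+ 2 + kap 3 / 12 * x ^+ 4))^-1.
  by rewrite -expRN; congr expR; rewrite /p !hornerE /=; ring.
pose c := cmom P X 0; pose s := smom P X 0.
have dc (x : R) : is_derive x (1 : R) c (- smom P X 1 x) by apply: is_derive_cmom => //; exact: all_moments_of_exp.
have ds (x : R) : is_derive x (1 : R) s (cmom P X 1 x) by apply: is_derive_smom => //; exact: all_moments_of_exp.
pose f x := expR p.[x] * (c x * c x + s x * s x).
have df (x : R) : is_derive x (1 : R) f 0.
  apply: is_derive_val (is_derive_mul (is_derive1_comp (is_derive_expR _) (is_derive_poly p x))
    (is_derive_add (is_derive_mul (dc x) (dc x)) (is_derive_mul (ds x) (ds x)))).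
  rewrite /GRing.scale /= stein_cos stein_sin -/(c x) -/(s x) /p !(derivXn, derivX, derivC, derivD, derivB, derivN, derivM) !hornerE /=.
  by move: (expR _) (c x) (s x) => e c' s'; field.
have f0 : f 0 = 1.
  by rewrite /f /c /s smom_0 cmom_0 /p !hornerE; under eq_Rintegral do rewrite expr0; rewrite Rintegral1 /= ?expr0n /= ?mulr0 ?subrr ?oppr0 ?addr0 expR0; ring.
have := is_derive_0_is_cst u 0 df; rewrite f0 /f pE -!expr2 => /(congr1 (fun x => expR (- kap 1 * u ^+ 2 + kap 3 / 12 * u ^+ 4) * x)).
by rewrite mulr1 mulrA divff ?mul1r// gt_eqF// expR_gt0.
Qed.

(** Each square is at most 1. The constant 2, cruder than the true bound 1, is enough to exclude
    growth. *)
Lemma cf_modulus_le2 u : cmom P X 0 u ^+ 2 + smom P X 0 u ^+ 2 <= 2.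
Proof.
have h0 := all_moments_of_exp 0.
have b (f : T -> R) : P.-integrable [set: T] (EFin \o f) -> (forall w, `|f w| <= 1) -> (\int[P]_w f w) ^+ 2 <= 1.
  move=> fi f1; rewrite -real_normK ?num_real// expr_le1//.
  apply: le_trans (le_normr_Rintegral _ fi) _ => //.
  by rewrite -[leRHS](Rintegral1 P); apply: Rintegral_ler; [exact: integrable_norm | exact: cst_integrable | exact: f1].
have -> : 2 = 1 + 1 :> R by [].
by apply: lerD; apply: b; [exact: integrable_cmom | move=> w; rewrite expr0 mul1r cos_max
  | exact: integrable_smom | move=> w; rewrite expr0 mul1r sin_max].
Qed.

Lemma cumulants_vanish : kap 2 = 0 /\ kap 3 = 0.
Proof.
have k3le : kap 3 <= 0.
  rewrite leNgt; apply/negP => k3.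
  (* A value of [u ^+ 2] at which the exponent in [cf_modulus] exceeds 1; then [expR x >= 1 + x > 2]
     contradicts the bound. *)
  pose u2 := 12 * (`|kap 1| + 1) / kap 3 + 1.
  have u20 : 0 < u2 by rewrite ltr_pwDr// divr_ge0 ?(ltW k3)// mulr_ge0// addr_ge0.
  have := cf_modulus_le2 (Num.sqrt u2); rewrite cf_modulus.
  have -> : Num.sqrt u2 ^+ 4 = u2 ^+ 2 by rewrite -[in RHS](sqr_sqrtr (ltW u20)) -exprM.
  rewrite sqr_sqrtr; last exact: ltW.
  have h : 1 < - kap 1 * u2 + kap 3 / 12 * u2 ^+ 2.
    have e : kap 3 / 12 * u2 = `|kap 1| + 1 + kap 3 / 12 by rewrite /u2; field; rewrite gt_eqF.
    have -> : - kap 1 * u2 + kap 3 / 12 * u2 ^+ 2 = (`|kap 1| - kap 1 + 1 + kap 3 / 12) * u2 by rewrite expr2 mulrA e; ring.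
    have u21 : 1 <= u2 by rewrite /u2 lerDr divr_ge0 ?(ltW k3)// mulr_ge0// addr_ge0.
    have k1 := ler_norm (kap 1).
    have : 1 < `|kap 1| - kap 1 + 1 + kap 3 / 12 by lra.
    by move=> h; apply: lt_le_trans h _; rewrite ler_peMr//; lra.
  move=> h2; have := expR_ge1Dx (- kap 1 * u2 + kap 3 / 12 * u2 ^+ 2); lra.
have k3 : kap 3 = 0.
  apply/eqP; rewrite eq_le k3le leNgt; apply/negP => k3.
  have h1 := tilted_variance_ge0 0; have h2 := tilted_variance_ge0 1.
  (* Here [kap 3 / 2 * t] equals [kap 3 / 2 - (|kap 1| + |kap 2|)], so the quadratic term outweighs
     the other two and the tilted variance would be negative. *)
  pose t := 1 + (`|kap 1| + `|kap 2|) * 2 / - kap 3.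
  have ht := tilted_variance_ge0 t.
  have nk3 : 0 < - kap 3 by rewrite oppr_gt0.
  have t1 : 1 <= t by rewrite /t lerDl divr_ge0 ?(ltW nk3)// mulr_ge0// addr_ge0.
  have e : kap 3 / 2 * t = kap 3 / 2 - (`|kap 1| + `|kap 2|) by rewrite /t; field; rewrite lt_eqF.
  have b1 := ler_norm (kap 1); have b2 := ler_norm (kap 2).
  have n1 := normr_ge0 (kap 1).
  have m1 : `|kap 1| <= `|kap 1| * t by rewrite ler_peMr.
  have m2 : kap 2 * t <= `|kap 2| * t by rewrite ler_wpM2r//; lra.
  have m3 : kap 3 / 2 * t ^+ 2 = (kap 3 / 2 - (`|kap 1| + `|kap 2|)) * t by rewrite expr2 mulrA e.
  have m4 : kap 3 / 2 * t < 0 by rewrite e; have := normr_ge0 (kap 2); lra.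
  move: ht; rewrite m3 mulrBl mulrDl; lra.
split=> //; apply/eqP/negPn/negP => k20.
(* The variance is now affine in the tilt, which is chosen to give [kap 1 - |kap 1| - 1 < 0]. *)
have := tilted_variance_ge0 (- (`|kap 1| + 1) / kap 2); rewrite k3 mul0r mul0r addr0.
have -> : kap 2 * (- (`|kap 1| + 1) / kap 2) = - (`|kap 1| + 1) by field.
have := ler_norm (kap 1); lra.
Qed.

(** With [mgf_rate] affine, the differential equation [stein_exp] integrates explicitly. The
    variance is recorded for the degenerate case [kap 1 = 0]. *)
Lemma gaussian_mgf : 0 <= kap 1 /\ (forall t : R, mexp 0 t = expR (kap 0 * t + kap 1 / 2 * t ^+ 2)) /\
  \int[P]_w (X w - kap 0) ^+ 2 = kap 1.
Proof.
have [k2 k3] := cumulants_vanish.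
have rE t : mgf_rate t = kap 0 + kap 1 * t by rewrite /mgf_rate k2 k3; ring.
have M0 : mexp 0 0 = 1.
  by rewrite /mexp -[RHS](Rintegral1 P); apply: eq_Rintegral => w _; rewrite mul0r expR0 expr0 mulr1.
split; first by have := tilted_variance_ge0 0; rewrite expr0n /= !mulr0 !addr0.
split=> [t|]; last first.
  have := tilted_variance 0; rewrite rE M0 expr0n /= !mulr0 !addr0 mulr1 => <-.
  by apply: eq_Rintegral => w _; rewrite mul0r expR0 mulr1.
pose p : {poly R} := - (kap 0)%:P * 'X - (kap 1 / 2)%:P * 'X^2.
have pE x : expR p.[x] = (expR (kap 0 * x + kap 1 / 2 * x ^+ 2))^-1.
  by rewrite -expRN; congr expR; rewrite /p !hornerE /=; ring.
pose f x := expR p.[x] * mexp 0 x.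
have df (x : R) : is_derive x (1 : R) f 0.
  apply: is_derive_val (is_derive_mul (is_derive1_comp (is_derive_expR _) (is_derive_poly p x)) (is_derive_mexp 0 x)).
  rewrite /GRing.scale /= stein_exp rE /p !(derivXn, derivX, derivC, derivD, derivB, derivN, derivM) !hornerE /=.
  by move: (expR _) (mexp 0 x) => e c'; field.
have f0 : f 0 = 1 by rewrite /f pE M0 mulr0 expr0n /= mulr0 addr0 expR0 invr1 mulr1.
have := is_derive_0_is_cst t 0 df; rewrite f0 /f pE => /(congr1 (fun x => expR (kap 0 * t + kap 1 / 2 * t ^+ 2) * x)).
by rewrite mulr1 mulrA divff ?mul1r// gt_eqF// expR_gt0.
Qed.

End stein.
End exponential_moments.

(** * From the moment generating function to the characteristic function *)

Section mgf_determines_cf.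
Context {R : realType} {d1 d2 : measure_display} {T1 : measurableType d1} {T2 : measurableType d2}.
Variables (P1 : probability T1 R) (P2 : probability T2 R) (X1 : T1 -> R) (X2 : T2 -> R).
Hypotheses (mX1 : measurable_fun [set: T1] X1) (mX2 : measurable_fun [set: T2] X2).
Hypothesis hexp1 : forall r : R, 0 <= r -> P1.-integrable [set: T1] (EFin \o (fun w => expR (r * `|X1 w|))).
Hypothesis hexp2 : forall r : R, 0 <= r -> P2.-integrable [set: T2] (EFin \o (fun w => expR (r * `|X2 w|))).
Hypothesis mgfE : forall t, mexp P1 X1 0 t = mexp P2 X2 0 t.

Lemma mexp_eq n t : mexp P1 X1 n t = mexp P2 X2 n t.
Proof.
elim: n t => [|n IH] t; first exact: mgfE.
exact: is_derive_unique_ext IH (is_derive_mexp mX1 hexp1 n t) (is_derive_mexp mX2 hexp2 n t).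
Qed.

Lemma moment_eq n : \int[P1]_w X1 w ^+ n = \int[P2]_w X2 w ^+ n.
Proof.
have := mexp_eq n 0; rewrite /mexp.
by under eq_Rintegral do rewrite mul0r expR0 mulr1; under [RHS]eq_Rintegral do rewrite mul0r expR0 mulr1.
Qed.

(** The cosine and sine series are integrated termwise, so only the moments enter, and these are
    derivatives of the moment generating function at 0. *)
Lemma cf_eq_of_mgf u : cmom P1 X1 0 u = cmom P2 X2 0 u /\ smom P1 X1 0 u = smom P2 X2 0 u.
Proof.
have bc n : `|cos_egf u n| <= 1 * `|u| ^+ n by rewrite mul1r cos_egf_le.
have bs n : `|sin_egf u n| <= 1 * `|u| ^+ n by rewrite mul1r sin_egf_le.
have c1 := @egf_limit _ _ _ P1 X1 mX1 hexp1 (cos_egf u) (fun x => cos (u * x)) 1 `|u| 0 (normr_ge0 u) bc (@egf_cos R u).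
have s1 := @egf_limit _ _ _ P1 X1 mX1 hexp1 (sin_egf u) (fun x => sin (u * x)) 1 `|u| 0 (normr_ge0 u) bs (@egf_sin R u).
have c2 := @egf_limit _ _ _ P2 X2 mX2 hexp2 (cos_egf u) (fun x => cos (u * x)) 1 `|u| 0 (normr_ge0 u) bc (@egf_cos R u).
have s2 := @egf_limit _ _ _ P2 X2 mX2 hexp2 (sin_egf u) (fun x => sin (u * x)) 1 `|u| 0 (normr_ge0 u) bs (@egf_sin R u).
have E (a : nat -> R) : (fun N => \sum_(n < N) a n / n`!%:R * \int[P1]_w X1 w ^+ (n + 0)) =
    (fun N => \sum_(n < N) a n / n`!%:R * \int[P2]_w X2 w ^+ (n + 0)).
  by apply/funext => N; apply: eq_bigr => n _; rewrite moment_eq.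
rewrite E in c1; rewrite E in s1.
by split; [exact: (cvg_unique _ c1 c2) | exact: (cvg_unique _ s1 s2)].
Qed.

End mgf_determines_cf.

(** * Gaussian laws *)

(** Tilting a normal density by [expR (t * x)] shifts its mean by [t * s ^+ 2]. *)
Lemma complete_square {R : realType} (m s t x : R) : s != 0 ->
  t * x + - (x - m) ^+ 2 / (s ^+ 2 *+ 2) =
  m * t + s ^+ 2 / 2 * t ^+ 2 + - (x - (m + t * s ^+ 2)) ^+ 2 / (s ^+ 2 *+ 2).
Proof. by move=> s0; rewrite -[s ^+ 2 *+ 2]mulr_natr; field. Qed.

Section normal_law.
Context {R : realType}.
Variables (m s : R).
Hypothesis s0 : 0 < s.
Let mu := @lebesgue_measure R.
Let N := (normal_prob m s : probability (measurableTypeR R) R).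

(** The Radon-Nikodym derivative of the normal law agrees almost everywhere with its density, both
    having the same integrals over measurable sets. *)
Lemma integral_normal_density (f : R -> R) : measurable_fun [set: R] f -> (forall x, 0 <= f x) ->
  (\int[N]_x (f x)%:E = \int[mu]_x (f x * normal_pdf m s x)%:E)%E.
Proof.
move=> mf f0; have dom := normal_prob_dominates m s.
pose g := Radon_Nikodym_SigmaFinite.f (normal_prob m s) mu.
have gi := Radon_Nikodym_SigmaFinite.f_integrable dom.
have mpdf : measurable_fun [set: measurableTypeR R] (EFin \o normal_pdf m s).
  by apply/measurable_EFinP; exact: measurable_normal_pdf.
have gE : ae_eq mu [set: measurableTypeR R] g (EFin \o normal_pdf m s).
  apply: (@integral_ae_eq _ _ _ mu setT measurableT (EFin \o normal_pdf m s) g gi mpdf).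
  by move=> E _ mE; rewrite -(Radon_Nikodym_SigmaFinite.f_integral dom mE).
have mfE : measurable_fun [set: measurableTypeR R] (EFin \o f) by exact/measurable_EFinP.
rewrite -(Radon_Nikodym_SigmaFinite.change_of_variables dom (f := EFin \o f) (E := setT)) => //.
apply: ae_eq_integral => //.
- by apply: emeasurable_funM => //; exact: measurable_int gi.
- by apply/measurable_EFinP; apply: measurable_funM => //; exact: measurable_normal_pdf.
by apply: filterS gE => x gx /gx; rewrite /g /= => ->.
Qed.

Lemma normal_mgf (t : R) : (\int[N]_x (expR (t * x))%:E = (expR (m * t + s ^+ 2 / 2 * t ^+ 2))%:E)%E.
Proof.
have sn0 : s != 0 by rewrite gt_eqF.
rewrite integral_normal_density; first last.
- by move=> x; exact: expR_ge0.
- by apply: (@measurableT_comp _ _ _ _ _ _ (@expR R)); [exact: measurable_expR | exact: measurable_funM].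
have E (x : R) : expR (t * x) * normal_pdf m s x =
    expR (m * t + s ^+ 2 / 2 * t ^+ 2) * normal_pdf (m + t * s ^+ 2) s x.
  rewrite !normal_pdfE// mulrCA [RHS]mulrCA; congr (_ * _).
  by rewrite /normal_fun -!expRD (complete_square m t x sn0).
under eq_integral do rewrite E EFinM.
rewrite ge0_integralZl//.
- by rewrite integral_normal_pdf mule1.
- by apply/measurable_EFinP; exact: measurable_normal_pdf.
- by move=> x _; rewrite lee_fin normal_pdf_ge0.
Qed.

Lemma integrable_normal_exp (t : R) : N.-integrable [set: measurableTypeR R] (EFin \o (fun x => expR (t * x))).
Proof.
apply/integrableP; split.
  by apply/measurable_EFinP; apply: (@measurableT_comp _ _ _ _ _ _ (@expR R)); [exact: measurable_expR | exact: measurable_funM].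
under eq_integral do rewrite /= ger0_norm ?expR_ge0//.
by rewrite normal_mgf ltry.
Qed.

Lemma integrable_normal_exp_abs (r : R) : 0 <= r ->
  N.-integrable [set: measurableTypeR R] (EFin \o (fun x : measurableTypeR R => expR (r * `|x|))).
Proof.
move=> r0; apply: (le_integrable_fun (g := fun x : measurableTypeR R => expR (r * x) + expR (- r * x))).
- apply: (@measurableT_comp _ _ _ _ _ _ (@expR R)); first by exact: measurable_expR.
  by apply: measurable_funM => //; exact: measurableT_comp.
- move=> x; rewrite ger0_norm ?expR_ge0//.
  have [x0|/ltW x0] := leP 0 (x : R); first by rewrite (ger0_norm x0) lerDl expR_ge0.
  by rewrite (ler0_norm x0) mulrN -mulNr lerDr expR_ge0.
- by apply: integrableD_fun; exact: integrable_normal_exp.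
Qed.

Lemma normal_mexp (t : R) : mexp N (fun x : measurableTypeR R => x) 0 t = expR (m * t + s ^+ 2 / 2 * t ^+ 2).
Proof.
rewrite /mexp; under eq_Rintegral do rewrite expr0 mul1r.
by rewrite /Rintegral normal_mgf.
Qed.

End normal_law.

Lemma Rintegral_distribution {d d' : measure_display} {T : measurableType d} {E : measurableType d'}
  {R : realType} (P : probability T R) (Y : {RV P >-> E}) (f : E -> R) (M : R) :
  measurable_fun [set: E] f -> (forall x, `|f x| <= M) ->
  \int[distribution P Y]_x f x = \int[P]_w f (Y w).
Proof.
move=> mf fM; rewrite /Rintegral; congr fine; apply: (integral_distribution (f := EFin \o f)).
  exact/measurable_EFinP.
apply: (@bounded_integrable _ _ _ P (f \o Y) M) => [|w]; last exact: fM.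
by apply: (@measurableT_comp _ _ _ _ _ _ f).
Qed.

Section gaussian_laws.
Context {d : measure_display} {T : measurableType d} {R : realType}.
Variables (P : probability T R) (X : {RV P >-> R}).

Lemma ae_cst_of_second_moment (m : R) : has_moment P (X : T -> R) 2 -> \int[P]_w (X w - m) ^+ 2 = 0 ->
  {ae P, forall w, X w = m}.
Proof.
move=> h2 v0; have mX : measurable_fun [set: T] (X : T -> R) by [].
have h1 : has_moment P (X : T -> R) 1 by apply: has_moment_le h2.
have i2 : P.-integrable [set: T] (EFin \o (fun w => (X w - m) ^+ 2)).
  rewrite (_ : (fun w => _) = (fun w => (X w ^+ 2 + (- (2 * m)) * X w ^+ 1) + m ^+ 2)); last by apply/funext => w; ring.
  by apply: integrableD_fun; [apply: integrableD_fun => //; exact: (integrableZ_fun _ h1) | exact: cst_integrable].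
have m2 : measurable_fun [set: T] (EFin \o (fun w => (X w - m) ^+ 2)).
  by apply/measurable_EFinP; exact: integrable_measurable i2.
have z : (\int[P]_w `|((X w - m) ^+ 2)%:E| = 0)%E.
  under eq_integral do rewrite /= ger0_norm ?sqr_ge0//.
  have -> : (\int[P]_w ((X w - m) ^+ 2)%:E = (\int[P]_w (X w - m) ^+ 2)%:E)%E.
    by rewrite /Rintegral fineK//; exact: (integrable_fin_num measurableT i2).
  by rewrite v0.
have /(ae_eq_integral_abs P measurableT m2) ae0 := z.
apply: filterS ae0 => w /(_ I) /= [] /eqP; rewrite sqrf_eq0 subr_eq0 => /eqP.
by [].
Qed.

Lemma gaussian_of_quartic_cf (p q : {poly R}) (rho : R) : 0 < rho -> (size p <= 5)%N -> (size q <= 5)%N ->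
  (forall u : R, `|u| < rho -> cmom P X 0 u = exp_cos p q 1 0 u) ->
  (forall u : R, `|u| < rho -> smom P X 0 u = exp_sin p q 1 0 u) -> gaussian X.
Proof.
move=> rho0 sp sq hc hs; have mX : measurable_fun [set: T] (X : T -> R) by [].
have hm := has_moment_all mX rho0 hc hs.
have rec n : \int[P]_w X w ^+ n.+1 = \sum_(j < 4) 'C(n, j)%:R * (cumulant p q j * \int[P]_w X w ^+ (n - j)).
  rewrite -(cmom_0 P X) (moment_recursion mX rho0 hc hs sp sq) !cmom_0.
  by rewrite !big_ord_recr big_ord0 /= add0r.
have hexp := integrable_exp_abs mX hm rec.
have [k0 [mgf var]] := gaussian_mgf mX hexp rec.
have [k1|k1] := eqVneq (cumulant p q 1) 0.
  left; exists (cumulant p q 0); apply: ae_cst_of_second_moment; first exact: hm.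
  by rewrite var.
have {}k0 : 0 < cumulant p q 1 by rewrite lt_neqAle eq_sym k1.
right; exists (cumulant p q 0), (Num.sqrt (cumulant p q 1)); rewrite sqrtr_gt0; split=> //.
set m := cumulant p q 0; set s := Num.sqrt _.
have s0 : 0 < s by rewrite sqrtr_gt0.
have cfE := @cf_eq_of_mgf R _ _ T (measurableTypeR R) P (normal_prob m s) X id mX (@measurable_id _ (measurableTypeR R) setT)
  hexp (integrable_normal_exp_abs m s0).
have mgfE t : mexp P X 0 t = mexp (normal_prob m s : probability (measurableTypeR R) R) (id : measurableTypeR R -> R) 0 t.
  by rewrite mgf (normal_mexp m s0) sqr_sqrtr// ltW.
have {}cfE u : cmom P X 0 u = cmom (normal_prob m s : probability (measurableTypeR R) R) id 0 u /\
    smom P X 0 u = smom (normal_prob m s : probability (measurableTypeR R) R) id 0 u.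
  have [cE sE] := cfE mgfE u; split; [exact: cE | exact: sE].
have mc (u : R) : measurable_fun [set: measurableTypeR R] (fun x : R => cos (u * x)) by exact: measurable_cosX.
have ms (u : R) : measurable_fun [set: measurableTypeR R] (fun x : R => sin (u * x)) by exact: measurable_sinX.
have mX' : measurable_fun [set: T] (X : T -> measurableTypeR R) by exact: mX.
(* The same function with codomain [measurableTypeR R], on which the uniqueness theorem is
   stated. *)
pose X' : {mfun T >-> measurableTypeR R} := HB.pack (X : T -> measurableTypeR R)
  (isMeasurableFun.Build _ _ T (measurableTypeR R) X mX').
have cosE (u : R) : \int[distribution P X']_x cos (u * x) = \int[normal_prob m s]_x cos (u * x).
  rewrite (@Rintegral_distribution _ _ _ _ _ P X' _ 1 (mc u)); last by move=> x; exact: cos_max.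
  have := (cfE u).1; rewrite /cmom; under eq_Rintegral do rewrite expr0 mul1r.
  by under [RHS]eq_Rintegral do rewrite expr0 mul1r.
have sinE (u : R) : \int[distribution P X']_x sin (u * x) = \int[normal_prob m s]_x sin (u * x).
  rewrite (@Rintegral_distribution _ _ _ _ _ P X' _ 1 (ms u)); last by move=> x; exact: sin_max.
  have := (cfE u).2; rewrite /smom; under eq_Rintegral do rewrite expr0 mul1r.
  by under [RHS]eq_Rintegral do rewrite expr0 mul1r.
move=> B mB; exact: (@eq_cf_eq_measure R (distribution P X') (normal_prob m s) cosE sinE B mB).
Qed.

End gaussian_laws.

(** * Characteristic function of weighted incomes *)

Section polar_coordinates.
Context {R : realType}.
Implicit Types (C S s t : R).

(** [C > 0] places the argument in [(- pi / 2, pi / 2)], where it is the arctangent of [S / C]. *)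
Lemma polar_form C S : 0 < C ->
  C = expR (ln (C ^+ 2 + S ^+ 2) / 2) * cos (atan (S / C)) /\
  S = expR (ln (C ^+ 2 + S ^+ 2) / 2) * sin (atan (S / C)).
Proof.
move=> C0; have Q0 : 0 < C ^+ 2 + S ^+ 2.
  have := sqr_ge0 S; have : 0 < C ^+ 2 by rewrite exprn_gt0.
  lra.
set Q := C ^+ 2 + S ^+ 2 in Q0 *.
have eE : expR (ln Q / 2) = Num.sqrt Q.
  rewrite -[LHS]ger0_norm ?expR_ge0// -sqrtr_sqr expr2 -expRD.
  by rewrite -splitr lnK.
have sQ : 0 < Num.sqrt Q by rewrite sqrtr_gt0.
have cE : cos (atan (S / C)) = C / Num.sqrt Q.
  rewrite cos_atan (_ : 1 + (S / C) ^+ 2 = Q / C ^+ 2); last by rewrite /Q; field; rewrite gt_eqF.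
  rewrite sqrtrM; last exact: ltW.
  by rewrite sqrtrV ?sqr_ge0// sqrtr_sqr gtr0_norm// invf_div.
have c0 : cos (atan (S / C)) != 0 by rewrite cE gt_eqF// divr_gt0.
have sE : sin (atan (S / C)) = S / C * cos (atan (S / C)).
  by rewrite -{2}(atanK (S / C)) /tan divfK.
rewrite eE sE cE; split; field; rewrite ?gt_eqF//.
Qed.

(** The bounds by [pi] exclude other determinations of the argument: half of [s - t] has sine 0 and
    lies strictly between [- pi] and [pi]. *)
Lemma polar_unique (A B s t : R) : `|s| < pi -> `|t| < pi ->
  expR A * cos s = expR B * cos t -> expR A * sin s = expR B * sin t -> A = B /\ s = t.
Proof.
move=> hs ht cE sE.
have e2 : expR A ^+ 2 = expR B ^+ 2.
  have E (D u : R) : expR D ^+ 2 = (expR D * cos u) ^+ 2 + (expR D * sin u) ^+ 2.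
    by rewrite !exprMn -mulrDr cos2Dsin2 mulr1.
  by rewrite (E A s) (E B t) cE sE.
have eAB : expR A = expR B.
  by apply/eqP; rewrite -(@eqrXn2 _ 2)// ?expR_ge0//; apply/eqP.
split; first exact: expR_inj.
have e0 : expR B != 0 by rewrite gt_eqF// expR_gt0.
rewrite eAB in cE sE; move/(mulfI e0): cE => cE; move/(mulfI e0): sE => sE.
pose h := (s - t) / 2.
have hpi : `|h| < pi.
  rewrite /h normrM [X in _ * X]gtr0_norm ?invr_gt0// ltr_pdivrMr//.
  by apply: le_lt_trans (ler_normB _ _) _; lra.
have : cos (h *+ 2) = 1.
  have -> : h *+ 2 = s - t by rewrite /h -mulr_natr; field.
  by rewrite cosB cE sE -!expr2 cos2Dsin2.
rewrite cos_mulr2n cos2sin2 => ch.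
have sh : sin h = 0.
  apply/eqP; rewrite -sqrf_eq0; apply/eqP; move: ch; rewrite -mulr_natr; lra.
suff h0 : h = 0 by move: h0; rewrite /h; lra.
have [h0|h0|//] := ltrgt0P h.
- have := @sin_gt0_pi R h; rewrite h0 sh ltxx => H; suff : false by []. 
  by apply: H; move: hpi; rewrite gtr0_norm.
- have := @sin_gt0_pi R (- h); rewrite oppr_gt0 h0 sinN sh oppr0 ltxx => H; suff : false by [].
  by apply: H; move: hpi; rewrite ltr0_norm.
Qed.

End polar_coordinates.

(** * The characteristic function of one shock pair near the origin *)

Section pair_cf.
Context {d : measure_display} {T : measurableType d} {R : realType}.
Variables (P : probability T R) (U V : T -> R).
Hypotheses (mU : measurable_fun [set: T] U) (mV : measurable_fun [set: T] V).

Definition pair_cos x y := \int[P]_w cos (x * U w + y * V w).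
Definition pair_sin x y := \int[P]_w sin (x * U w + y * V w).
Definition pair_ln x y := ln (pair_cos x y ^+ 2 + pair_sin x y ^+ 2) / 2.
Definition pair_arg x y := atan (pair_sin x y / pair_cos x y).

Lemma measurable_pair (x y : R) : measurable_fun [set: T] (fun w => x * U w + y * V w).
Proof. by apply: measurable_funD; exact: measurable_funM. Qed.

(** For [|x|] and [|y|] below [1 / m.+1] both integrands are at most the minimum of 2 and
    [(|U| + |V|) / m.+1]. This bound is uniform in [(x, y)], and its integral tends to 0 by
    dominated convergence without any moment. *)
Lemma pair_cf_near0 (e : R) : 0 < e -> exists2 r : R, 0 < r & forall x y : R, `|x| < r -> `|y| < r ->
  `|pair_cos x y - 1| < e /\ `|pair_sin x y| < e.
Proof.
move=> e0; pose Z w := `|U w| + `|V w|.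
have Z0 w : 0 <= Z w by rewrite addr_ge0.
have mZ : measurable_fun [set: T] Z by apply: measurable_funD; exact: measurableT_comp.
pose f (m : nat) w := Num.min 2 (Z w * m.+1%:R^-1).
have f0 m w : 0 <= f m w by rewrite le_min ler0n mulr_ge0 ?invr_ge0.
have mf m : measurable_fun [set: T] (f m).
  by apply: measurable_minr => //; exact: measurable_funM.
have f2 m w : `|f m w| <= 2 by rewrite ger0_norm// ge_min lexx.
have cf w : f ^~ w @ \oo --> (0 : R).
  have c : (fun m : nat => Z w * m.+1%:R^-1) @ \oo --> (0 : R).
    by rewrite -(mulr0 (Z w)); apply: cvgM; [exact: cvg_cst | exact: cvg_harmonic].
  have sq : \forall m \near \oo, (fun=> 0 : R) m <= f m w <= (fun m : nat => Z w * m.+1%:R^-1) m.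
    by apply: nearW => m; rewrite f0 /f ge_min lexx orbT.
  exact: (squeeze_cvgr sq (cvg_cst 0) c).
have [_ cv] := Rintegral_dominated mf (cst_integrable P 2) cf f2.
have /cvgrPdist_lt /(_ e e0) [N _ hN] := cv.
have {hN} := hN N (leqnn N); rewrite Rintegral1 sub0r normrN => hN.
have fi : P.-integrable [set: T] (EFin \o f N) by exact: (bounded_integrable P (mf N) (f2 N)).
have n0 : 0 < N.+1%:R^-1 :> R by rewrite invr_gt0.
exists N.+1%:R^-1 => // x y hx hy.
have thN w : `|x * U w + y * V w| <= Z w * N.+1%:R^-1.
  apply: le_trans (ler_normD _ _) _; rewrite !normrM /Z mulrDl.
  by apply: lerD; rewrite mulrC ler_wpM2l// ltW.
have bound (g : T -> R) : measurable_fun [set: T] g -> (forall w, `|g w| <= 2) ->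
    (forall w, `|g w| <= `|x * U w + y * V w|) -> `|\int[P]_w g w| < e.
  move=> mg g2 gth; have gi : P.-integrable [set: T] (EFin \o g) by exact: (bounded_integrable P mg g2).
  apply: le_lt_trans (le_normr_Rintegral _ gi) _ => //.
  apply: (@le_lt_trans _ _ (\int[P]_w f N w)); last by apply: le_lt_trans hN; exact: ler_norm.
  apply: Rintegral_ler => //; first exact: integrable_norm.
  by move=> w; rewrite /f le_min g2 /=; exact: le_trans (gth w) (thN w).
have mth := measurable_pair x y.
have mcos : measurable_fun [set: T] (fun w => cos (x * U w + y * V w)).
  by apply: (@measurableT_comp _ _ _ _ _ _ (@cos R)) => //; exact: measurable_cosR.
have msin : measurable_fun [set: T] (fun w => sin (x * U w + y * V w)).
  by apply: (@measurableT_comp _ _ _ _ _ _ (@sin R)) => //; exact: measurable_sinR.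
split; last first.
  apply: bound => // w; last exact: norm_sin_le.
  by apply: le_trans (sin_max _) _; lra.
have -> : pair_cos x y - 1 = \int[P]_w (cos (x * U w + y * V w) - 1).
  rewrite RintegralB//; first by rewrite Rintegral1.
  - by apply: (@bounded_integrable _ _ _ P _ 1) => // w; exact: cos_max.
  - exact: cst_integrable.
apply: bound => [|w|w].
- by apply: measurable_funB.
- by have := cos_max (x * U w + y * V w); rewrite !ler_norml => /andP[? ?]; apply/andP; split; lra.
set t := x * U w + y * V w; have -> : cos t - 1 = - (2 * sin (t / 2) ^+ 2).
  have tE : t = (t / 2) *+ 2 by rewrite -mulr_natr; field.
  by rewrite {1}tE cos_mulr2n cos2sin2 -mulr_natr; ring.
rewrite normrN normrM normrX (ger0_norm (ler0n R 2)) expr2 mulrA.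
have s1 := norm_sin_le (t / 2); have s2 := sin_max (t / 2).
rewrite normrM [X in _ <= _ * X]ger0_norm ?invr_ge0// in s1.
apply: (@le_trans _ _ (2 * `|sin (t / 2)|)); last by lra.
by rewrite ler_piMr// mulr_ge0.
Qed.

(** The bounds on the argument and the log-modulus also serve as the boundedness hypothesis of
    Frechet's theorem. *)
Lemma pair_phase_near0 (e : R) : 0 < e -> exists2 r : R, 0 < r & forall x y : R, `|x| < r -> `|y| < r ->
  [/\ 0 < pair_cos x y, `|pair_arg x y| < e & `|pair_ln x y| <= ln 4].
Proof.
move=> e0; have [h h0 hat] : exists2 h : R, 0 < h & forall z : R, `|z| < h -> `|atan z| < e.
  have /cvgrPdist_lt/(_ e e0)/nbhs_ballP[h /= h0 hh] := @continuous_atan R 0.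
  exists h => // z zh; have := hh z; rewrite atan0 sub0r normrN; apply.
  by rewrite /ball /= sub0r normrN.
(* The first bound keeps [pair_cos] between 3/4 and 5/4; the second then keeps the tangent of the
   argument below [h]. *)
pose c := Num.min (1 / 4) (h / 2).
have c0 : 0 < c by rewrite lt_min !divr_gt0.
have [r r0 hr] := pair_cf_near0 c0; exists r => // x y hx hy.
have [] := hr x y hx hy; rewrite !lt_min /pair_arg /pair_ln.
set C := pair_cos x y; set S := pair_sin x y.
move=> /andP[C4 _] /andP[S4 Sh].
have [C1 C2] : 3 / 4 < C /\ C < 5 / 4 by move: C4; rewrite ltr_norml => /andP[? ?]; split; lra.
have C0 : 0 < C by lra.
split=> //.
  apply: hat; rewrite normrM normfV (gtr0_norm C0) ltr_pdivrMr//.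
  apply: lt_le_trans Sh _.
  have -> : h / 2 = h * (1 / 2) by field.
  by rewrite ler_pM2l//; lra.
set Q := C ^+ 2 + S ^+ 2.
have S2 : S ^+ 2 <= 1.
  by rewrite -real_normK ?num_real// expr_le1//; lra.
have Q1 : 4^-1 <= Q.
  have : (3 / 4) ^+ 2 <= C ^+ 2 by rewrite ler_sqr ?nnegrE; lra.
  by have := sqr_ge0 S; rewrite /Q; lra.
have Q2 : Q <= 4.
  have : C ^+ 2 <= (5 / 4) ^+ 2 by rewrite ler_sqr ?nnegrE; lra.
  by rewrite /Q; lra.
have Q0 : 0 < Q by apply: lt_le_trans Q1; rewrite invr_gt0.
have l1 : ln Q <= ln 4 by rewrite ler_ln ?posrE.
have l2 : - ln 4 <= ln Q by rewrite -lnV ?posrE// ler_ln ?posrE ?invr_gt0.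
have l3 : 0 <= ln 4 :> R by rewrite ln_ge0// ler1n.
by rewrite ler_norml; apply/andP; split; lra.
Qed.

End pair_cf.

(** * Incomes as sums over independent shocks *)

Section income_decomposition.
Context {d : measure_display} {O : measurableType d} {R : realType}.
Variables (P : probability O R) (q n : nat) (a : nat -> R).
Variables (xi : int -> {RV P >-> R}) (eta : nat -> {RV P >-> R}).

Definition date (k : nat) : int := k%:Z + 1 - q%:Z.
Definition shock_index (s : int) : nat := absz (s + q%:Z - 1)%R.

Lemma dateK k : shock_index (date k) = k.
Proof. rewrite /shock_index /date; lia. Qed.

Lemma shock_indexK s : 1 - q%:Z <= s -> date (shock_index s) = s.
Proof. rewrite /shock_index /date; lia. Qed.

Lemma permanent_loads i w : (i < n)%N ->
  \sum_(k < q + n) yload q k i * eta `|date k|%N w = permanent eta i.+1 w.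
Proof.
move=> i_n; rewrite -(big_mkord xpredT (fun k => yload q k i * eta `|date k|%N w)).
rewrite (@big_cat_nat _ _ _ q)//=; last by rewrite leq_addr.
rewrite big_nat big1 ?add0r; last first.
  by move=> k /andP[_ kq]; rewrite /yload leqNgt kq /= mul0r.
rewrite (@big_cat_nat _ _ _ (i + q).+1)/=; [|by rewrite leqW// leq_addl | by lia].
rewrite [X in _ + X]big_nat [X in _ + X]big1 ?addr0; last first.
  by move=> k /andP[ki _]; rewrite /yload [(k <= _)%N]leqNgt ki andbF mul0r.
rewrite /permanent big_add1 /= -{1}[q]add0n big_addn.
have -> : ((i + q).+1 - q)%N = i.+1 by lia.
apply: eq_big_nat => s /andP[_ si].
rewrite /yload leq_addl /= leq_add2r -ltnS si mul1r.
by have -> : `|date (s + q)|%N = s.+1 by rewrite /date; lia.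
Qed.

Lemma transitory_loads i w : (i < n)%N ->
  \sum_(k < q + n) xload q a k i * xi (date k) w = transitory q a xi i.+1 w.
Proof.
move=> i_n; rewrite -(big_mkord xpredT (fun k => xload q a k i * xi (date k) w)).
rewrite (@big_cat_nat _ _ _ i)//=; last by lia.
rewrite big_nat big1 ?add0r; last first.
  move=> k /andP[_ ki]; rewrite /xload /ma_coef leq_eqVlt ltn_addr ?orbT//.
  have kq : (q < i + q - k)%N by lia.
  by rewrite gtn_eqF ?(leq_ltn_trans _ kq)// [(_ <= q)%N]leqNgt kq mul0r.
rewrite (@big_cat_nat _ _ _ (i + q).+1)/=; [|by lia | by lia].
rewrite [X in _ + X]big_nat [X in _ + X]big1 ?addr0; last first.
  by move=> k /andP[ki _]; rewrite /xload leqNgt ki /= mul0r.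
rewrite -{1}[i]add0n big_addn.
have -> : ((i + q).+1 - i)%N = q.+1 by lia.
rewrite big_nat_rev /= big_ltn// /transitory; congr (_ + _).
  have -> : (0 + q.+1 - 1 + i)%N = (i + q)%N by lia.
  rewrite /xload leqnn subnn /ma_coef /= mul1r.
  by have -> : date (i + q) = i.+1%:Z by rewrite /date; lia.
apply: eq_big_nat => j /andP[j1 jq]; have {}jq : (j <= q)%N by [].
have -> : (0 + q.+1 - j.+1 + i)%N = (i + q - j)%N by lia.
rewrite /xload leq_subr subKn; last by lia.
rewrite /ma_coef gtn_eqF// jq.
by have -> : date (i + q - j) = i.+1%:Z - j%:Z by rewrite /date; lia.
Qed.

Lemma weighted_income (l : seq (nat * R)) w : all (fun p => p.1 < n)%N l ->
  \sum_(p <- l) p.2 * income q a xi eta p.1.+1 w =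
  \sum_(k < q + n) (xlin q a k l * xi (date k) w + ylin q k l * eta `|date k|%N w).
Proof.
elim: l => [_|p l IH /= /andP[hp hl]].
  by rewrite big_nil big1// => k _; rewrite /xlin /ylin !big_nil !mul0r addr0.
rewrite big_cons IH// /income -(permanent_loads w hp) -(transitory_loads w hp).
rewrite mulrDr !mulr_sumr -!big_split /=; apply: eq_bigr => k _.
by rewrite /xlin /ylin !big_cons; ring.
Qed.

(** This lets shocks dated 0 or earlier, whose [shock_sigma] is generated by [xi] alone, be treated
    as pairs: the [eta] formally attached to them gets coefficient 0. *)
Lemma ylin_before k (l : seq (nat * R)) : (k < q)%N -> ylin q k l = 0.
Proof. by move=> kq; rewrite /ylin big1// => p _; rewrite /yload leqNgt kq mulr0. Qed.

Definition shock_ln k := pair_ln P (xi (date k)) (eta `|date k|%N).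
Definition shock_arg k := pair_arg P (xi (date k)) (eta `|date k|%N).

Lemma cf_weighted_income (l : seq (nat * R)) : shocks_indep q n xi eta -> all (fun p => p.1 < n)%N l ->
  (forall k, (k < q + n)%N -> 0 < pair_cos P (xi (date k)) (eta `|date k|%N) (xlin q a k l) (ylin q k l)) ->
  let L := \sum_(k < q + n) shock_ln k (xlin q a k l) (ylin q k l) in
  let A := \sum_(k < q + n) shock_arg k (xlin q a k l) (ylin q k l) in
  \int[P]_w cos (\sum_(p <- l) p.2 * income q a xi eta p.1.+1 w) = expR L * cos A /\
  \int[P]_w sin (\sum_(p <- l) p.2 * income q a xi eta p.1.+1 w) = expR L * sin A.
Proof.
move=> ind hl pos L A.
pose X s := xlin q a (shock_index s) l; pose Y s := ylin q (shock_index s) l.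
pose th s w := X s * xi s w + Y s * eta `|s|%N w.
pose D := [set s : int | 1 - q%:Z <= s <= n%:Z].
have idx s : D s -> (shock_index s < q + n)%N /\ date (shock_index s) = s.
  by move=> /andP[s1 sn]; split; [rewrite /shock_index; lia | exact: shock_indexK].
have Fm s (E : set O) : D s -> shock_sigma xi eta s E -> measurable E.
  move=> _; rewrite /shock_sigma; case: ifP => _ [B mB <-].
    exact: (measurable_funPT (xi s) measurableT B mB).
  have mp : measurable_fun [set: O] (fun w => (xi s w, eta `|s|%N w)) by exact: measurable_fun_pair.
  exact: (mp measurableT B mB).
have thF s (B : set R) : D s -> measurable B -> shock_sigma xi eta s (th s @^-1` B).
  move=> Ds mB; rewrite /shock_sigma; case: ifP => s0.
    exists ((fun x : R => X s * x) @^-1` B).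
      have mx : measurable_fun [set: R] (fun x : R => X s * x) by exact: measurable_funM.
      by have := mx measurableT B mB; rewrite setTI.
    rewrite setTI; apply/seteqP; split=> w /=; rewrite /th /Y ylin_before ?mul0r ?addr0//;
      by move: Ds => /andP[]; rewrite /shock_index; lia.
  exists ((fun z : R * R => X s * z.1 + Y s * z.2) @^-1` B); last by rewrite setTI.
  have mx : measurable_fun [set: R * R] (fun z : R * R => X s * z.1 + Y s * z.2).
    by apply: measurable_funD; exact: measurable_funM.
  by have := mx measurableT B mB; rewrite setTI. 
have pol s : D s -> \int[P]_w cos (th s w) = expR (shock_ln (shock_index s) (X s) (Y s)) * cos (shock_arg (shock_index s) (X s) (Y s)) /\
    \int[P]_w sin (th s w) = expR (shock_ln (shock_index s) (X s) (Y s)) * sin (shock_arg (shock_index s) (X s) (Y s)).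
  move=> /idx[ks sE].
  have thE w : th s w = X s * xi (date (shock_index s)) w + Y s * eta `|date (shock_index s)|%N w by rewrite /th sE.
  have [cE sE'] := polar_form (pair_sin P (xi (date (shock_index s))) (eta `|date (shock_index s)|%N) (X s) (Y s)) (pos _ ks).
  split.
    transitivity (pair_cos P (xi (date (shock_index s))) (eta `|date (shock_index s)|%N) (X s) (Y s)); last exact: cE.
    by apply: eq_Rintegral => w _; rewrite thE.
  transitivity (pair_sin P (xi (date (shock_index s))) (eta `|date (shock_index s)|%N) (X s) (Y s)); last exact: sE'.
  by apply: eq_Rintegral => w _; rewrite thE.
have [] := @indep_phases _ _ _ P _ D (shock_sigma xi eta) th (fun s => shock_ln (shock_index s) (X s) (Y s))
  (fun s => shock_arg (shock_index s) (X s) (Y s)) ind Fm thF (fun s h => (pol s h).1) (fun s h => (pol s h).2)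
  [seq date k | k <- iota 0 (q + n)].
- rewrite map_inj_uniq ?iota_uniq//; apply: can_inj; exact: dateK.
- by move=> s /mapP[k]; rewrite mem_iota => /andP[_ kq] ->; rewrite /D /= /date; apply/andP; split; lia.
have bigE (f : int -> R) : \sum_(s <- [seq date k | k <- iota 0 (q + n)]) f s = \sum_(k < q + n) f (date k).
  by rewrite big_map -(big_mkord xpredT (fun k => f (date k))) /index_iota subn0.
rewrite !bigE => cE sE.
have LE : \sum_(k < q + n) shock_ln (shock_index (date k)) (X (date k)) (Y (date k)) = L.
  by apply: eq_bigr => k _; rewrite /X /Y dateK.
have AE : \sum_(k < q + n) shock_arg (shock_index (date k)) (X (date k)) (Y (date k)) = A.
  by apply: eq_bigr => k _; rewrite /X /Y dateK.
rewrite LE AE in cE sE.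
have thE w : \sum_(p <- l) p.2 * income q a xi eta p.1.+1 w = \sum_(s <- [seq date k | k <- iota 0 (q + n)]) th s w.
  by rewrite bigE weighted_income//; apply: eq_bigr => k _; rewrite /th /X /Y dateK.
by split; under eq_Rintegral do rewrite thE.
Qed.

Lemma xlin_le k (l : seq (nat * R)) : `|xlin q a k l| <= (1 + \sum_(j < q.+1) `|a j|) * \sum_(p <- l) `|p.2|.
Proof.
rewrite mulr_sumr; apply: le_trans (ler_norm_sum _ _ _) _; apply: ler_sum => p _.
rewrite normrM mulrC ler_wpM2r// /xload /ma_coef.
have s0 : 0 <= \sum_(j < q.+1) `|a j| by rewrite sumr_ge0.
case: ifP => _; last by rewrite normr0 addr_ge0.
case: ifP => _; first by rewrite normr1 lerDl.
case: ifP => [jq|_]; last by rewrite normr0 addr_ge0.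
rewrite (bigD1 (Ordinal (jq : (_ < q.+1)%N)))//= addrCA lerDl addr_ge0// sumr_ge0//.
Qed.

Lemma ylin_le k (l : seq (nat * R)) : `|ylin q k l| <= \sum_(p <- l) `|p.2|.
Proof.
apply: le_trans (ler_norm_sum _ _ _) _; apply: ler_sum => p _.
by rewrite normrM ler_piMr// /yload; case: (_ && _); rewrite ?normr0 ?normr1.
Qed.

Lemma shocks_near0 (e : R) N : 0 < e -> exists2 r : R, 0 < r & forall k, (k < N)%N -> forall x y : R, `|x| < r -> `|y| < r ->
  [/\ 0 < pair_cos P (xi (date k)) (eta `|date k|%N) x y, `|shock_arg k x y| < e & `|shock_ln k x y| <= ln 4].
Proof.
move=> e0; elim: N => [|N [r1 r10 IH]]; first by exists 1.
have mxi : measurable_fun [set: O] (xi (date N)) by [].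
have meta : measurable_fun [set: O] (eta `|date N|%N) by [].
have [r2 r20 h2] := @pair_phase_near0 _ _ _ P _ _ mxi meta e e0.
exists (Num.min r1 r2); first by rewrite lt_min r10.
move=> k; rewrite ltnS leq_eqVlt => /orP[/eqP ->|kN] x y; rewrite !lt_min => /andP[? ?] /andP[? ?].
  exact: h2.
exact: IH.
Qed.

End income_decomposition.

(** * From observational equivalence to the balance equations *)

Lemma obs_equivalent_Rintegral {R : realType} (q n : nat)
    {d1 : measure_display} {O1 : measurableType d1} {P1 : probability O1 R}
    (a1 : nat -> R) (xi1 : int -> {RV P1 >-> R}) (eta1 : nat -> {RV P1 >-> R})
    {d2 : measure_display} {O2 : measurableType d2} {P2 : probability O2 R}
    (a2 : nat -> R) (xi2 : int -> {RV P2 >-> R}) (eta2 : nat -> {RV P2 >-> R})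
    (l : seq (nat * R)) (f : R -> R) :
  obs_equivalent q n a1 xi1 eta1 a2 xi2 eta2 -> all (fun p => p.1 < n)%N l ->
  measurable_fun [set: R] f -> (forall x, `|f x| <= 1) ->
  \int[P1]_w f (\sum_(p <- l) p.2 * income q a1 xi1 eta1 p.1.+1 w) =
  \int[P2]_w f (\sum_(p <- l) p.2 * income q a2 xi2 eta2 p.1.+1 w).
Proof.
(* The default 0 of [nth] is never reached, since [hl] keeps the periods below [n]. *)
move=> eqv hl mf f1; pose g (v : n.-tuple R) := \sum_(p <- l) p.2 * nth 0 v p.1.
have mg : measurable_fun [set: n.-tuple R] g.
  rewrite /g; elim: l hl {g} => [_|p l IH /= /andP[hp hl]].
    by rewrite (_ : (fun v => _) = fun=> 0); [exact: measurable_cst | apply/funext => v; rewrite big_nil].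
  rewrite (_ : (fun v => _) = fun v : n.-tuple R => p.2 * tnth v (Ordinal hp) + \sum_(p' <- l) p'.2 * nth 0 v p'.1); last first.
    by apply/funext => v; rewrite big_cons (tnth_nth 0).
  apply: measurable_funD; last exact: IH.
  by apply: measurable_funM => //; exact: measurable_tnth.
have mfg : measurable_fun [set: n.-tuple R] (f \o g) by exact: (@measurableT_comp _ _ _ _ _ _ f).
have gE d (O : measurableType d) (P : probability O R) (a : nat -> R) (xi : int -> {RV P >-> R}) (eta : nat -> {RV P >-> R}) w :
    g (observed q n a xi eta w) = \sum_(p <- l) p.2 * income q a xi eta p.1.+1 w.
  rewrite /g; elim: l hl {g mg mfg} => [_|p l IH /= /andP[hp hl]]; first by rewrite !big_nil.
  by rewrite !big_cons IH// (nth_mktuple _ _ (Ordinal hp)).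
transitivity (\int[distribution P1 (observed q n a1 xi1 eta1)]_v (f \o g) v).
  rewrite (@Rintegral_distribution _ _ _ _ _ P1 (observed q n a1 xi1 eta1) (f \o g) 1 mfg); last by move=> x; exact: f1.
  by apply: eq_Rintegral => w _; rewrite /= gE.
transitivity (\int[distribution P2 (observed q n a2 xi2 eta2)]_v (f \o g) v).
  rewrite /Rintegral; congr fine; apply: eq_measure_integral => A mA _; exact: eqv.
rewrite (@Rintegral_distribution _ _ _ _ _ P2 (observed q n a2 xi2 eta2) (f \o g) 1 mfg); last by move=> x; exact: f1.
by apply: eq_Rintegral => w _; rewrite /= gE.
Qed.

Lemma diffs_vanish5 {R : realType} (f : R -> R) :
  (exists2 r : R, 0 < r & forall z d1 d2 d3 d4 d5 : R, `|z| < r -> `|d1| < r ->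
    `|d2| < r -> `|d3| < r -> `|d4| < r -> `|d5| < r -> diffs [:: d1; d2; d3; d4; d5] f z = 0) ->
  diffs_vanish 5 f.
Proof.
move=> [r r0 H]; exists r => // -[|d1 [|d2 [|d3 [|d4 [|d5 [|]]]]]]//= x _.
by move=> /and5P[h1 h2 h3 h4 /andP[h5 _]] hx; exact: H.
Qed.

Theorem theorem1 (R : realType) (q n : nat) (hq : (1 <= q)%N)
    (hn : (q + 3 <= n)%N)
    (d1 : measure_display) (O1 : measurableType d1) (P1 : probability O1 R)
    (a1 : nat -> R) (xi1 : int -> {RV P1 >-> R}) (eta1 : nat -> {RV P1 >-> R})
    (d2 : measure_display) (O2 : measurableType d2) (P2 : probability O2 R)
    (a2 : nat -> R) (xi2 : int -> {RV P2 >-> R}) (eta2 : nat -> {RV P2 >-> R})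
    (indep1 : shocks_indep q n xi1 eta1)
    (indep2 : shocks_indep q n xi2 eta2)
    (a1_first : a1 1%N \notin [:: 0; 1]) (a1_last : a1 q \notin [:: 0; 1])
    (a2_first : a2 1%N \notin [:: 0; 1]) (a2_last : a2 q \notin [:: 0; 1])
    (xi1_nongaussian : ~ gaussian (xi1 1))
    (xi2_nongaussian : ~ gaussian (xi2 1))
    (equiv : obs_equivalent q n a1 xi1 eta1 a2 xi2 eta2) :
  forall j : nat, (1 <= j <= q)%N -> a2 j = a1 j.
Proof.
move=> j jq; apply/eqP/negPn/negP => aj; apply: xi1_nongaussian.
rewrite eq_sym in aj.
have [a10 a11] : a1 1%N != 0 /\ a1 1%N != 1 by move: a1_first; rewrite !inE negb_or => /andP[].
have aq1 : a1 q != 0 by move: a1_last; rewrite !inE negb_or => /andP[].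
have aq2 : a2 q != 0 by move: a2_last; rewrite !inE negb_or => /andP[].
(* A sum of [q + n] arguments below [e] stays below [pi], so arguments add up without wrapping
   around and [polar_unique] applies. *)
pose e : R := pi / (q + n).+1%:R.
have e0 : 0 < e by rewrite divr_gt0 ?pi_gt0.
have [r1 r10 near1] := @shocks_near0 _ _ _ P1 q xi1 eta1 e (q + n) e0.
have [r2 r20 near2] := @shocks_near0 _ _ _ P2 q xi2 eta2 e (q + n) e0.
pose K (a : nat -> R) := 1 + \sum_(j < q.+1) `|a j|.
have K1 a : 1 <= K a by rewrite /K lerDl sumr_ge0.
(* [K a] bounds all loads, so weights of total size below [rho] keep the linear forms of both
   structures within [r1] and [r2]. *)
pose rho := Num.min r1 r2 / (K a1 + K a2).
have KK : 0 < K a1 + K a2 by have := K1 a1; have := K1 a2; lra.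
have rho0 : 0 < rho by rewrite divr_gt0// lt_min r10.
have small l a (r : R) k : \sum_(p <- l) `|p.2| < rho -> K a <= K a1 + K a2 -> Num.min r1 r2 <= r ->
    `|xlin q a k l| < r /\ `|ylin q k l| < r.
  move=> sl Ka rr; have S0 : 0 <= \sum_(p <- l) `|p.2| by rewrite sumr_ge0.
  have SK : (K a1 + K a2) * \sum_(p <- l) `|p.2| < r.
    by apply: lt_le_trans rr; rewrite mulrC -ltr_pdivlMr.
  split; apply: le_lt_trans SK.
    by apply: le_trans (xlin_le q a k l) _; rewrite -/(K a) ler_wpM2r.
  apply: le_trans (ylin_le q k l) _; rewrite ler_peMl//.
  by have := K1 a1; have := K1 a2; lra.
have sum_arg (f : nat -> R) : (forall k, (k < q + n)%N -> `|f k| < e) -> `|\sum_(k < q + n) f k| < pi.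
  move=> fe; apply: (@le_lt_trans _ _ (\sum_(k < q + n) e)).
    by apply: le_trans (ler_norm_sum _ _ _) _; apply: ler_sum => k _; apply: ltW; exact: fe.
  rewrite sumr_const card_ord -[_ *+ _]mulr_natr /e mulrAC ltr_pdivrMr ?ltr0n//.
  by rewrite ltr_pM2l ?pi_gt0// ltr_nat.
have bal l : all (fun p => p.1 < n)%N l -> \sum_(p <- l) `|p.2| < rho ->
    \sum_(k < q + n) shock_ln q xi1 eta1 k (xlin q a1 k l) (ylin q k l) =
    \sum_(k < q + n) shock_ln q xi2 eta2 k (xlin q a2 k l) (ylin q k l) /\
    \sum_(k < q + n) shock_arg q xi1 eta1 k (xlin q a1 k l) (ylin q k l) =
    \sum_(k < q + n) shock_arg q xi2 eta2 k (xlin q a2 k l) (ylin q k l).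
  move=> hl sl.
  have l1 k : `|xlin q a1 k l| < r1 /\ `|ylin q k l| < r1.
    by apply: small => //; [have := K1 a2; lra | rewrite ge_min lexx].
  have l2 k : `|xlin q a2 k l| < r2 /\ `|ylin q k l| < r2.
    by apply: small => //; [have := K1 a1; lra | rewrite ge_min lexx orbT].
  have n1 k hk := near1 k hk _ _ (l1 k).1 (l1 k).2.
  have n2 k hk := near2 k hk _ _ (l2 k).1 (l2 k).2.
  have [|c1 s1] := @cf_weighted_income _ _ _ P1 q n a1 xi1 eta1 l indep1 hl.
    by move=> k hk; have [] := n1 k hk.
  have [|c2 s2] := @cf_weighted_income _ _ _ P2 q n a2 xi2 eta2 l indep2 hl.
    by move=> k hk; have [] := n2 k hk.
  apply: polar_unique.
  - by apply: (sum_arg (fun k => shock_arg q xi1 eta1 k (xlin q a1 k l) (ylin q k l))) => k hk; have [] := n1 k hk.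
  - by apply: (sum_arg (fun k => shock_arg q xi2 eta2 k (xlin q a2 k l) (ylin q k l))) => k hk; have [] := n2 k hk.
  - by rewrite -c1 -c2; apply: (obs_equivalent_Rintegral equiv hl); [exact: measurable_cosR | exact: cos_max].
  - by rewrite -s1 -s2; apply: (obs_equivalent_Rintegral equiv hl); [exact: measurable_sinR | exact: sin_max].
have balln : balanced q n a1 a2 (shock_ln q xi1 eta1) (shock_ln q xi2 eta2) rho by move=> l hl sl; exact: (bal l hl sl).1.
have balarg : balanced q n a1 a2 (shock_arg q xi1 eta1) (shock_arg q xi2 eta2) rho by move=> l hl sl; exact: (bal l hl sl).2.
have Vln := diffs_vanish5 (balanced_diffs5 hq hn rho0 jq aj a10 a11 aq1 aq2 balln).
have Varg := diffs_vanish5 (balanced_diffs5 hq hn rho0 jq aj a10 a11 aq1 aq2 balarg).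
have qq : (q < q + n)%N by rewrite -[X in (X < _)%N]addn0 ltn_add2l (leq_trans _ hn)// addn3.
have nearq (u : R) (hu : `|u| < r1) : [/\ 0 < pair_cos P1 (xi1 (date q q)) (eta1 `|date q q|%N) u 0,
    `|shock_arg q xi1 eta1 q u 0| < e & `|shock_ln q xi1 eta1 q u 0| <= ln 4].
  by apply: near1 => //; rewrite normr0.
have [|p sp [rp rp0 pE]] := diffs_vanish_poly Vln.
  by exists r1 => //; exists (ln 4) => u /nearq[].
have [|g sg [rg rg0 gE]] := diffs_vanish_poly Varg.
  by exists r1 => //; exists e => u /nearq[_ /ltW].
have dq : date q q = 1 by rewrite /date addrAC subrr add0r.
have cf (u : R) : `|u| < Num.min r1 (Num.min rp rg) ->
    cmom P1 (xi1 1) 0 u = exp_cos p g 1 0 u /\ smom P1 (xi1 1) 0 u = exp_sin p g 1 0 u.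
  rewrite !lt_min => /andP[ur1 /andP[urp urg]]; have [pos _ _] := nearq u ur1.
  have [cE sE] := polar_form (pair_sin P1 (xi1 (date q q)) (eta1 `|date q q|%N) u 0) pos.
  rewrite -/(pair_ln _ _ _ _ _) -/(pair_arg _ _ _ _ _) in cE sE.
  rewrite -/(shock_ln q xi1 eta1 q u 0) -/(shock_arg q xi1 eta1 q u 0) pE// gE// in cE sE.
  have -> : exp_cos p g 1 0 u = expR p.[u] * cos g.[u].
    by rewrite /exp_cos -polyC1 hornerC horner0; ring.
  have -> : exp_sin p g 1 0 u = expR p.[u] * sin g.[u].
    by rewrite /exp_sin -polyC1 hornerC horner0; ring.
  rewrite -cE -sE /pair_cos /pair_sin dq /cmom /smom.
  by split; apply: eq_Rintegral => w _; rewrite mul0r addr0 expr0 mul1r.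
apply: (@gaussian_of_quartic_cf _ _ _ P1 (xi1 1) p g (Num.min r1 (Num.min rp rg))) => //.
- by rewrite !lt_min r10 rp0.
- by move=> u /cf[].
- by move=> u /cf[].
Qed.
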